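(* Let $\mu^{\mathrm{big}}_{i_0}$ be the measure on $\mathcal H^2\times\Omega_{i_0}^3\times V^2\times\mathcal T^2$ defined in the context. The marginal (image measure) of $(\kappa,v,i_1,T)$ with respect to $\mu^{\mathrm{big}}_{i_0}$ equals the following probability measure on $\mathcal H\times\Omega_{i_0}\times V\times\mathcal T$: $$\mu_{i_0}^{\mathrm{single}}(d\kappa\,dv\,di_1\,dT)=\rho_{i_0}^{\mathrm{single}}(\kappa,v,i_1,T)\,d\kappa_{\mathcal H}\prod_{i\in V\setminus\{i_0\}}dv_i\cdot di_1\,dT,$$ with density $$\rho_{i_0}^{\mathrm{single}}(\kappa,v,i_1,T)=\frac1{\pi^{|E|}}\exp\Big(\sum_{\{i,j\}\in E}W_{ij}(1-\cosh(v_i-v_j))\Big)\prod_{\{i,j\}\in E\setminus T}\frac1{W_{ij}e^{v_i+v_j}}\cdot\exp\Big(-\sum_{(i,j)\in\vec E}\frac{\kappa_{ij}^2}{W_{ij}e^{v_i+v_j}}\Big)\frac{e^{2v_{i_1}}}{\sum_{i\in V}e^{2v_i}}\prod_{i\in V\setminus\{i_0\}}e^{-v_i}.$$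
   Context: Let $G=(V,E)$ be a finite connected undirected graph (edges are two-element subsets $\{i,j\}$ of $V$), with weights $W_{ij}=W_{ji}>0$ for $\{i,j\}\in E$. Let $\vec E=\{(i,j):\{i,j\}\in E\}$ be the set of directed edges. Fix $i_0\in V$ and let $\Omega_{i_0}=\{u\in\mathbb R^V:u_{i_0}=0\}$. Let $\mathcal T$ be the set of undirected spanning trees of $G$, each viewed as a set of undirected edges. Let $\mathcal H$ be the linear space of all $\kappa=(\kappa_{ij})_{(i,j)\in\vec E}\in\mathbb R^{\vec E}$ with $\sum_{j:\{i,j\}\in E}(\kappa_{ij}-\kappa_{ji})=0$ for all $i\in V$. Take any directed spanning tree $\vec T_0\subset\vec E$ (a spanning tree with each edge given one direction). The restriction map $\iota:\mathcal H\to\mathbb R^{\vec E\setminus\vec T_0}$ is an isomorphism; $d\kappa_{\mathcal H}$ is the image under $\iota^{-1}$ of Lebesgue measure on $\mathbb R^{\vec E\setminus\vec T_0}$ (it does not depend on $\vec T_0$). For $u\in\Omega_{i_0}$ put $\omega'_{ij}=\frac{W_{ij}}2e^{u_i+u_j}$. For $\kappa,\kappa'\in\mathbb R^{\vec E}$, $s,v,u\in\Omega_{i_0}$, $i_1,i_1'\in V$, $T,T'\in\mathcal T$ let $$\rho^{\mathrm{big}}_{i_0}(\kappa,\kappa',s,v,u,i_1,i_1',T,T')=\frac{4^{|V|-1}}{(2\pi)^{2|E|}}\exp\Big(\sum_{\{i,j\}\in E}W_{ij}\big(1-\cosh(u_i-u_j)-\tfrac12e^{u_i+u_j}(s_i-s_j)^2\big)\Big)\prod_{\{i,j\}\in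 T}\omega'_{ij}\prod_{\{i,j\}\in T'}\omega'_{ij}\prod_{\{i,j\}\in E}\frac1{(\omega'_{ij})^2}$$ $$\cdot\exp\Big(-\sum_{(i,j)\in\vec E}\frac{\kappa_{ij}^2+(\kappa'_{ij})^2}{2\omega'_{ij}}\Big)\frac{e^{2v_{i_1}+2u_{i_1'}}}{\sum_{i\in V}e^{2v_i}\sum_{j\in V}e^{2u_j}}\prod_{i\in V\setminus\{i_0\}}e^{-u_i}.$$ The measure $\mu^{\mathrm{big}}_{i_0}$ on $\mathcal H^2\times\Omega_{i_0}^3\times V^2\times\mathcal T^2$ (variables $(\kappa,\kappa',s,v,u,i_1,i_1',T,T')$) is $$\mu^{\mathrm{big}}_{i_0}=\rho^{\mathrm{big}}_{i_0}\,d\kappa_{\mathcal H}\,d\kappa'_{\mathcal H}\prod_{i\in V\setminus\{i_0\}}1_{\{u_i=v_i\}}\,ds_i\,du_i\cdot di_1\,di_1'\,dT\,dT',$$ where $1_{\{u_i=v_i\}}du_i$ is the Lebesgue measure on the diagonal of $\mathbb R^2$ (the image of $du_i$ under $u_i\mapsto(v_i,u_i)=(u_i,u_i)$), $ds_i,du_i,dv_i$ are Lebesgue measure on $\mathbb R$, and $di_1,di_1',dT,dT'$ are counting measures. *)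

(* Defs.v *)
From HB Require Import structures.
From mathcomp Require Import all_boot all_order all_algebra.
From mathcomp Require Import all_classical all_reals all_analysis.

Set Implicit Arguments.
Unset Strict Implicit.
Unset Printing Implicit Defensive.

Import Order.TTheory GRing.Theory Num.Theory.
Import numFieldNormedType.Exports.

Local Open Scope classical_set_scope.
Local Open Scope ring_scope.

(* A type with the sigma-algebra of all its subsets. MathComp-Analysis asks
   measurable spaces to be pointed; [x0] only serves that purpose. *)
Definition discrete_space (T : choiceType) (x0 : T) : Type := T.

Section discrete_space.
Variables (T : choiceType) (x0 : T).
HB.instance Definition _ := Choice.on (discrete_space x0).
HB.instance Definition _ := isPointed.Build (discrete_space x0) x0.
HB.instance Definition _ := @isMeasurable.Build default_measure_display
  (discrete_space x0) discrete_measurable discrete_measurable0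
  discrete_measurableC discrete_measurableU.
End discrete_space.

Definition ffun_display : measure_display -> measure_display.
Proof. exact. Qed.

(* T^I carries the product sigma-algebra. *)
Section ffun_measurable.
Context (I : finType) {d} {T : measurableType d}.

Definition ffun_measurable : set (set {ffun I -> T}) :=
  <<s \bigcup_(i in [set: I])
        preimage_set_system setT (fun x : {ffun I -> T} => x i) measurable >>.

Let ffun_measurable0 : ffun_measurable set0.
Proof. exact: sigma_algebra0. Qed.

HB.instance Definition _ :=
  isPointed.Build {ffun I -> T} [ffun _ => point].

Let ffun_measurableC A : ffun_measurable A -> ffun_measurable (~` A).
Proof. exact: sigma_algebraC. Qed.

Let ffun_measurable_bigcup (F : (set {ffun I -> T})^nat) :
  (forall k, ffun_measurable (F k)) -> ffun_measurable (\bigcup_k F k).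
Proof. exact: sigma_algebra_bigcup. Qed.

HB.instance Definition _ := @isMeasurable.Build (ffun_display d)
  {ffun I -> T} ffun_measurable
  ffun_measurable0 ffun_measurableC ffun_measurable_bigcup.

End ffun_measurable.

Fixpoint lebesgue_tuple (R : realType) (n : nat) :
    set (n.-tuple (measurableTypeR R)) -> \bar R :=
  match n with
  | 0 => \d_ [tuple]
  | m.+1 => pushforward (@lebesgue_measure R \x @lebesgue_tuple R m)%E
              (fun x => [tuple of x.1 :: x.2])
  end.

Definition lebesgue_ffun (R : realType) (I : finType) :
    set {ffun I -> measurableTypeR R} -> \bar R :=
  pushforward (@lebesgue_tuple R #|I|)
    (fun x => [ffun i => tnth x (enum_rank i)]).

(* For bijective [coord], the preimage of [B] under the inverse of [coord] is
   [coord @` B]: this is the image of Lebesgue measure under that inverse. *)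
Definition lebesgue_coord (R : realType) (X : Type) (I : finType)
    (coord : X -> {ffun I -> measurableTypeR R}) (B : set X) : \bar R :=
  lebesgue_ffun (coord @` B).

Section graphs.
Variable V : finType.
Implicit Types E F T : {set {set V}}.

Definition adj F : rel V := fun i j => [set i; j]%SET \in F.

Definition connected_edges F : bool := [forall i, forall j, connect (adj F) i j].

(* For edge sets without loops, a duplicate-free closed walk with at most two
   vertices is empty or runs along an edge and back. *)
Definition acyclic_edges F : bool :=
  `[< forall c : seq V, ucycle (adj F) c -> (size c <= 2)%N >].

Definition is_spanning_tree E T : bool :=
  [&& T \subset E, connected_edges T & acyclic_edges T].

Definition stree E : Type := {T : {set {set V}} | is_spanning_tree E T}.
HB.instance Definition _ E := Finite.on (stree E).

Definition darc E : Type := {a : V * V | [set a.1; a.2]%SET \in E}.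
HB.instance Definition _ E := Finite.on (darc E).
HB.instance Definition _ E := SubType.on (darc E).

Definition src E (a : darc E) : V := (val a).1.
Definition tgt E (a : darc E) : V := (val a).2.
Definition arc_edge E (a : darc E) : {set V} := [set src a; tgt a]%SET.

Fact rev_arc_subproof E (a : darc E) : [set tgt a; src a]%SET \in E.
Proof. by rewrite finset.setUC; exact: (valP a). Qed.

Definition rev_arc E (a : darc E) : darc E :=
  exist (fun p : V * V => [set p.1; p.2]%SET \in E) (tgt a, src a)
    (rev_arc_subproof a).

Definition is_directed_spanning_tree E (T0 : {set darc E}) : bool :=
  is_spanning_tree E [set arc_edge a | a in T0]%SET
  && [forall a in T0, rev_arc a \notin T0].

Definition dtree E : Type := {T0 : {set darc E} | is_directed_spanning_tree T0}.

Definition undirected E (T0 : dtree E) : stree E :=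
  exist (is_spanning_tree E) _ (proj1 (andP (valP T0))).

(* The value at the edge {i, j} of a symmetric function f of i and j. *)
Definition on_edge (R : realType) (f : V -> V -> R) (e : {set V}) : R :=
  if enum e is [:: i; j] then f i j else 0.

End graphs.

Section spaces.
Variables (R : realType) (V : finType) (E : {set {set V}}) (i0 : V).

Definition vertex_space : Type := discrete_space i0.
HB.instance Definition _ := Measurable.on vertex_space.

Definition tree_space (T0 : dtree E) : Type := discrete_space (undirected T0).
HB.instance Definition _ T0 := Measurable.on (tree_space T0).

Definition is_flow (k : {ffun darc E -> measurableTypeR R}) : bool :=
  [forall i, \sum_(a : darc E | src a == i) (k a - k (rev_arc a)) == 0].

Definition flow : Type := {k : {ffun darc E -> measurableTypeR R} | is_flow k}.

Definition pinned : Type := {u : {ffun V -> measurableTypeR R} | u i0 == 0}.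

Fact flow0_subproof : is_flow [ffun _ => 0].
Proof. by apply/forallP => i; rewrite big1// => a _; rewrite !ffunE subrr. Qed.

Fact pinned0_subproof : ([ffun _ => 0] : {ffun V -> measurableTypeR R}) i0 == 0.
Proof. by rewrite ffunE. Qed.

(* Both subspaces carry the trace sigma-algebra. *)
HB.instance Definition _ := Choice.on flow.
HB.instance Definition _ := SubType.on flow.
HB.instance Definition _ := isPointed.Build flow (exist is_flow _ flow0_subproof).
HB.instance Definition _ := Measurable.copy flow
  (g_sigma_algebra_preimageType (val : flow -> {ffun darc E -> measurableTypeR R})).

HB.instance Definition _ := Choice.on pinned.
HB.instance Definition _ := SubType.on pinned.
HB.instance Definition _ := isPointed.Build pinned
  (exist (fun u : {ffun V -> measurableTypeR R} => u i0 == 0) _ pinned0_subproof).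
HB.instance Definition _ := Measurable.copy pinned
  (g_sigma_algebra_preimageType (val : pinned -> {ffun V -> measurableTypeR R})).

Definition flow_restr (T0 : dtree E) (k : flow) :
    {ffun {a : darc E | a \notin val T0} -> measurableTypeR R} :=
  [ffun a => val k (val a)].

Definition flow_measure (T0 : dtree E) : set flow -> \bar R :=
  lebesgue_coord (flow_restr T0).

Definition pinned_restr (u : pinned) :
    {ffun {i : V | i != i0} -> measurableTypeR R} :=
  [ffun i => val u (val i)].

Definition pinned_measure : set pinned -> \bar R := lebesgue_coord pinned_restr.

End spaces.

Arguments pinned_measure R {V} i0.

Section densities.
Variables (R : realType) (V : finType) (E : {set {set V}}).
Variables (W : V -> V -> R) (i0 : V).

Definition cosh (x : R) : R := (expR x + expR (- x)) / 2.

Definition omega' (u : V -> R) (i j : V) : R := W i j / 2 * expR (u i + u j).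

Definition rho_big (k k' : darc E -> R) (s v u : V -> R) (i1 i1' : V)
    (T T' : {set {set V}}) : R :=
  4 ^+ (#|V|.-1) / (2 * pi) ^+ (2 * #|E|)%N
  * expR (\sum_(e in E) on_edge (fun i j =>
      W i j * (1 - cosh (u i - u j)
               - 2^-1 * expR (u i + u j) * (s i - s j) ^+ 2)) e)
  * (\prod_(e in T) on_edge (omega' u) e)
  * (\prod_(e in T') on_edge (omega' u) e)
  * (\prod_(e in E) (on_edge (omega' u) e ^+ 2)^-1)
  * expR (- \sum_(a : darc E)
      (k a ^+ 2 + k' a ^+ 2) / (2 * omega' u (src a) (tgt a)))
  * (expR (2 * v i1 + 2 * u i1')
     / ((\sum_(i : V) expR (2 * v i)) * (\sum_(j : V) expR (2 * u j))))
  * \prod_(i : V | i != i0) expR (- u i).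

Definition rho_single (k : darc E -> R) (v : V -> R) (i1 : V)
    (T : {set {set V}}) : R :=
  (pi ^+ #|E|)^-1
  * expR (\sum_(e in E) on_edge (fun i j => W i j * (1 - cosh (v i - v j))) e)
  * (\prod_(e in E :\: T) (on_edge (fun i j => W i j * expR (v i + v j)) e)^-1)
  * expR (- \sum_(a : darc E)
      k a ^+ 2 / (W (src a) (tgt a) * expR (v (src a) + v (tgt a))))
  * (expR (2 * v i1) / \sum_(i : V) expR (2 * v i))
  * \prod_(i : V | i != i0) expR (- v i).

End densities.

Section measures.
Variables (R : realType) (V : finType) (E : {set {set V}}).
Variables (W : V -> V -> R) (i0 : V) (T0 : dtree E).

Notation H := (flow R E).
Notation Omega := (pinned R i0).
Notation vert := (vertex_space i0).
Notation tree := (tree_space T0).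

Definition big_space : Type :=
  (H * H * Omega * Omega * Omega * vert * vert * tree * tree)%type.
HB.instance Definition _ := Measurable.on big_space.

Definition single_space : Type := (H * Omega * vert * tree)%type.
HB.instance Definition _ := Measurable.on single_space.

(* The factor 1_{u_i = v_i} du_i puts Lebesgue measure on the diagonal v = u. *)
Definition diag_vu
    (x : H * H * Omega * Omega * vert * vert * tree * tree) : big_space :=
  let: (k, k', s, u, i1, i1', T, T') := x in
  (k, k', s, u, u, i1, i1', T, T').

Definition ref_big : set big_space -> \bar R :=
  pushforward
    (flow_measure T0 \x flow_measure T0
     \x pinned_measure R i0 \x pinned_measure R i0
     \x counting \x counting \x counting \x counting)%E
    diag_vu.

Definition mu_big (A : set big_space) : \bar R :=
  (\int[ref_big]_(x in A)
     let: (k, k', s, v, u, i1, i1', T, T') := x in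
     (rho_big W i0 (val k) (val k') (val s) (val v) (val u) i1 i1'
        (val T) (val T'))%:E)%E.

Definition ref_single : set single_space -> \bar R :=
  (flow_measure T0 \x pinned_measure R i0 \x counting \x counting)%E.

Definition mu_single (A : set single_space) : \bar R :=
  (\int[ref_single]_(x in A)
     let: (k, v, i1, T) := x in
     (rho_single W i0 (val k) (val v) i1 (val T))%:E)%E.

Definition marginal (x : big_space) : single_space :=
  let: (k, _, _, v, _, i1, _, T, _) := x in (k, v, i1, T).

End measures.

Arguments mu_big {R V E} W i0 T0.
Arguments mu_single {R V E} W i0 T0.
Arguments marginal {R V E} i0 T0.

(* Main.v *)
Require Import Defs.
From HB Require Import structures.
From mathcomp Require Import all_boot all_order all_algebra.
From mathcomp Require Import fingroup perm ring lra.
From mathcomp Require Import all_classical all_reals all_analysis measurable_realfun.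

Set Implicit Arguments.
Unset Strict Implicit.
Unset Printing Implicit Defensive.

Import Order.TTheory GRing.Theory Num.Theory.
Import numFieldNormedType.Exports.

Local Open Scope classical_set_scope.
Local Open Scope ring_scope.

(* At fixed (kappa, u, i_1, T) put c_e = W_e e^(u_i + u_j) and let D be the sum
   over the spanning trees S of prod_(e in S) c_e. The integral over s is
   Gaussian, its matrix is the Laplacian reduced at i_0, and the determinant of
   that matrix is D by the matrix-tree theorem. The integral over kappa' is
   Gaussian on H; in off-tree coordinates its matrix has determinant
   2^(|V|-1) D / prod_e c_e^2, by Sylvester's determinant identity and because
   the reduced incidence matrix of a tree has determinant +1 or -1. The sum over
   T' is D / 2^(|V|-1), so the powers of D cancel.

   That the single marginal has mass 1 reduces, by the same computations, to
     int exp(sum_e W_e (1 - cosh(u_i - u_j))) sqrt(D) prod_i e^(-u_i) du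
       = (2 pi)^((|V|-1)/2).
   Here D prod_i e^(-2 u_i) is the determinant of a Schroedinger operator, and
   the vertices other than i_0 are eliminated one at a time. Let 0 be the first
   of them, eta_i the weight joining i to i_0, a = eta_0 + sum_k W_0k e^(u_k)
   and A = eta_0 + sum_k W_0k. The substitution u_0 = ln a - tau makes the
   first pivot e^tau; the Schur
   complement is then the Schroedinger operator of the model on the remaining
   vertices with weights W_ij + W_0i W_0j e^(-tau), which depend on tau only, and
   the energy splits off (e^(tau/2) - A e^(-tau/2))^2 / 2. By Tonelli the
   remaining integral is known by induction, and
     int e^(tau/2) exp(-(e^(tau/2) - A e^(-tau/2))^2 / 2) dtau = sqrt(2 pi). *)

(** * Spanning trees as rooted parent functions *)

(** Each Gaussian integral over circulations costs D^(-1/2). In the big measure the s-integral costs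
    a second D^(-1/2), and the sum over T' pays for both. In the single measure only the sum over T
    is available, so sqrt(D) survives and the u-integral is not Gaussian. The induction that
    evaluates it closes because it ranges over a class larger than weighted graphs: symmetric
    nonnegative weights together with a root weight eta, where nondegeneracy of the Schroedinger
    operator replaces connectedness. Eliminating a vertex joins its neighbours to each other and
    stays in this class. Taking the logarithm of the pivot as variable in place of u_0 decouples it
    from the remaining field. The constant A drops out of the last integral because the reflection
    tau -> 2 ln A - tau exchanges e^(tau/2) and A e^(-tau/2), and the mean of these two is the
    derivative of their difference. The factor 2^(|V|-1) in the determinant on H arises because each
    undirected edge carries two arcs, so that the Laplacian appears twice. The powers of pi match
    because H has dimension 2|E| - (|V|-1). *)

Section parent_functions.
Variables (V : finType) (i0 : V).
Implicit Types (f g : {ffun V -> V}) (E T : {set {set V}}).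

(** Orienting the edges of a spanning tree towards [i0] turns it into a function, which is the form
    in which trees come out of a determinant expansion. *)
Definition rooted f : bool := (f i0 == i0) && [forall i, fconnect f i i0].

Definition parent_edges f : {set {set V}} := [set [set i; f i] | i in predC1 i0]%SET.

Lemma rooted_root f : rooted f -> f i0 = i0.
Proof. by case/andP=> /eqP. Qed.

Lemma rootedP f i : rooted f -> exists n, iter n f i = i0.
Proof.
by case/andP=> _ /forallP/(_ i) h; exists (findex f i i0); exact: iter_findex.
Qed.

(** Descent along orbits: a property handed from child to parent would reach the root after finitely
    many steps. *)
Lemma rooted_ind f (P : V -> Prop) : rooted f ->
  (forall i, i != i0 -> P i -> i != i0 /\ P (f i)) -> ~ P i0 -> forall i, ~ P i.
Proof.
move=> rf Pf P0 i Pi; have [n ni] := rootedP i rf.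
have : P (iter n f i).
  elim: n {ni} => //= n IH; have [e|ne] := eqVneq (iter n f i) i0.
    by rewrite e in IH.
  by case: (Pf _ ne IH).
by rewrite ni.
Qed.

Lemma rooted_neq f i : rooted f -> i != i0 -> f i != i.
Proof.
move=> rf ii0; apply/eqP => fi; have [n] := rootedP i rf.
suff -> : iter n f i = i by move/eqP: ii0.
by elim: n => //= n ->.
Qed.

(** The orbit of [i] would stay in the pair [i], [f i] and miss the root. Excluding 2-cycles is what
    makes an edge determine its child endpoint. *)
Lemma rooted_neq2 f i : rooted f -> i != i0 -> f (f i) != i.
Proof.
move=> rf ii0; apply/eqP => ffi.
have : ~ (i = i \/ i = f i); last by move=> h; apply: h; left.
apply: (rooted_ind (P := fun j => j = i \/ j = f i) rf).
- move=> j ji0 [->|->]; rewrite ?ffi; split => //; [right|rewrite ?ji0|left] => //.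
  by apply: contra ji0 => /eqP e; move: ffi; rewrite e rooted_root// => e2; rewrite -e2 eqxx in ii0.
- case=> e; first by rewrite e eqxx in ii0.
  by move: ffi; rewrite -e rooted_root// => e2; rewrite e2 eqxx in ii0.
Qed.

Lemma set2_eq (a b c d : V) : [set a; b]%SET = [set c; d]%SET ->
  (a = c /\ b = d) \/ (a = d /\ b = c).
Proof.
move=> e.
have ha : a \in [set c; d]%SET by rewrite -e !inE eqxx.
have hb : b \in [set c; d]%SET by rewrite -e !inE eqxx orbT.
have hc : c \in [set a; b]%SET by rewrite e !inE eqxx.
have hd : d \in [set a; b]%SET by rewrite e !inE eqxx orbT.
move: ha hb hc hd; rewrite !inE.
by do 4! (case/orP => /eqP ?); subst; auto.
Qed.

Lemma parent_edge_inj f : rooted f ->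
  {in predC1 i0 &, injective (fun i => [set i; f i]%SET)}.
Proof.
move=> rf i j; rewrite !inE => ii0 ji0 /set2_eq[[]//|[e1 e2]].
by have := rooted_neq2 rf ii0; rewrite e2 -e1 eqxx.
Qed.

Lemma adj_parent_edges f i j :
  adj (parent_edges f) i j -> (i != i0 /\ j = f i) \/ (j != i0 /\ i = f j).
Proof.
case/imsetP => k; rewrite !inE => ki0 /set2_eq[[-> ->]|[-> ->]]; by [left|right].
Qed.

Lemma adjC T : symmetric (adj T).
Proof. by move=> i j; rewrite /adj finset.setUC. Qed.

Lemma connect_parent_edges f : rooted f -> connected_edges (parent_edges f).
Proof.
move=> rf.
have cs : connect_sym (adj (parent_edges f)).
  by apply: sym_connect_sym; exact: adjC.
have c0 i : connect (adj (parent_edges f)) i i0.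
  have [n] := rootedP i rf; elim: n i => [i <-//|n IH i].
  rewrite iterSr => /IH; have [->//|ii0] := eqVneq i i0.
  apply: connect_trans; apply: connect1.
  by apply/imsetP; exists i; rewrite ?inE.
apply/forallP => i; apply/forallP => j; apply: connect_trans (c0 i) _.
by rewrite cs.
Qed.

(** On a cycle, a vertex of maximal depth has both neighbours at most as deep, so both are its
    parent. A duplicate-free cycle through three or more vertices has distinct neighbours there. *)
Lemma acyclic_parent_edges f : rooted f -> acyclic_edges (parent_edges f).
Proof.
move=> rf; apply/asboolP => c /andP[cc uc].
have dP i : exists n, iter n f i == i0.
  by have [n e] := rootedP i rf; exists n; apply/eqP.
pose dep i := ex_minn (dP i).
have dep0 : dep i0 = 0%N.
  by rewrite /dep; case: ex_minnP => n _ /(_ 0%N (eqxx _)); rewrite leqn0 => /eqP.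
have depS i : i != i0 -> dep i = (dep (f i)).+1.
  move=> ii0; rewrite /dep; case: ex_minnP => n /eqP hn mn.
  case: ex_minnP => n' /eqP hn' mn'.
  case: n hn mn => [/= e|n hn mn]; first by rewrite e eqxx in ii0.
  apply/eqP; rewrite eqn_leq; apply/andP; split.
    by apply: mn; rewrite iterSr hn'.
  by rewrite ltnS; apply: mn'; rewrite -iterSr hn.
rewrite leqNgt; apply/negP => sc.
have [x xc xmax] : exists2 x, x \in c & forall y, y \in c -> (dep y <= dep x)%N.
  case: c {cc uc} sc => // y0 c _.
  case: (@arg_maxnP _ y0 (mem (y0 :: c)) dep); first by rewrite inE mem_head.
  by move=> x xc xm; exists x => // y yc; exact: xm.
have par y : y \in c -> adj (parent_edges f) x y -> y = f x.
  move=> yc /adj_parent_edges[[]//|[yi0 e]].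
  by have := xmax _ yc; rewrite (depS _ yi0) -e ltnn.
have e1 : next c x = f x.
  by apply: par; [rewrite mem_next|exact: next_cycle].
have e2 : prev c x = f x.
  by apply: par; [rewrite mem_prev|rewrite adjC; exact: prev_cycle].
(* Once the cycle is rotated to start at [x], [next] is its second vertex and [prev] its last
   one. *)
case/rot_to: xc => i c' rc.
have uc' : uniq (x :: c') by rewrite -rc rot_uniq.
have sc' : (2 < size (x :: c'))%N by rewrite -rc size_rot.
move: e1 e2; rewrite -(next_rot i uc) -(prev_rot i uc) rc.
case: c' {rc} uc' sc' => [//|y [//|z c']] uc' _.
rewrite prev_nth !inE eqxx.
have /memNindex -> : x \notin [:: y, z & c'] by case/andP: uc'.
rewrite /= eqxx => <- e.
have : nth x (z :: c') (size c') \in z :: c' by rewrite mem_nth.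
by case/and3P: uc' => _ /negP + _; rewrite -[y in y \in _]e => h /h.
Qed.

Lemma spanning_parent_edges E f : rooted f -> parent_edges f \subset E ->
  is_spanning_tree E (parent_edges f).
Proof.
by move=> rf fE; rewrite /is_spanning_tree fE connect_parent_edges ?acyclic_parent_edges.
Qed.

(** Where [f] and [g] differ, [g] must run the edge {i, f i} backwards, so they differ at [f i] as
    well; the disagreement would travel to the root, where they agree. *)
Lemma parent_edges_inj f g : rooted f -> rooted g ->
  parent_edges f = parent_edges g -> f = g.
Proof.
move=> rf rg efg.
have step (h k : {ffun V -> V}) i : rooted h -> rooted k -> parent_edges h = parent_edges k ->
    i != i0 -> h i != k i -> k (h i) = i /\ h i != i0.
  move=> rh rk e ii0 hk.
  have : [set i; h i]%SET \in parent_edges k by rewrite -e; apply/imsetP; exists i; rewrite ?inE.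
  case/imsetP => j; rewrite !inE => ji0 /set2_eq[[? ?]|[e1 e2]].
    by subst j; rewrite (_ : h i = k i) ?eqxx in hk.
  by rewrite e2 -e1.
apply/ffunP => i; apply/eqP/negP => /negP.
apply: (rooted_ind (P := fun i => f i != g i) rf) => [j ji0 hj|].
  split=> //; have [gf fi0] := step _ _ _ rf rg efg ji0 hj.
  by rewrite gf rooted_neq2.
by move/negP; rewrite !rooted_root ?eqxx.
Qed.

(** Each vertex takes as parent a neighbour strictly closer to the root, with distance measured by
    the shortest path. *)
Lemma connected_parent F : connected_edges F ->
  exists2 f, rooted f & parent_edges f \subset F.
Proof.
move=> cF.
have dP i : exists n, [exists p : n.-tuple V, path (adj F) i p && (last i p == i0)].
  have /connectP[p pp e] : connect (adj F) i i0 by move/forallP: cF => /(_ i)/forallP/(_ i0).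
  by exists (size p); apply/existsP; exists (in_tuple p); rewrite /= pp -e eqxx.
pose dep i := ex_minn (dP i).
have parP i : exists j, (i != i0) ==> adj F i j && (dep j < dep i)%N.
  have [->|ii0] := eqVneq i i0; first by exists i0.
  rewrite /dep; case: ex_minnP => n /existsP[p /andP[pp /eqP lp]] mn.
  case: n p pp lp mn => [p|n p].
    by rewrite tuple0/= => _ e; rewrite e eqxx in ii0.
  case/tupleP: p => j p /= /andP[aij pp] lp mn; exists j; rewrite aij/=.
  case: ex_minnP => n' _; apply.
  by apply/existsP; exists p; rewrite pp lp eqxx.
pose f := [ffun i => if i == i0 then i0 else xchoose (parP i)].
have fP i : i != i0 -> adj F i (f i) && (dep (f i) < dep i)%N.
  move=> ii0; rewrite ffunE ifN//.
  by have /implyP/(_ ii0) := xchooseP (parP i).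
have f0 : f i0 = i0 by rewrite ffunE ifT.
exists f; last first.
  by apply/fintype.subsetP => e /imsetP[i ii0 ->]; case/andP: (fP i ii0).
rewrite /rooted f0 eqxx/=; apply/forallP => i.
move: {2}(dep i).+1 (ltnSn (dep i)) => n; elim: n i => // n IH i.
rewrite ltnS => hi; have [->//|ii0] := eqVneq i i0.
apply: connect_trans (connect1 _) (IH (f i) _); first exact/eqP.
by case/andP: (fP i ii0) => _ /leq_trans; exact.
Qed.

(** A connected [T] contains the edges of a parent function. Any further edge of [T] would close a
    path of these edges to a cycle, so there is none. *)
Lemma spanning_treeP E T : (forall e : {set V}, e \in E -> #|e| = 2%N) -> is_spanning_tree E T ->
  exists2 f, rooted f & T = parent_edges f.
Proof.
move=> E2 /and3P[TE cT /asboolP aT].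
have [f rf fT] := connected_parent cT; exists f => //.
apply/eqP; rewrite finset.eqEsubset fT andbT; apply/fintype.subsetP => e eT.
have /eqP/cards2P[x [y [xy exy]]] : #|e| = 2%N by apply: E2; exact: (fintype.subsetP TE) _ eT.
rewrite exy in eT *; apply/negP => /negP nf {exy}.
have /connectP[p pp ey] : connect (adj (parent_edges f)) x y.
  by move/forallP: (connect_parent_edges rf) => /(_ x)/forallP/(_ y).
move: ey; case/shortenP: pp => {}p pp up _ ey.
(* The edge from [y] back to [x] closes the simple path [x :: p] to a cycle in [T]; acyclicity then
   leaves only x = y or a path of one step, which is itself a parent edge. *)
have : (size (x :: p) <= 2)%N.
  apply: aT; rewrite /ucycle up andbT /= rcons_path -ey.
  rewrite adjC {2}/adj eT andbT; apply: sub_path pp => i j.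
  exact: (fintype.subsetP fT).
case: p pp up ey => [|z [|//]]/=.
  by move=> _ _ yx; rewrite yx eqxx in xy.
by move=> /andP[a _] _ yz _; rewrite yz -[_ \in _]/(adj (parent_edges f) x z) a in nf.
Qed.

End parent_functions.

(** * The matrix-tree theorem *)

Section matrix_tree.
Variables (V : finType) (i0 : V).

Notation nonroot := {i : V | i != i0}.
Notation m := #|{: nonroot}|.

(** Matrices take ordinal indices, so the vertices that index the reduced matrices are
    enumerated. *)
Definition nr (p : 'I_m) : V := val (enum_val p).

Lemma nr_neq p : nr p != i0. Proof. exact: (valP (enum_val p)). Qed.

Lemma nr_inj : injective nr.
Proof. by move=> p q /val_inj/enum_val_inj. Qed.

Lemma nr_rank (k : nonroot) : nr (enum_rank k) = val k.
Proof. by rewrite /nr enum_rankK. Qed.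

Lemma nr_onto i : i != i0 -> exists p, i = nr p.
Proof. by move=> ii0; exists (enum_rank (exist _ i ii0)); rewrite nr_rank. Qed.

Lemma big_nonroot (T : Type) (idx : T) (op : Monoid.com_law idx) (F : V -> T) :
  \big[op/idx]_(i | i != i0) F i = \big[op/idx]_p F (nr p).
Proof.
rewrite (reindex_omap nr (fun i => omap enum_rank (insub i : option nonroot))).
  apply: eq_bigl => p; rewrite nr_neq/= insubT ?nr_neq// => h /=.
  by apply/eqP; congr Some; apply: nr_inj; rewrite nr_rank.
by move=> i ii0; rewrite insubT/= nr_rank.
Qed.

Lemma card_nonroot : m = #|V|.-1.
Proof. by rewrite card_sig; have := cardC1 i0; rewrite -/(predC1 i0) => <-; apply: eq_card. Qed.

Variable F : fieldType.

(** The identity minus the transition matrix of [f], with row and column of the root deleted. *)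
Definition parent_mx (f : V -> V) : 'M[F]_m :=
  \matrix_(p, q) ((p == q)%:R - (f (nr p) == nr q)%:R).

(** In a nonzero term of the expansion, every index moved by the permutation is moved along [f]. The
    moved indices would then be closed under [f] and never reach the root, so only the identity
    contributes. *)
Lemma det_parent_mx (f : {ffun V -> V}) : rooted i0 f -> \det (parent_mx f) = 1.
Proof.
move=> rf; rewrite /determinant (bigD1 (1%g : {perm 'I_m}))//= odd_perm1 mul1r.
rewrite [X in _ + X]big1 ?addr0 => [|s s1]; last first.
  apply/eqP; rewrite mulf_eq0; apply/orP; right; rewrite prodf_seq_eq0.
  apply/negPn/negP => /hasPn h.
  have hs p : s p != p -> f (nr p) = nr (s p).
    move=> sp; have := h p (mem_index_enum _); rewrite mxE /= (eq_sym p) (negbTE sp) sub0r oppr_eq0.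
    by have [->//|_] := eqVneq (f (nr p)) (nr (s p)); rewrite eqxx.
  have [p sp] : exists p, s p != p.
    by apply/existsP; apply: contraNT s1 => /existsPn e; apply/eqP/permP => p; rewrite perm1; apply/eqP/negPn/e.
  apply: (@rooted_ind _ _ f (fun i => exists2 q, i = nr q & s q != q) rf _ _ (nr p)); last by exists p.
    move=> _ _ [q -> sq]; split; first exact: nr_neq.
    by exists (s q); [exact: hs|rewrite (inj_eq perm_inj)].
  by case=> q e; have := nr_neq q; rewrite -e eqxx.
rewrite big1// => p _; rewrite mxE perm1 eqxx (negbTE (rooted_neq rf (nr_neq p))).
by rewrite subr0.
Qed.

(* The indicator of the vertices whose orbit avoids the root is a null vector. *)
Lemma det_parent_mx0 (f : {ffun V -> V}) : f i0 = i0 -> ~~ rooted i0 f -> \det (parent_mx f) = 0.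
Proof.
move=> f0; rewrite /rooted f0 eqxx/= negb_forall => /existsP[i ni].
apply/eqP; rewrite -det_tr; apply/det0P.
exists (\row_q (~~ fconnect f (nr q) i0)%:R).
  apply/eqP => /rowP; have [p e] : exists p, i = nr p.
    by apply: nr_onto; apply: contraNneq ni => ->.
  by move=> /(_ p); rewrite !mxE -e ni => /eqP; rewrite oner_eq0.
apply/rowP => p; rewrite !mxE.
under eq_bigr do rewrite !mxE mulrBr.
rewrite sumrB (bigD1 p)//= eqxx mulr1 big1 ?addr0; last first.
  by move=> q /negbTE; rewrite eq_sym => ->; rewrite mulr0.
have e : fconnect f (nr p) i0 = fconnect f (f (nr p)) i0.
  apply/idP/idP => h; last by apply: connect_trans h; exact: fconnect1.
  have := iter_findex h; case: (findex f (nr p) i0) => [/= e|k].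
    by have := nr_neq p; rewrite e eqxx.
  by rewrite iterSr => <-; exact: fconnect_iter.
apply/eqP; rewrite subr_eq0 eq_sym e.
have [->|/nr_onto[q ->]] := eqVneq (f (nr p)) i0.
  rewrite connect0 big1// => q _.
  by rewrite eq_sym (negbTE (nr_neq q)) mulr0.
rewrite (bigD1 q)//= eqxx mulr1 big1 ?addr0// => k kq.
by rewrite (inj_eq nr_inj) eq_sym (negbTE kq) mulr0.
Qed.

Definition laplacian (c : V -> V -> F) : 'M[F]_m :=
  \matrix_(p, q) ((p == q)%:R * (\sum_j c (nr p) j) - c (nr p) (nr q)).

(** Multilinearity in the rows reduces the determinant to those of [parent_mx], which are 1 or 0.
    Symmetry of [c] is not involved: in general the sum is over trees directed towards the root. *)
Lemma det_laplacian (c : V -> V -> F) : \det (laplacian c) =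
  \sum_(f : {ffun V -> V} | rooted i0 f) \prod_(i | i != i0) c i (f i).
Proof.
(* Row p is the sum over j of c (nr p) j times e_p - e_j, where e_j = 0 for the root. Choosing one j
   in each row is choosing a parent function. *)
have -> : laplacian c = \matrix_(p, q) \sum_j c (nr p) j * ((p == q)%:R - (j == nr q)%:R).
  apply/matrixP => p q; rewrite !mxE.
  under [RHS]eq_bigr do rewrite mulrBr.
  rewrite sumrB -mulr_suml mulrC; congr (_ - _).
  by rewrite (bigD1 (nr q))//= eqxx mulr1 big1 ?addr0// => j /negbTE ->; rewrite mulr0.
rewrite /determinant.
under eq_bigr => s _.
  under eq_bigr do rewrite mxE.
  rewrite bigA_distr_bigA/= mulr_sumr; over.
rewrite exchange_big/=.
pose ext (g : {ffun 'I_m -> V}) : {ffun V -> V} :=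
  [ffun i => if insub i is Some k then g (enum_rank (k : nonroot)) else i0].
have extE g p : ext g (nr p) = g p.
  rewrite ffunE insubT ?nr_neq// => h; congr (g _); apply: nr_inj; by rewrite nr_rank.
have ext0 g : ext g i0 = i0 by rewrite ffunE insubF ?eqxx.
(* The clause [f i0 == i0], contained in [rooted], is split off because it alone describes the range
   of [ext]. *)
rewrite [RHS](eq_bigl (fun f : {ffun V -> V} => (f i0 == i0) && rooted i0 f)); last first.
  by move=> f; rewrite /rooted; case: eqP.
rewrite [RHS]big_mkcondr/= [RHS](reindex_onto ext (fun f => [ffun p => f (nr p)]))/=; last first.
  move=> f /eqP f0; apply/ffunP => i; have [->|/nr_onto[p ->]] := eqVneq i i0.
    by rewrite ext0 f0.
  by rewrite extE ffunE.
apply: eq_big => g.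
  by rewrite ext0 eqxx/=; apply/esym/eqP/ffunP => p; rewrite ffunE extE.
move=> _; transitivity ((\prod_p c (nr p) (g p)) * \det (parent_mx (ext g))).
  rewrite /determinant mulr_sumr; apply: eq_bigr => s _.
  rewrite mulrCA; congr (_ * _); rewrite -big_split/=; apply: eq_bigr => p _.
  by rewrite mxE extE.
case: ifPn => h; last by rewrite det_parent_mx0// mulr0.
rewrite det_parent_mx// mulr1 big_nonroot; apply: eq_bigr => p _; by rewrite extE.
Qed.

End matrix_tree.

Section tree_sum.
Variables (V : finType) (i0 : V) (F : fieldType) (E : {set {set V}}).
Hypothesis E2 : forall e : {set V}, e \in E -> #|e| = 2%N.
Variable w : {set V} -> F.

Definition tree_sum : F := \sum_(T : {set {set V}} | is_spanning_tree E T) \prod_(e in T) w e.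

Lemma prod_parent_edges (f : {ffun V -> V}) (K : comPzRingType) (h : {set V} -> K) : rooted i0 f ->
  \prod_(e in parent_edges i0 f) h e = \prod_(i | i != i0) h [set i; f i]%SET.
Proof.
move=> rf; rewrite /parent_edges big_imset/=; last exact: parent_edge_inj.
by apply: eq_bigl.
Qed.

Lemma card_parent_edges (f : {ffun V -> V}) : rooted i0 f -> #|parent_edges i0 f| = #|V|.-1.
Proof.
by move=> rf; rewrite /parent_edges card_in_imset ?cardC1//; exact: parent_edge_inj.
Qed.

(** Spanning trees correspond to rooted functions along edges of [E]; a rooted function that uses a
    non-edge has weight 0. *)
Lemma tree_sumE : tree_sum = \det (laplacian i0 (fun i j => if [set i; j]%SET \in E then w [set i; j]%SET else 0)).
Proof.
rewrite det_laplacian (bigID (fun f => parent_edges i0 f \subset E))/= [X in _ + X]big1 ?addr0.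
  rewrite /tree_sum.
  have surj T : is_spanning_tree E T -> exists f, rooted i0 f && (parent_edges i0 f == T).
    by move=> sT; have [f rf ->] := spanning_treeP i0 E2 sT; exists f; rewrite rf eqxx.
  (* The default [finfun id] is never taken at a spanning tree of [E]. *)
  pose inv (T : {set {set V}}) : {ffun V -> V} :=
    odflt (finfun id) [pick f | rooted i0 f && (parent_edges i0 f == T)].
  have invP T : is_spanning_tree E T -> rooted i0 (inv T) && (parent_edges i0 (inv T) == T).
    move=> /surj[f hf]; rewrite /inv; case: pickP => //= h; by rewrite h in hf.
  rewrite (reindex_onto (parent_edges i0) inv); last by move=> T /invP/andP[_ /eqP].
  apply: eq_big => f.
    apply/idP/idP => [/andP[h /eqP e]|/andP[rf fE]].
      by have /andP[+ _] := invP _ h; rewrite e => ->; case/and3P: h.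
    have h := spanning_parent_edges rf fE; rewrite h/=; apply/eqP.
    by have /andP[ri /eqP e] := invP _ h; apply: (parent_edges_inj ri rf).
  move=> /andP[h /eqP e]; have /andP[rf _] := invP _ h; rewrite e in rf.
  case/and3P: h => fE _ _; rewrite prod_parent_edges//.
  by apply: eq_bigr => i ii0; rewrite (fintype.subsetP fE)//; apply/imsetP; exists i.
move=> f /andP[rf /fintype.subsetPn[_ /imsetP[i ii0 ->]] h].
by rewrite (bigD1 i)//= (negbTE h) mul0r.
Qed.

End tree_sum.

(** * Sigma-finite products and Lebesgue measure on tuples *)

Section transport.
Local Open Scope ereal_scope.
Context d d' (T1 : measurableType d) (T2 : measurableType d') (R : realType).
Variable m : {sigma_finite_measure set T1 -> \bar R}.
Variables (f : T1 -> T2) (g : T2 -> T1).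
Hypotheses (mf : measurable_fun [set: T1] f) (mg : measurable_fun [set: T2] g).
Hypothesis fK : cancel f g.

(** The proofs are arguments so that the sigma-finite instance, which rests on the measurable
    inverse [g], can be inferred from the term. *)
Definition transport (_ : measurable_fun [set: T1] f)
  (_ : measurable_fun [set: T2] g) (_ : cancel f g) := pushforward m f.

Let mu := transport mf mg fK.

Let mu0 : mu set0 = 0. Proof. exact: measure0. Qed.
Let mu_ge0 A : 0 <= mu A. Proof. exact: measure_ge0. Qed.
Let mu_additive : semi_sigma_additive mu.
Proof. exact: measure_semi_sigma_additive. Qed.

HB.instance Definition _ := isMeasure.Build _ _ _ mu mu0 mu_ge0 mu_additive.

Let mu_sigma_finite : sigma_finite [set: T2] mu.
Proof.
have [F FT Fm] := sigma_finiteT m.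
exists (fun n => g @^-1` F n).
  by rewrite -preimage_bigcup -FT preimage_setT.
move=> n; have [mF Foo] := Fm n; split.
  by rewrite -[X in measurable X]setTI; exact: mg.
rewrite /mu /transport /pushforward (_ : _ @^-1` _ = F n)//.
by apply/seteqP; split => x /=; rewrite fK.
Qed.

HB.instance Definition _ := Measure_isSigmaFinite.Build _ _ _ mu mu_sigma_finite.

End transport.

(* The library's sigma-finite instance of [\x] is shadowed by the one for
   subprobabilities; a copy of the constant gets its own instance. *)
Section sigma_finite_product.
Local Open Scope ereal_scope.
Context d d' (T1 : measurableType d) (T2 : measurableType d') (R : realType).
Variable m1 : {sigma_finite_measure set T1 -> \bar R}.
Variable m2 : {sigma_finite_measure set T2 -> \bar R}.

Definition sf_prod : set (T1 * T2) -> \bar R := m1 \x m2.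

HB.instance Definition _ := Measure.on sf_prod.

Let sf_prod_sigma_finite : sigma_finite [set: T1 * T2] sf_prod.
Proof.
have [F FT Fm] := sigma_finiteT m1; have [G GT Gm] := sigma_finiteT m2.
(* An enumeration of pairs of indices; numbers that code no pair are sent to (0, 0), which keeps it
   onto. *)
have [h /= hK] : exists h : nat -> nat * nat, forall p, exists n, h n = p.
  exists (odflt (0, 0)%N \o unpickle) => p; exists (pickle p).
  by rewrite /= pickleK.
exists (fun n => F (h n).1 `*` G (h n).2).
  apply/seteqP; split => // -[x y] _.
  have [i _ Fx] : (\bigcup_i F i) x by rewrite -FT.
  have [j _ Gy] : (\bigcup_i G i) y by rewrite -GT.
  by have [n hn] := hK (i, j); exists n => //=; rewrite hn.
move=> n; have [mF Foo] := Fm (h n).1; have [mG Goo] := Gm (h n).2.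
split; first exact: measurableX.
rewrite /sf_prod product_measure1E// lte_mul_pinfty//.
by rewrite ge0_fin_numE.
Qed.

HB.instance Definition _ := Measure_isSigmaFinite.Build _ _ _ sf_prod sf_prod_sigma_finite.

End sigma_finite_product.

Section measurability.
Context (R : realType).
Local Notation mR := (measurableTypeR R).

Lemma measurable_pair_cons n :
  measurable_fun [set: mR * n.-tuple mR] (fun x => [tuple of x.1 :: x.2] : n.+1.-tuple mR).
Proof. exact: measurable_cons. Qed.

Lemma measurable_uncons n : measurable_fun [set: n.+1.-tuple mR]
  (fun x => (thead x, [tuple of behead x]) : mR * n.-tuple mR).
Proof.
apply: measurable_fun_pair; last exact: measurable_behead.
exact: measurable_tnth.
Qed.

Lemma consK n : cancel (fun x : mR * n.-tuple mR => [tuple of x.1 :: x.2])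
  (fun x => (thead x, [tuple of behead x])).
Proof. by move=> [t x]; congr pair; apply: val_inj. Qed.

(** The recursion defines a bare set function. Being a measure and being sigma-finite are proved
    together, since the product at the next step needs both. *)
Lemma lebesgue_tuple_measure n :
  exists M : {sigma_finite_measure set (n.-tuple mR) -> \bar R}, @lebesgue_tuple R n = M.
Proof.
elim: n => [|n [M eM]]; first by exists (\d_ [tuple]).
exists (transport (sf_prod (@lebesgue_measure R) M)
  (@measurable_pair_cons n) (@measurable_uncons n) (@consK n)).
by rewrite /= eM.
Qed.

End measurability.

Section lebesgue_tuple_instance.
Context (R : realType) (n : nat).
Local Notation mR := (measurableTypeR R).
Local Notation mu := (@lebesgue_tuple R n).

Let mu0 : mu set0 = 0%E.
Proof. by have [M ->] := @lebesgue_tuple_measure R n. Qed.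
Let mu_ge0 A : (0 <= mu A)%E.
Proof. by have [M ->] := @lebesgue_tuple_measure R n. Qed.
Let mu_additive : semi_sigma_additive mu.
Proof. by have [M ->] := @lebesgue_tuple_measure R n; exact: measure_semi_sigma_additive. Qed.

HB.instance Definition _ := isMeasure.Build _ _ _ mu mu0 mu_ge0 mu_additive.

Let mu_sigma_finite : sigma_finite [set: n.-tuple mR] mu.
Proof. by have [M ->] := @lebesgue_tuple_measure R n; exact: sigma_finiteT. Qed.

HB.instance Definition _ := Measure_isSigmaFinite.Build _ _ _ mu mu_sigma_finite.

End lebesgue_tuple_instance.

Section tuple_integrals.
Local Open Scope ereal_scope.
Context (R : realType).
Local Notation mR := (measurableTypeR R).
Local Notation lam := (@lebesgue_measure R).

Lemma integral_tuple0 (f : 0.-tuple mR -> \bar R) : measurable_fun [set: 0.-tuple mR] f ->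
  \int[@lebesgue_tuple R 0]_x f x = f [tuple].
Proof. by move=> mf; rewrite integral_dirac// diracT mul1e. Qed.

Lemma measurable_fun_cons n (f : n.+1.-tuple mR -> \bar R) :
  measurable_fun [set: n.+1.-tuple mR] f ->
  measurable_fun [set: mR * n.-tuple mR] (fun z => f [tuple of z.1 :: z.2]).
Proof. by move=> mf; apply: (measurableT_comp mf); exact: measurable_pair_cons. Qed.

Lemma integral_tupleS_prod n (f : n.+1.-tuple mR -> \bar R) : measurable_fun [set: n.+1.-tuple mR] f ->
  (forall x, 0 <= f x) ->
  \int[@lebesgue_tuple R n.+1]_x f x =
  \int[(lam \x @lebesgue_tuple R n)]_z f [tuple of z.1 :: z.2].
Proof.
move=> mf f0; rewrite /lebesgue_tuple -/lebesgue_tuple ge0_integral_pushforward//.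
exact: measurable_pair_cons.
Qed.

Lemma integral_tupleS n (f : n.+1.-tuple mR -> \bar R) : measurable_fun [set: n.+1.-tuple mR] f ->
  (forall x, 0 <= f x) ->
  \int[@lebesgue_tuple R n.+1]_x f x =
  \int[@lebesgue_tuple R n]_y \int[lam]_t f [tuple of t :: y].
Proof.
move=> mf f0; rewrite integral_tupleS_prod// fubini_tonelli2//.
exact: measurable_fun_cons.
Qed.

Lemma exchange_integral_tuple n (f : mR * n.-tuple mR -> \bar R) :
  measurable_fun [set: mR * n.-tuple mR] f -> (forall x, 0 <= f x) ->
  \int[@lebesgue_tuple R n]_y \int[lam]_t f (t, y) =
  \int[lam]_t \int[@lebesgue_tuple R n]_y f (t, y).
Proof. by move=> mf f0; rewrite -fubini_tonelli. Qed.

Lemma lebesgue_reflect (c : R) (A : set mR) : measurable A ->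
  pushforward lam (fun t : mR => (c - t)%R : mR) A = lam A.
Proof.
have mc : measurable_fun [set: mR] (fun t : mR => (c - t)%R : mR).
  by apply: measurable_funB.
(* It is enough to compare lengths of half-open intervals; reflection only swaps the closed end with
   the open one. *)
move=> mA; apply/esym/lebesgue_measure_unique => //= _ [[a b]] _ <-.
rewrite /pushforward (_ : _ @^-1` _ = `[(c - b)%R, (c - a)%R[%classic); last first.
  by apply/seteqP; split => t /=; rewrite !in_itv/= => /andP[? ?]; apply/andP; split; lra.
rewrite !lebesgue_measure_itv/= !lte_fin ltrD2l ltrN2; case: ifP => // _.
by rewrite -!EFinB; congr EFin; ring.
Qed.

Lemma integral_reflect (f : mR -> \bar R) (c : R) : measurable_fun [set: mR] f -> (forall x, 0 <= f x) ->
  \int[lam]_t f (c - t)%R = \int[lam]_t f t.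
Proof.
move=> mf f0.
have mc : measurable_fun [set: mR] (fun t : mR => (c - t)%R : mR) by exact: measurable_funB.
transitivity (\int[pushforward lam (fun t : mR => (c - t)%R : mR)]_t f t).
  by rewrite ge0_integral_pushforward.
by apply: eq_measure_integral => A mA _; exact: lebesgue_reflect.
Qed.

End tuple_integrals.

(** * Gaussian integrals *)

Section schur.
Variable F : fieldType.

Definition schur n (M : 'M[F]_n.+1) : 'M[F]_n :=
  \matrix_(i, j) (M (lift ord0 i) (lift ord0 j)
    - M (lift ord0 i) ord0 * M ord0 (lift ord0 j) / M ord0 ord0).

Lemma det_schur n (M : 'M[F]_n.+1) : M ord0 ord0 != 0 ->
  \det M = M ord0 ord0 * \det (schur M).
Proof.
move=> a0; pose N : 'M[F]_(1 + n) := M; pose a := M ord0 ord0.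
have eM : M = block_mx 1%:M 0 (a^-1 *: dlsubmx N) 1%:M *m
    block_mx (ulsubmx N) (ursubmx N) 0 (schur M) :> 'M[F]_(1 + n).
  rewrite mulmx_block !mul1mx !mul0mx !addr0.
  have l0 : lshift n (ord0 : 'I_1) = ord0 by exact: val_inj.
  have rS k : rshift 1 k = lift ord0 k by exact: val_inj.
  rewrite -[LHS](@submxK _ 1 n 1 n) -/N; congr block_mx.
  - apply/matrixP => i j; rewrite !mxE big_ord1 !mxE !ord1 l0 rS.
    by rewrite /N /a; field.
  - apply/matrixP => i j; rewrite !mxE big_ord1 !mxE !ord1 l0 !rS.
    by rewrite /N /a; field.
rewrite {1}eM det_mulmx (@det_lblock _ 1 n) (@det_ublock _ 1 n) !det1 !mul1r.
rewrite [ulsubmx N]mx11_scalar det_scalar1 !mxE; congr (M _ _ * _); exact: val_inj.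
Qed.

End schur.

Section gauss1.
Local Open Scope ereal_scope.
Context (R : realType).
Local Notation mR := (measurableTypeR R).
Local Notation lam := (@lebesgue_measure R).

Lemma integral_gauss (a c : R) : (0 < a)%R ->
  \int[lam]_t (expR (- (2^-1 * (a * (t + c) ^+ 2))))%:E = (Num.sqrt (2 * pi / a))%:E.
Proof.
move=> a0; pose s := (Num.sqrt a)^-1%R.
have s0 : s != 0%R by rewrite invr_neq0// gt_eqF// sqrtr_gt0.
have s2 : (s ^+ 2 = a^-1)%R by rewrite exprVn sqr_sqrtr// ltW.
have := integral_normal_pdf (- c) s.
rewrite normal_pdfE//.
under eq_integral do rewrite EFinM.
rewrite ge0_integralZl//; last 3 first.
- by apply/measurable_EFinP; exact: measurable_normal_fun.
- by move=> t _; rewrite lee_fin normal_fun_ge0.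
- by rewrite lee_fin normal_peak_ge0.
rewrite /normal_peak s2 => h.
have e : (a^-1 * pi *+ 2 = 2 * pi / a)%R by ring.
rewrite e in h.
have p0 : (0 < Num.sqrt (2 * pi / a))%R by rewrite sqrtr_gt0 divr_gt0// mulr_gt0// pi_gt0.
(* Extended reals do not allow cancelling the peak, so 1 is inserted as the peak times its
   inverse. *)
rewrite -[LHS]mul1e -[X in X * _](_ : (Num.sqrt (2 * pi / a))%:E * ((Num.sqrt (2 * pi / a))^-1)%:E = 1).
  rewrite -muleA -[RHS]mule1 -h; congr (_ * (_ * _)).
  apply: eq_integral => t _; congr (expR _)%:E.
  by rewrite s2 opprK; field; rewrite gt_eqF.
by rewrite -EFinM mulfV// gt_eqF.
Qed.

End gauss1.

Section quadratic_forms.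
Variable R : realType.

Definition quad n (M : 'M[R]_n) (x : 'I_n -> R) : R := \sum_i \sum_j x i * M i j * x j.

Definition posdef n (M : 'M[R]_n) := M^T = M /\
  forall x, (exists i, x i != 0) -> 0 < quad M x.

(** Completion of the square in the first coordinate. *)
Lemma quad_schur n (M : 'M[R]_n.+1) (x : 'I_n.+1 -> R) : M^T = M -> M ord0 ord0 != 0 ->
  quad M x = M ord0 ord0 *
      (x ord0 + (\sum_j M ord0 (lift ord0 j) * x (lift ord0 j)) / M ord0 ord0) ^+ 2
    + quad (schur M) (fun j => x (lift ord0 j)).
Proof.
move=> sM a0; set a := M ord0 ord0; set rho := \sum_j _ * _.
have sE i j : M i j = M j i by rewrite -{1}sM mxE.
rewrite /quad big_ord_recl big_ord_recl -/a.
under [X in _ + X + _]eq_bigr do rewrite -mulrA.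
rewrite -mulr_sumr -/rho.
under [X in _ + _ + X]eq_bigr => i _ do rewrite big_ord_recl sE.
rewrite big_split/=.
have -> : \sum_(i < n) x (lift ord0 i) * M ord0 (lift ord0 i) * x ord0 = rho * x ord0.
  by rewrite mulr_suml; apply: eq_bigr => i _; rewrite [x _ * _]mulrC.
have -> : \sum_i \sum_j x (lift ord0 i) * schur M i j * x (lift ord0 j)
    = \sum_i \sum_j x (lift ord0 i) * M (lift ord0 i) (lift ord0 j) * x (lift ord0 j) - rho * rho / a.
  rewrite {1}/rho -mulrA mulr_suml -sumrB; apply: eq_bigr => i _.
  rewrite /rho mulr_suml mulr_sumr -sumrB; apply: eq_bigr => j _.
  by rewrite mxE (sE (lift ord0 i) ord0) -/a; field.
by field.
Qed.

Lemma posdef_corner n (M : 'M[R]_n.+1) : posdef M -> 0 < M ord0 ord0.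
Proof.
move=> [_ pM]; have := pM (fun i => (i == ord0)%:R).
rewrite /quad big_ord_recl big_ord_recl/= mul1r mulr1 !big1 ?addr0.
- by apply; exists ord0; rewrite eqxx oner_neq0.
- by move=> i _; rewrite big1// => j _; rewrite !mul0r.
- by move=> i _; rewrite mulr0.
Qed.

Lemma posdef_schur n (M : 'M[R]_n.+1) : posdef M -> posdef (schur M).
Proof.
move=> pM; have a0 := posdef_corner pM; case: pM => sM pM; split.
  have sE i j : M i j = M j i by rewrite -{1}sM mxE.
  by apply/matrixP => i j; rewrite !mxE (sE (lift ord0 j) (lift ord0 i)) (sE (lift ord0 j) ord0) (sE ord0 (lift ord0 i)); ring.
move=> y [k yk]; set rho := \sum_j M ord0 (lift ord0 j) * y j.
(* The first coordinate is the minimizer for given [y]: the square in [quad_schur] vanishes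
   there. *)
have := pM (fun i => if unlift ord0 i is Some j then y j else - (rho / M ord0 ord0)).
rewrite quad_schur ?gt_eqF// unlift_none.
rewrite (_ : \sum_j _ = rho); last by apply: eq_bigr => j _; rewrite liftK.
rewrite addNr expr0n mulr0 add0r (_ : quad (schur M) _ = quad (schur M) y).
  by apply; exists (lift ord0 k); rewrite liftK.
by congr quad; apply/funext => j; rewrite liftK.
Qed.

Lemma posdef_det n (M : 'M[R]_n) : posdef M -> 0 < \det M.
Proof.
elim: n M => [|n IH] M pM; first by rewrite det_mx00.
have a0 := posdef_corner pM.
by rewrite det_schur ?gt_eqF// mulr_gt0// IH//; exact: posdef_schur.
Qed.

End quadratic_forms.

Section gaussian.
Local Open Scope ereal_scope.
Context (R : realType).
Local Notation mR := (measurableTypeR R).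
Local Notation lam := (@lebesgue_measure R).

Lemma measurable_coord n (i : 'I_n) : measurable_fun [set: n.-tuple mR] (fun x => tnth x i : R).
Proof. exact: (measurable_tnth (T := mR)). Qed.

Lemma measurable_quad n (M : 'M[R]_n) :
  measurable_fun [set: n.-tuple mR] (fun x => quad M (tnth x)).
Proof.
apply: measurable_sum => i; apply: measurable_sum => j.
apply: measurable_funM; last exact: measurable_coord.
by apply: measurable_funM; [exact: measurable_coord|exact: measurable_cst].
Qed.

Lemma gaussian_integral n (M : 'M[R]_n) : posdef M ->
  \int[@lebesgue_tuple R n]_x (expR (- (2^-1 * quad M (tnth x))))%:E =
  (Num.sqrt ((2 * pi) ^+ n / \det M))%:E.
Proof.
have mg k (N : 'M[R]_k) : measurable_fun [set: k.-tuple mR]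
    (fun x => (expR (- (2^-1 * quad N (tnth x))))%:E).
  apply/measurable_EFinP; apply: measurableT_comp => //.
  apply: measurableT_comp => //; apply: measurable_funM => //.
  exact: measurable_quad.
elim: n M => [|n IH] M pM.
  rewrite integral_tuple0// /quad big_ord0 mulr0 oppr0 expR0 det_mx00 expr0 divr1.
  by rewrite sqrtr1.
have a0 := posdef_corner pM; have p2 := posdef_schur pM; have d2 := posdef_det p2.
rewrite integral_tupleS//.
(* At fixed [y] the first coordinate is a shifted Gaussian with variance the inverse of the corner
   entry; the Gaussian of the Schur complement is left for the induction. *)
under eq_integral => y _.
  under eq_integral => t _.
    rewrite quad_schur ?(gt_eqF a0)//; last by case: pM.
    rewrite tnth0 (_ : (fun j => _) = tnth y); last by apply/funext => j; rewrite tnthS.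
    rewrite (eq_bigr (fun j => M ord0 (lift ord0 j) * tnth y j)%R); last by move=> j _; rewrite tnthS.
    rewrite mulrDr opprD expRD mulrC EFinM; over.
  rewrite ge0_integralZl//; last first.
    apply/measurable_EFinP; apply: measurableT_comp => //.
    apply: measurableT_comp => //; apply: measurable_funM => //; apply: measurable_funM => //.
    by apply: measurable_funX; exact: measurable_funD.
  rewrite integral_gauss//; over.
rewrite ge0_integralZr//; last exact: mg.
rewrite IH// -EFinM -sqrtrM; last first.
  by rewrite divr_ge0 ?exprn_ge0 ?mulr_ge0 ?pi_ge0// ltW.
congr (Num.sqrt _)%:E.
rewrite det_schur ?gt_eqF// exprS; field.
by rewrite !gt_eqF.
Qed.

End gaussian.

(** * Substitution on the line *)

Section substitution.
Local Open Scope ereal_scope.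
Context (R : realType).
Local Notation mR := (measurableTypeR R).
Local Notation lam := (@lebesgue_measure R).

(* Unlike [increasing_ge0_integration_by_substitutionT], the derivative [f] may
   be unbounded at infinity. *)
Lemma integral_substitution_line (F f G : R -> R) :
  {homo F : x y / (x < y)%R} ->
  (forall x : R, is_derive x 1%R F (f x)) -> continuous f -> (forall x, 0 <= f x)%R ->
  (forall x, exists n : nat, x <= F n%:R)%R ->
  (forall x, exists n : nat, F (- n%:R) <= x)%R ->
  continuous G -> (forall x, 0 <= G x)%R ->
  \int[lam]_x (G x)%:E = \int[lam]_x (G (F x) * f x)%:E.
Proof.
move=> incF dF cf f0 Fy FNy cG G0.
have F' : F^`()%classic = f.
  by apply/funext => x; rewrite derive1E; have [_ ->] := dF x.
have derF x : derivable F x 1%R by have [] := dF x.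
have cF : continuous F.
  by move=> x; apply/differentiable_continuous/derivable1_diffP.
have le_F x y : (x <= y)%R -> (F x <= F y)%R.
  by rewrite le_eqVlt => /predU1P[->//|/incF/ltW].
(* Substitution is applied on compact intervals [I n] and their images [J n]; both exhaust the line,
   and monotone convergence passes to the limit. *)
pose I (n : nat) : set R := `[(- n%:R)%R, n%:R%R]%classic.
pose J (n : nat) : set R := `[F (- n%:R)%R, F n%:R%R]%classic.
have ndI : nondecreasing_seq I.
  move=> m n mn; rewrite subsetEset => x; rewrite /I /= !in_itv/= => /andP[h1 h2].
  have : (m%:R <= n%:R :> R)%R by rewrite ler_nat.
  by move=> h; apply/andP; split; lra.
have ndJ : nondecreasing_seq J.
  move=> m n mn; rewrite subsetEset => x; rewrite /J /= !in_itv/= => /andP[h1 h2].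
  have mn' : (m%:R <= n%:R :> R)%R by rewrite ler_nat.
  apply/andP; split; first by apply: le_trans h1; apply: le_F; rewrite lerN2.
  by apply: (le_trans h2); exact: le_F.
have UI : \bigcup_n I n = setT.
  apply/seteqP; split => // x _; exists (Num.truncn `|x|%R).+1 => //.
  by rewrite /I /= in_itv/= -ler_norml; apply/ltW; exact: truncnS_gt.
have UJ : \bigcup_n J n = setT.
  apply/seteqP; split => // x _.
  have [n hn] := Fy x; have [k hk] := FNy x; exists (maxn n k) => //; rewrite /J /= in_itv/=.
  apply/andP; split; [apply: le_trans hk|apply: (le_trans hn)]; apply: le_F.
    by rewrite lerN2 ler_nat leq_maxr.
  by rewrite ler_nat leq_maxl.
have mG : measurable_fun [set: mR] (fun x => (G x)%:E).
  by apply/measurable_EFinP; exact: continuous_measurable_fun.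
have mGF : measurable_fun [set: mR] (fun x => (G (F x) * f x)%:E).
  apply/measurable_EFinP; apply: continuous_measurable_fun => x.
  apply: cvgM; last exact: cf.
  apply: (cvg_comp F G); [exact: cF|exact: cG].
have cI : \int[lam]_(x in I i) (G (F x) * f x)%:E @[i --> \oo] --> \int[lam]_x (G (F x) * f x)%:E.
  rewrite -UI; apply: ge0_nondecreasing_set_cvg_integral => //.
  - by move=> n; exact: measurable_itv.
  - by move=> n; exact: measurable_funTS.
  - by move=> n x _; rewrite lee_fin mulr_ge0.
have cJ : \int[lam]_(x in J i) (G x)%:E @[i --> \oo] --> \int[lam]_x (G x)%:E.
  rewrite -UJ; apply: ge0_nondecreasing_set_cvg_integral => //.
  - by move=> n; exact: measurable_itv.
  - by move=> n; exact: measurable_funTS.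
  - by move=> n x _; rewrite lee_fin.
have e n : \int[lam]_(x in J n) (G x)%:E = \int[lam]_(x in I n) (G (F x) * f x)%:E.
  rewrite integration_by_substitution_increasing ?F'//.
  - by rewrite ge0_cp.
  - by move=> x y _ _; exact: incF.
  - apply/cvg_ex; exists (f (- n%:R)%R); apply: cvg_at_right_filter; exact: cf.
  - apply/cvg_ex; exists (f n%:R%R); apply: cvg_at_left_filter; exact: cf.
  - split => [x _||]; [exact: derF| |].
      by apply: cvg_at_right_filter; exact: cF.
    by apply: cvg_at_left_filter; exact: cF.
  - exact: continuous_subspaceT.
apply: (etrans (esym (cvg_lim (@ereal_hausdorff R) cJ))).
apply: (etrans _ (cvg_lim (@ereal_hausdorff R) cI)).
by congr (limn _); apply/funext => n; exact: e.
Qed.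

End substitution.

Section inverse_gaussian.
Local Open Scope ereal_scope.
Context (R : realType) (A : R).
Hypothesis A0 : (0 < A)%R.
Local Notation mR := (measurableTypeR R).
Local Notation lam := (@lebesgue_measure R).

Let F (t : R) : R := (expR (t / 2) - A * expR (- (t / 2)))%R.
Let f (t : R) : R := ((expR (t / 2) + A * expR (- (t / 2))) / 2)%R.
Let G (x : R) : R := expR (- (2^-1 * x ^+ 2)).

Let dF (t : R) : is_derive t 1%R F (f t).
Proof.
rewrite /F; apply: is_derive_eq.
by rewrite /f /GRing.scale/=; field.
Qed.

Let incF : {homo F : x y / (x < y)%R}.
Proof.
move=> x y xy; rewrite /F ltrB// ?ltr_pM2l// ltr_expR; lra.
Qed.

Let cexp (c : R) : continuous (fun t : R => expR (t * c)).
Proof.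
move=> t; apply: (cvg_comp _ expR); last exact: continuous_expR.
by apply: cvgM; [exact: cvg_id|exact: cvg_cst].
Qed.

Let cf : continuous f.
Proof.
rewrite (_ : f = fun t : R => ((expR (t * 2^-1) + A * expR (t * - 2^-1)) * 2^-1)%R); last first.
  by apply/funext => t; rewrite /f mulrN.
move=> t; apply: cvgM; last exact: cvg_cst.
apply: cvgD; first exact: cexp.
by apply: cvgM; [exact: cvg_cst|exact: cexp].
Qed.

Let cG : continuous G.
Proof.
move=> x; apply: (cvg_comp _ expR); last exact: continuous_expR.
by apply: cvgN; apply: cvgM; [exact: cvg_cst|exact: exprn_continuous].
Qed.

Let Fy x : exists n : nat, (x <= F n%:R)%R.
Proof.
(* By e^y >= 1 + y, F n >= 1 + n/2 - A, which exceeds x once n > c. *)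
pose c : R := (2 * (`|x| + A))%R.
exists (Num.truncn c).+1; set n : R := _.+1%:R.
have cn : (c < n)%R by exact: truncnS_gt.
have n0 : (0 <= n)%R by exact: ler0n.
have h1 : (1 + n / 2 <= expR (n / 2))%R by exact: expR_ge1Dx.
have h2 : (A * expR (- (n / 2)) <= A)%R.
  by rewrite ger_pMr// -[leRHS]expR0 ler_expR; lra.
have h3 := ler_norm x.
rewrite /F; rewrite /c in cn; lra.
Qed.

Let FNy x : exists n : nat, (F (- n%:R) <= x)%R.
Proof.
(* By e^y >= 1 + y, F (-n) <= 1 - A (1 + n/2), which is below -|x| once n > c. *)
pose c : R := (2 * ((1 + `|x|) / A))%R.
exists (Num.truncn c).+1; set n : R := _.+1%:R.
have cn : (c < n)%R by exact: truncnS_gt.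
have n0 : (0 <= n)%R by exact: ler0n.
have h1 : (1 + n / 2 <= expR (n / 2))%R by exact: expR_ge1Dx.
have h2 : (A * (1 + n / 2) <= A * expR (n / 2))%R by rewrite ler_pM2l.
have h3 : (expR (- n / 2) <= 1)%R by rewrite -[leRHS]expR0 ler_expR; lra.
have h4 : (A * c < A * n)%R by rewrite ltr_pM2l.
have h5 : (A * c = 2 * (1 + `|x|))%R by rewrite /c; field; rewrite gt_eqF.
have h6 : (- x <= `|x|)%R by rewrite -normrN ler_norm.
rewrite /F mulNr opprK; rewrite mulNr in h3; rewrite h5 in h4.
have h7 : (A * (1 + n / 2) = A + (A * n) / 2)%R by field.
rewrite h7 in h2; move: h2 h3 h4; set p := (A * expR _)%R; set q := expR _; set r := (A * n)%R.
move=> h2 h3 h4.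
by have A_gt0 := A0; lra.
Qed.

(** The reflection t -> 2 ln A - t changes F into -F and e^(t/2) into A e^(-t/2). Averaging the
    integral with its reflection replaces the factor e^(t/2) by F', and a standard Gaussian in F
    remains. *)
Lemma integral_inverse_gaussian :
  \int[lam]_t (expR (t / 2) * expR (- (2^-1 * (expR (t / 2) - A * expR (- (t / 2))) ^+ 2)))%:E
  = (Num.sqrt (2 * pi))%:E.
Proof.
(* The integrand is k1 + k1; [k2] is the reflection of [k1], and k1 + k2 is G(F) F'. *)
pose k1 (t : R) := (expR (t / 2) * G (F t) / 2)%R.
pose k2 (t : R) := (A * expR (- (t / 2)) * G (F t) / 2)%R.
have mexp (c : R) : measurable_fun [set: mR] (fun t => expR (t * c) : R).
  by apply: continuous_measurable_fun; exact: cexp.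
have mF : measurable_fun [set: mR] F.
  by apply: continuous_measurable_fun => x; apply/differentiable_continuous/derivable1_diffP; have [] := dF x.
have mGF : measurable_fun [set: mR] (G \o F).
  by apply: measurableT_comp mF; apply: continuous_measurable_fun.
have mexpN : measurable_fun [set: mR] (fun t => expR (- (t / 2)) : R).
  by rewrite (_ : (fun _ => _) = fun t : R => expR (t * - 2^-1)%R)//; apply/funext => t; rewrite mulrN.
have mk1 : measurable_fun [set: mR] (fun t => (k1 t)%:E).
  apply/measurable_EFinP; apply: measurable_funM => //; exact: measurable_funM.
have mk2 : measurable_fun [set: mR] (fun t => (k2 t)%:E).
  apply/measurable_EFinP; apply: measurable_funM => //; apply: measurable_funM => //.
  exact: measurable_funM.
have k10 t : 0 <= (k1 t)%:E by rewrite lee_fin !mulr_ge0 ?expR_ge0.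
have k20 t : 0 <= (k2 t)%:E by rewrite lee_fin !mulr_ge0 ?expR_ge0// ltW.
have k12 : \int[lam]_t (k1 t)%:E = \int[lam]_t (k2 t)%:E.
  apply: (etrans (esym (integral_reflect (2 * ln A) mk1 k10))).
  apply: eq_integral => t _; congr EFin.
  have e1 : (expR ((2 * ln A - t) / 2) = A * expR (- (t / 2)))%R.
    rewrite (_ : (2 * ln A - t) / 2 = ln A + - (t / 2))%R; last by field.
    by rewrite expRD lnK.
  have e2 : (A * expR (- ((2 * ln A - t) / 2)) = expR (t / 2))%R.
    rewrite expRN e1 invfM expRN invrK mulrA mulfV ?mul1r// gt_eqF//.
  by rewrite /k1 /k2 /F e1 e2 /G -[in LHS]sqrrN opprB.
transitivity (\int[lam]_t ((k1 t)%:E + (k1 t)%:E)).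
  by apply: eq_integral => t _; rewrite -EFinD; congr EFin; rewrite /k1 /G /F; field.
rewrite ge0_integralD// {2}k12 -ge0_integralD//.
transitivity (\int[lam]_t (G (F t) * f t)%:E).
  by apply: eq_integral => t _; rewrite -EFinD; congr EFin; rewrite /k1 /k2 /f; field.
have f0 t : (0 <= f t)%R by rewrite /f divr_ge0// addr_ge0 ?mulr_ge0 ?expR_ge0// ltW.
have G0 x : (0 <= G x)%R by exact: expR_ge0.
rewrite -(integral_substitution_line incF dF cf f0 Fy FNy cG G0).
have := @integral_gauss R 1 0 ltr01; rewrite divr1 => <-.
by apply: eq_integral => t _; rewrite mul1r addr0.
Qed.

End inverse_gaussian.

(** * The sigma model and elimination of a vertex *)

Section sigma_model.
Variable R : realType.

Lemma coshN (x : R) : cosh (- x) = cosh x.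
Proof. by rewrite /cosh opprK addrC. Qed.

Lemma cosh0 : cosh (0 : R) = 1.
Proof. by rewrite /cosh oppr0 expR0; field. Qed.

Section def.
Variables (n : nat) (W : 'I_n -> 'I_n -> R) (eta : 'I_n -> R).

Definition energy (u : 'I_n -> R) : R :=
  2^-1 * (\sum_i \sum_j W i j * (cosh (u i - u j) - 1)) + \sum_i eta i * (cosh (u i) - 1).

(* The discrete Schroedinger operator for which [exp u], extended by 1 to the
   root, is harmonic; [eta] is the weight towards the root. *)
Definition schroedinger (u : 'I_n -> R) : 'M[R]_n :=
  \matrix_(i, j) ((i == j)%:R * (expR (- u i) * (eta i + \sum_k W i k * expR (u k))) - W i j).

(** The nonvanishing determinant stands for connectedness to the root. In this form it passes to
    Schur complements at once and excludes a zero pivot. *)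
Definition admissible := [/\ forall i j, W i j = W j i, forall i j, 0 <= W i j,
  forall i, 0 <= eta i & forall u, \det (schroedinger u) != 0].

End def.

Section elimination.
Variables (n : nat) (W : 'I_n.+1 -> 'I_n.+1 -> R) (eta : 'I_n.+1 -> R).
Hypothesis adm : admissible W eta.

(** The quantity a of the overview; at the zero field it is A. *)
Definition pivot (y : 'I_n -> R) : R :=
  eta ord0 + \sum_k W ord0 (lift ord0 k) * expR (y k).

(** Elimination also creates loops i = j. They cancel on the diagonal of [schroedinger] and
    contribute cosh 0 - 1 = 0 to [energy]. *)
Definition elimW (b : R) (i j : 'I_n) : R :=
  W (lift ord0 i) (lift ord0 j) + W ord0 (lift ord0 i) * W ord0 (lift ord0 j) / b.

Definition elim_eta (b : R) (i : 'I_n) : R :=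
  eta (lift ord0 i) + eta ord0 * W ord0 (lift ord0 i) / b.

Definition ucons (t : R) (y : 'I_n -> R) (i : 'I_n.+1) : R :=
  if unlift ord0 i is Some j then y j else t.

Lemma ucons0 t y : ucons t y ord0 = t.
Proof. by rewrite /ucons unlift_none. Qed.

Lemma uconsS t y j : ucons t y (lift ord0 j) = y j.
Proof. by rewrite /ucons liftK. Qed.

Lemma pivot_ge0 y : 0 <= pivot y.
Proof.
case: adm => _ W0 e0 _; apply: addr_ge0 => //; apply: sumr_ge0 => k _.
by rewrite mulr_ge0// expR_ge0.
Qed.

Lemma schroedinger00 t y : schroedinger W eta (ucons t y) ord0 ord0 = pivot y * expR (- t).
Proof.
rewrite mxE eqxx mul1r big_ord_recl !ucons0.
under eq_bigr do rewrite uconsS.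
rewrite /pivot addrCA mulrDr mulrCA -expRD addNr expR0 mulr1 addrAC subrr add0r.
by rewrite mulrC.
Qed.

(** A zero pivot forces all weights at vertex 0 to vanish, and then the first row of the operator is
    zero. *)
Lemma pivot_gt0 y : 0 < pivot y.
Proof.
rewrite lt_neqAle pivot_ge0 andbT eq_sym; apply/eqP => p0.
case: adm => _ W0 e0 /(_ (ucons 0 y))/eqP; apply.
have s0 : 0 <= \sum_k W ord0 (lift ord0 k) * expR (y k).
  by apply: sumr_ge0 => k _; rewrite mulr_ge0// expR_ge0.
have /eqP se0 : \sum_k W ord0 (lift ord0 k) * expR (y k) == 0.
  by rewrite eq_le s0 andbT -[leRHS]p0 /pivot lerDr.
have Wk k : W ord0 (lift ord0 k) = 0.
  have /allP/(_ k) : all (fun i => true ==> (W ord0 (lift ord0 i) * expR (y i) == 0)) (index_enum 'I_n).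
    rewrite -psumr_eq0 ?se0 ?eqxx// => i _; by rewrite mulr_ge0// expR_ge0.
  by rewrite mem_index_enum => /(_ isT)/=; rewrite mulf_eq0 (gt_eqF (expR_gt0 _)) orbF => /eqP.
rewrite (expand_det_row _ ord0) big1// => j _.
have [->|[k ->]] : j = ord0 \/ exists k, j = lift ord0 k.
  by case: (unliftP ord0 j) => [k|] ->; [right; exists k|left].
- by rewrite schroedinger00 p0 !mul0r.
- by rewrite mxE /= mul0r Wk subrr mul0r.
Qed.

Section point.
Variables (tau : R) (y : 'I_n -> R).
Let b := expR tau.
Let u := ucons (ln (pivot y) - tau) y.

Lemma expR_ucons0 : expR (u ord0) = pivot y / b.
Proof. by rewrite /u ucons0 expRD expRN lnK ?posrE ?pivot_gt0. Qed.

Lemma expRN_ucons0 : expR (- u ord0) = b / pivot y.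
Proof. by rewrite expRN expR_ucons0 invf_div. Qed.

Lemma schroedinger_corner : schroedinger W eta u ord0 ord0 = b.
Proof.
rewrite schroedinger00 -{1}[_ - tau](ucons0 _ y) expRN_ucons0 mulrC divfK//.
by rewrite gt_eqF ?pivot_gt0.
Qed.

(** Off the diagonal this is the choice of [elimW]. On the diagonal, vertex 0 contributes W_0i
    e^(u_0) = W_0i a / b, and expanding a distributes this over the new root weight and the new edge
    weights. *)
Lemma schur_schroedinger : schur (schroedinger W eta u) = schroedinger (elimW b) (elim_eta b) y.
Proof.
case: adm => sW _ _ _; have b0 : b != 0 by rewrite gt_eqF ?expR_gt0.
apply/matrixP => i j; rewrite mxE schroedinger_corner.
rewrite [schroedinger _ _ _ (lift _ _) (lift _ _)]mxE [schroedinger _ _ _ (lift _ _) ord0]mxE.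
rewrite [schroedinger _ _ _ ord0 (lift _ _)]mxE [in RHS]mxE.
rewrite (inj_eq lift_inj) /= !mul0r !sub0r mulrNN {1}/u uconsS big_ord_recl.
have -> : \sum_(k < n) W (lift ord0 i) (lift ord0 k) * expR (u (lift ord0 k)) =
    \sum_(k < n) W (lift ord0 i) (lift ord0 k) * expR (y k).
  by apply: eq_bigr => k _; rewrite /u uconsS.
rewrite expR_ucons0 /elim_eta (sW (lift ord0 i) ord0) /pivot.
have -> : \sum_k elimW b i k * expR (y k) = \sum_k W (lift ord0 i) (lift ord0 k) * expR (y k)
    + W ord0 (lift ord0 i) / b * \sum_k W ord0 (lift ord0 k) * expR (y k).
  rewrite mulr_sumr -big_split/=; apply: eq_bigr => k _; rewrite /elimW; field => //.
by rewrite /elimW; field.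
Qed.

(** With p, q, w, e0 as set below, a = e0 + p and A = e0 + w, so the terms at vertex 0 add up to (e0
    + p)(e0 + q) / (2b) + b/2 - A. The new weights account for the first summand minus A^2 / (2b),
    and the rest is the square. *)
Lemma energy_elim : energy W eta u = energy (elimW b) (elim_eta b) y
  + 2^-1 * (expR (tau / 2) - pivot (fun=> 0) * expR (- (tau / 2))) ^+ 2.
Proof.
case: adm => sW _ _ _; have b0 : b != 0 by rewrite gt_eqF ?expR_gt0.
have bE : expR (tau / 2) ^+ 2 = b by rewrite expr2 -expRD -splitr.
set w := \sum_k W ord0 (lift ord0 k).
set p := \sum_k W ord0 (lift ord0 k) * expR (y k).
set q := \sum_k W ord0 (lift ord0 k) * expR (- y k).
set e0 := eta ord0.
have AE : pivot (fun=> 0) = e0 + w.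
  by congr (_ + _); apply: eq_bigr => k _; rewrite expR0 mulr1.
have aE : pivot y = e0 + p by [].
have a0 : e0 + p != 0 by rewrite -aE gt_eqF ?pivot_gt0.
pose E1 := \sum_(i < n) \sum_(j < n) W (lift ord0 i) (lift ord0 j) * (cosh (y i - y j) - 1).
pose E2 := \sum_(i < n) eta (lift ord0 i) * (cosh (y i) - 1).
have h1 : \sum_(k < n) W ord0 (lift ord0 k) * (cosh (u ord0 - y k) - 1) =
    2^-1 * (pivot y / b * q + b / pivot y * p) - w.
  rewrite mulrDr !mulr_sumr -big_split/= -sumrB; apply: eq_bigr => k _.
  by rewrite /cosh opprB !expRD expR_ucons0 expRN_ucons0; field; rewrite aE a0 b0.
have h2 : energy W eta u = 2^-1 * E1 + E2
    + (2^-1 * (pivot y / b * q + b / pivot y * p) - w)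
    + e0 * (2^-1 * (pivot y / b + b / pivot y) - 1).
  rewrite /energy big_ord_recl big_ord_recl subrr cosh0 subrr mulr0 add0r.
  have uS k : u (lift ord0 k) = y k by rewrite /u uconsS.
  under [X in _ * (X + _)]eq_bigr do rewrite uS.
  rewrite h1.
  under [X in _ * (_ + X)]eq_bigr => i _.
    rewrite big_ord_recl sW uS -coshN opprB.
    under [X in _ + X]eq_bigr do rewrite uS.
    over.
  rewrite big_split/= h1 -/E1 [\sum_(i < n.+1) _]big_ord_recl.
  have -> : \sum_(i < n) eta (lift ord0 i) * (cosh (u (lift ord0 i)) - 1) = E2.
    by apply: eq_bigr => i _; rewrite uS.
  rewrite [cosh (u ord0)]/cosh expR_ucons0 expRN_ucons0 -/e0.
  by field; rewrite aE a0 b0.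
have h3 : energy (elimW b) (elim_eta b) y = 2^-1 * E1 + E2
    + 2^-1 * (p * q - w * w) / b + e0 / b * (2^-1 * (p + q) - w).
  rewrite /energy.
  have -> : \sum_i \sum_j elimW b i j * (cosh (y i - y j) - 1) = E1 + (p * q - w * w) / b.
    (* Symmetrizing the double sum p q in i and j produces cosh (y i - y j). *)
    have -> : p * q - w * w = \sum_i \sum_j
        W ord0 (lift ord0 i) * W ord0 (lift ord0 j) * (cosh (y i - y j) - 1).
      transitivity (\sum_i \sum_j W ord0 (lift ord0 i) * W ord0 (lift ord0 j) *
          ((expR (y i) * expR (- y j) + expR (y j) * expR (- y i)) / 2 - 1)); last first.
        apply: eq_bigr => i _; apply: eq_bigr => j _; rewrite /cosh opprB.
        by rewrite !expRD.
      have pq : p * q = \sum_i \sum_j W ord0 (lift ord0 i) * W ord0 (lift ord0 j) * (expR (y i) * expR (- y j)).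
        rewrite /p /q mulr_suml; apply: eq_bigr => i _; rewrite mulr_sumr; apply: eq_bigr => j _; ring.
      have qp : p * q = \sum_i \sum_j W ord0 (lift ord0 i) * W ord0 (lift ord0 j) * (expR (y j) * expR (- y i)).
        rewrite mulrC /p /q mulr_suml; apply: eq_bigr => i _; rewrite mulr_sumr; apply: eq_bigr => j _; ring.
      have ww : w * w = \sum_i \sum_j W ord0 (lift ord0 i) * W ord0 (lift ord0 j).
        by rewrite /w mulr_suml; apply: eq_bigr => i _; rewrite mulr_sumr.
      rewrite -[p * q](_ : 2^-1 * (p * q) + 2^-1 * (p * q) = _); last by field.
      rewrite {1}pq qp ww !mulr_sumr -big_split/= -sumrB; apply: eq_bigr => i _.
      rewrite !mulr_sumr -big_split/= -sumrB; apply: eq_bigr => j _.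
      by field.
    rewrite mulr_suml -big_split/=; apply: eq_bigr => i _.
    rewrite mulr_suml -big_split/=; apply: eq_bigr => j _.
    by rewrite /elimW; field.
  have -> : \sum_i elim_eta b i * (cosh (y i) - 1) = E2 + e0 / b * (2^-1 * (p + q) - w).
    rewrite mulrBr /p /q /w -big_split/= !mulr_sumr -sumrB -big_split/=.
    by apply: eq_bigr => i _; rewrite /elim_eta /cosh -/e0; field.
  by field.
have s0 : expR (tau / 2) != 0 by rewrite gt_eqF ?expR_gt0.
rewrite h2 h3 AE aE expRN -bE; field.
by rewrite a0 s0.
Qed.

End point.

Lemma admissible_elim (b : R) : 0 < b -> admissible (elimW b) (elim_eta b).
Proof.
move=> b0; case: (adm) => sW W0 e0 d0; split.
- by move=> i j; rewrite /elimW sW; congr (_ + _ / _); rewrite mulrC.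
- by move=> i j; rewrite addr_ge0// divr_ge0 ?mulr_ge0// ltW.
- by move=> i; rewrite addr_ge0// divr_ge0 ?mulr_ge0// ltW.
(* Every b > 0 is the pivot of some field extending [y], so the determinant sought is a factor of a
   nonzero one. *)
- move=> y; have [tau ->] : exists tau, b = expR tau by exists (ln b); rewrite lnK.
  have := d0 (ucons (ln (pivot y) - tau) y).
  rewrite det_schur; last by rewrite schroedinger_corner gt_eqF ?expR_gt0.
  by rewrite schur_schroedinger mulf_eq0 negb_or => /andP[].
Qed.

End elimination.

End sigma_model.

Section measurable_det.
Context d (T : measurableType d) (R : realType).

Lemma measurable_det n (M : T -> 'M[R]_n) :
  (forall i j, measurable_fun [set: T] (fun x => M x i j)) ->
  measurable_fun [set: T] (fun x => \det (M x)).
Proof.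
move=> mM; apply: measurable_sum => s; apply: measurable_funM; first exact: measurable_cst.
by apply: measurable_prod => i _.
Qed.

Lemma measurable_sqrt (f : T -> R) : measurable_fun [set: T] f ->
  measurable_fun [set: T] (fun x => Num.sqrt (f x)).
Proof.
move=> mf; apply: (measurableT_comp _ mf).
by apply: continuous_measurable_fun; exact: sqrt_continuous.
Qed.

Lemma measurable_expRN (f : T -> R) : measurable_fun [set: T] f ->
  measurable_fun [set: T] (fun x => expR (- f x)).
Proof. by move=> mf; apply: measurableT_comp => //; exact: measurableT_comp. Qed.

Lemma measurable_cosh (f : T -> R) : measurable_fun [set: T] f ->
  measurable_fun [set: T] (fun x => cosh (f x)).
Proof.
move=> mf; apply: measurable_funM; last exact: measurable_cst.
by apply: measurable_funD; [exact: measurableT_comp|exact: measurable_expRN].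
Qed.

End measurable_det.

(** * Normalization of the sigma model by induction on the number of vertices *)

Section partition_function.
Local Open Scope ereal_scope.
Context (R : realType).
Local Notation mR := (measurableTypeR R).
Local Notation lam := (@lebesgue_measure R).

Definition sigma_density n (W : 'I_n -> 'I_n -> R) eta (u : 'I_n -> R) : R :=
  (expR (- energy W eta u) * Num.sqrt (\det (schroedinger W eta u)))%R.

Lemma sigma_density_ge0 n W eta u : (0 <= @sigma_density n W eta u)%R.
Proof. by rewrite mulr_ge0 ?expR_ge0 ?sqrtr_ge0. Qed.

Lemma measurable_sigma_density n W eta :
  measurable_fun [set: n.-tuple mR] (fun x => @sigma_density n W eta (tnth x)).
Proof.
have mc := @measurable_coord R n.
apply: measurable_funM.
  apply: measurableT_comp => //; apply: measurableT_comp => //.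
  apply: measurable_funD.
    apply: measurable_funM => //; apply: measurable_sum => i; apply: measurable_sum => j.
    apply: measurable_funM => //; apply: measurable_funB => //.
    by apply: measurable_cosh; exact: measurable_funB.
  apply: measurable_sum => i; apply: measurable_funM => //; apply: measurable_funB => //.
  exact: measurable_cosh.
apply: measurable_sqrt; apply: measurable_det => i j.
under eq_fun do rewrite mxE.
apply: measurable_funB => //; apply: measurable_funM => //; apply: measurable_funM => //.
  exact: measurable_expRN.
apply: measurable_funD => //; apply: measurable_sum => k; apply: measurable_funM => //.
exact: (measurableT_comp (@measurable_expR R) (mc k)).
Qed.

(** Under the substitution the density is a product in which [y] enters only the last factor. The
    factor expR (tau / 2) is the square root of the pivot. *)
Lemma sigma_density_elim n (W : 'I_n.+1 -> 'I_n.+1 -> R) eta (tau : R) y :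
  admissible W eta ->
  sigma_density W eta (ucons (ln (pivot W eta y) - tau) y) =
  (expR (tau / 2)
    * expR (- (2^-1 * (expR (tau / 2) - pivot W eta (fun=> 0) * expR (- (tau / 2))) ^+ 2))
    * sigma_density (elimW W (expR tau)) (elim_eta W eta (expR tau)) y)%R.
Proof.
move=> adm; rewrite /sigma_density energy_elim// det_schur; last first.
  by rewrite schroedinger_corner// gt_eqF ?expR_gt0.
rewrite schroedinger_corner// schur_schroedinger// sqrtrM ?expR_ge0//.
have -> : Num.sqrt (expR tau) = expR (tau / 2).
  by rewrite {1}[tau]splitr expRD -expr2 sqrtr_sqr ger0_norm ?expR_ge0.
rewrite opprD expRD; ring.
Qed.

Lemma tnth_cons n (t : R) (x : n.-tuple mR) :
  tnth [tuple of (t : mR) :: x] = ucons t (tnth x) :> ('I_n.+1 -> R).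
Proof.
apply/funext => i; rewrite /ucons; case: unliftP => [j|] ->; by rewrite ?tnthS ?tnth0.
Qed.

Lemma sigma_model_normalized n (W : 'I_n -> 'I_n -> R) eta : admissible W eta ->
  \int[@lebesgue_tuple R n]_x (sigma_density W eta (tnth x))%:E = (Num.sqrt (2 * pi) ^+ n)%:E.
Proof.
elim: n W eta => [|n IH] W eta adm.
  rewrite integral_tuple0; last by apply/measurable_EFinP; exact: measurable_sigma_density.
  rewrite /sigma_density /energy !big_ord0 mulr0 addr0 oppr0 expR0 mul1r det_mx00.
  by rewrite sqrtr1 expr0.
have mD : measurable_fun [set: n.+1.-tuple mR] (fun x => (sigma_density W eta (tnth x))%:E).
  by apply/measurable_EFinP; exact: measurable_sigma_density.
have D0 (x : n.+1.-tuple mR) : 0 <= (sigma_density W eta (tnth x))%:E.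
  by rewrite lee_fin sigma_density_ge0.
rewrite integral_tupleS//.
pose c (y : n.-tuple mR) := ln (pivot W eta (tnth y)).
have mpivot : measurable_fun [set: n.-tuple mR] (fun y => pivot W eta (tnth y)).
  apply: measurable_funD => //; apply: measurable_sum => k; apply: measurable_funM => //.
  exact: (measurableT_comp (@measurable_expR R) (@measurable_coord R n k)).
have mc : measurable_fun [set: n.-tuple mR] c by exact: measurableT_comp.
pose Psi (z : mR * n.-tuple mR) : \bar R :=
  (sigma_density W eta (tnth [tuple of ((c z.2 - z.1)%R : mR) :: z.2]))%:E.
have mPsi : measurable_fun [set: mR * n.-tuple mR] Psi.
  apply: (measurableT_comp mD); apply: measurable_cons => //.
  by apply: measurable_funB => //; exact: (measurableT_comp mc).
have Psi0 z : 0 <= Psi z by exact: D0.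
(* For fixed [y] the first coordinate becomes c y - tau, a reflection, which preserves Lebesgue
   measure although its centre depends on [y]. *)
transitivity (\int[@lebesgue_tuple R n]_y \int[lam]_t Psi (t, y)).
  apply: eq_integral => y _; rewrite -(integral_reflect (c y))//.
  apply: (measurableT_comp mD); exact: measurable_cons.
(* With tau outermost, the inner integral is the normalization for fixed weights, and its value does
   not depend on tau. *)
rewrite exchange_integral_tuple//.
pose K (tau : R) := (expR (tau / 2)
    * expR (- (2^-1 * (expR (tau / 2) - pivot W eta (fun=> 0) * expR (- (tau / 2))) ^+ 2)))%R.
transitivity (\int[lam]_tau ((K tau)%:E * (Num.sqrt (2 * pi) ^+ n)%:E)).
  apply: eq_integral => tau _.
  under eq_integral => y _ do rewrite /Psi /= tnth_cons sigma_density_elim// EFinM.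
  rewrite ge0_integralZl//.
  - by rewrite IH//; apply: admissible_elim => //; exact: expR_gt0.
  - by apply/measurable_EFinP; exact: measurable_sigma_density.
  - by move=> y _; rewrite lee_fin sigma_density_ge0.
have mK : measurable_fun [set: mR] (fun t => (K t)%:E).
  apply/measurable_EFinP.
  have mdiv : measurable_fun [set: mR] (fun t : mR => t / 2 : R)%R by exact: measurable_funM.
  apply: measurable_funM; first exact: measurableT_comp.
  apply: measurableT_comp => //; apply: measurableT_comp => //; apply: measurable_funM => //.
  apply: measurable_funX; apply: measurable_funB; first exact: measurableT_comp.
  by apply: measurable_funM => //; exact: measurable_expRN.
have K0 t : 0 <= (K t)%:E by rewrite lee_fin mulr_ge0 ?expR_ge0.
rewrite ge0_integralZr// integral_inverse_gaussian ?pivot_gt0//.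
by rewrite -EFinM exprS.
Qed.

End partition_function.

(** * Measures given by coordinates *)

Section measurable_ffun.
Context (I : finType) d (T : measurableType d).

Lemma measurable_ffun_coord (i : I) :
  measurable_fun [set: {ffun I -> T}] (fun x : {ffun I -> T} => x i).
Proof.
move=> _ A mA; apply: sub_sigma_algebra; exists i => //.
by exists A.
Qed.

Lemma measurable_to_ffun d' (U : measurableType d') (f : U -> {ffun I -> T}) :
  (forall i, measurable_fun [set: U] (fun x => f x i)) -> measurable_fun [set: U] f.
Proof.
move=> mf; apply: (measurability (\bigcup_(i in [set: I])
        preimage_set_system setT (fun x : {ffun I -> T} => x i) measurable)) => //.
move=> _ [_ [i _ [A mA <-]] <-]; rewrite !setTI.
by rewrite -[X in measurable X]setTI; exact: mf.
Qed.

End measurable_ffun.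

Section coordinate_measure.
Local Open Scope ereal_scope.
Context (R : realType) (I : finType) d (X : measurableType d).
Local Notation mR := (measurableTypeR R).
Variables (coord : X -> {ffun I -> mR}) (inv : {ffun I -> mR} -> X).
Hypotheses (coordK : cancel coord inv) (invK : cancel inv coord).
Hypotheses (mcoord : measurable_fun [set: X] coord)
  (minv : measurable_fun [set: {ffun I -> mR}] inv).

Definition of_tuple (x : #|I|.-tuple mR) : X := inv [ffun i => tnth x (enum_rank i)].

Definition to_tuple (x : X) : #|I|.-tuple mR := [tuple coord x (enum_val i) | i < #|I|].

Lemma of_tupleK : cancel of_tuple to_tuple.
Proof.
move=> x; apply: eq_from_tnth => i.
by rewrite tnth_mktuple /of_tuple invK ffunE enum_valK.
Qed.

Lemma measurable_of_tuple : measurable_fun [set: #|I|.-tuple mR] of_tuple.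
Proof.
apply: (measurableT_comp minv); apply: measurable_to_ffun => i.
by under eq_fun do rewrite ffunE; exact: measurable_tnth.
Qed.

Lemma measurable_to_tuple : measurable_fun [set: X] to_tuple.
Proof.
apply/measurable_fun_tnthP => i; rewrite (_ : _ \o _ = fun x => coord x (enum_val i)).
  exact: (measurableT_comp (measurable_ffun_coord _)).
by apply/funext => x; rewrite /= tnth_mktuple.
Qed.

Definition coord_measure : set X -> \bar R :=
  transport (@lebesgue_tuple R #|I|) measurable_of_tuple measurable_to_tuple of_tupleK.

HB.instance Definition _ := SigmaFiniteMeasure.on coord_measure.

(** A direct image under [coord] is a preimage under its inverse; this equips the set function with
    its sigma-finite structure. *)
Lemma lebesgue_coordE : lebesgue_coord coord = coord_measure.
Proof.
apply/funext => B; rewrite /lebesgue_coord /lebesgue_ffun /coord_measure /transport /pushforward.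
congr (lebesgue_tuple _); apply/seteqP; split => x /=.
  by move=> [y By yx]; rewrite /of_tuple -yx coordK.
by move=> Bx; exists (of_tuple x) => //; rewrite invK.
Qed.

Lemma integral_coord_measure (f : X -> \bar R) : measurable_fun [set: X] f ->
  (forall x, 0 <= f x) ->
  \int[coord_measure]_x f x = \int[@lebesgue_tuple R #|I|]_x f (of_tuple x).
Proof. by move=> mf f0; rewrite ge0_integral_pushforward//; exact: measurable_of_tuple. Qed.

End coordinate_measure.

Section pinned_coordinates.
Context (R : realType) (V : finType) (i0 : V).
Local Notation mR := (measurableTypeR R).
Local Notation nonroot := {i : V | i != i0}.

Fact pinned_ext_subproof (x : {ffun nonroot -> mR}) :
  [ffun i => if insub i is Some k then x k else 0] i0 == 0 :> mR.
Proof. by rewrite ffunE insubF ?eqxx. Qed.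

Definition pinned_ext (x : {ffun nonroot -> mR}) : pinned R i0 :=
  exist _ [ffun i => if insub i is Some k then x k else 0 : mR] (pinned_ext_subproof x).

Lemma pinned_extK : cancel pinned_ext (@pinned_restr R V i0).
Proof. by move=> x; apply/ffunP => k; rewrite !ffunE /= valK. Qed.

Lemma pinned_restrK : cancel (@pinned_restr R V i0) pinned_ext.
Proof.
move=> u; apply: val_inj; apply/ffunP => i; rewrite /= ffunE.
case: insubP => [k _ <-|]; first by rewrite ffunE.
by rewrite negbK => /eqP ->; have /eqP -> := valP u.
Qed.

Lemma measurable_pinned (i : V) : measurable_fun [set: pinned R i0] (fun u => val u i : R).
Proof.
apply: (measurableT_comp (measurable_ffun_coord i)).
by move=> _ A mA; exists A.
Qed.

Lemma measurable_pinned_restr : measurable_fun [set: pinned R i0] (@pinned_restr R V i0).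
Proof.
apply: measurable_to_ffun => k; rewrite (_ : (fun u => pinned_restr u k) = fun u => val u (val k)).
  exact: measurable_pinned.
by apply/funext => u; rewrite ffunE.
Qed.

Lemma measurable_to_pinned d (T : measurableType d) (f : T -> pinned R i0) :
  (forall i, measurable_fun [set: T] (fun x => val (f x) i : R)) -> measurable_fun [set: T] f.
Proof.
move=> mf _ _ [B mB <-]; rewrite !setTI.
have : measurable_fun [set: T] (fun x => val (f x)) by exact: measurable_to_ffun.
by move=> /(_ measurableT _ mB); rewrite setTI.
Qed.

Lemma measurable_pinned_ext : measurable_fun [set: {ffun nonroot -> mR}] pinned_ext.
Proof.
apply: measurable_to_pinned => i.
rewrite (_ : (fun x => val (pinned_ext x) i) = fun x : {ffun nonroot -> mR} => if insub i is Some k then x k else 0).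
  by case: insubP => [k _ _|_]; [exact: measurable_ffun_coord|exact: measurable_cst].
by apply/funext => x; rewrite ffunE.
Qed.

End pinned_coordinates.

(** * Circulations and their off-tree coordinates *)

Section sylvester.
Variables (F : fieldType) (n m : nat).

(** Both sides come from factoring [block_mx D1 (- B^T) B (invmx D2)] into triangular blocks in two
    ways. It moves a determinant on off-tree arcs to one on nonroot vertices. *)
Lemma det_add_congr (D1 : 'M[F]_n) (D2 : 'M[F]_m) (B : 'M[F]_(m, n)) :
  D1 \in unitmx -> D2 \in unitmx ->
  \det (D1 + B^T *m D2 *m B) =
  \det D1 * \det D2 * \det (invmx D2 + B *m invmx D1 *m B^T).
Proof.
move=> u1 u2.
pose P := D1 + B^T *m D2 *m B; pose S := invmx D2 + B *m invmx D1 *m B^T.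
have ea : block_mx D1 (- B^T) B (invmx D2) =
    block_mx 1%:M 0 (B *m invmx D1) 1%:M *m block_mx D1 (- B^T) 0 S.
  rewrite mulmx_block !mul1mx !mul0mx !addr0 mulmxKV// mulmxN.
  by rewrite addrC addrK.
have eb : block_mx D1 (- B^T) B (invmx D2) =
    block_mx P (- B^T) 0 (invmx D2) *m block_mx 1%:M 0 (D2 *m B) 1%:M.
  rewrite mulmx_block !mulmx1 !mulmx0 !add0r mulKmx// mulNmx mulmxA.
  by rewrite addrK.
have := congr1 determinant ea.
rewrite eb !det_mulmx !det_lblock !det_ublock !det1 mulr1 !mul1r det_inv -/P -/S => h.
have d2 : \det D2 != 0 by rewrite -unitfE -unitmxE.
by rewrite mulrAC -h mulr1 divfK.
Qed.

End sylvester.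

Section arcs.
Variables (V : finType) (E : {set {set V}}).
Hypothesis E2 : forall e : {set V}, e \in E -> #|e| = 2%N.

Lemma edge_neq i j : [set i; j]%SET \in E -> i != j.
Proof. by move=> /E2; rewrite cards2; case: eqVneq. Qed.

Lemma arc_neq (a : darc E) : src a != tgt a.
Proof. exact: edge_neq (valP a). Qed.

Lemma arc_edge_in (a : darc E) : arc_edge a \in E.
Proof. exact: (valP a). Qed.

Lemma arc_eq (a b : darc E) : src a = src b -> tgt a = tgt b -> a = b.
Proof.
rewrite /src /tgt => h1 h2; apply: val_inj.
by case: (val a) (val b) h1 h2 => ? ? [? ?]/= -> ->.
Qed.

Lemma rev_arcK : involutive (@rev_arc V E).
Proof. by move=> a; apply: arc_eq. Qed.

Lemma arc_edge_eq (a b : darc E) : arc_edge a = arc_edge b -> a = b \/ a = rev_arc b.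
Proof. by move=> /set2_eq[[? ?]|[? ?]]; [left|right]; exact: arc_eq. Qed.

Lemma arc_edge_rev (a : darc E) : arc_edge (rev_arc a) = arc_edge a.
Proof. by rewrite /arc_edge finset.setUC. Qed.

Lemma rev_arc_neq (a : darc E) : rev_arc a != a.
Proof. by apply/eqP => /(congr1 (@src V E)) h; have := arc_neq a; rewrite -{1}h eqxx. Qed.

Lemma big_arc_pairs (T : Type) (idx : T) (op : Monoid.com_law idx) (F : V -> V -> T) :
  \big[op/idx]_(a : darc E) F (src a) (tgt a) =
  \big[op/idx]_i \big[op/idx]_j (if [set i; j]%SET \in E then F i j else idx).
Proof.
rewrite pair_big/= -big_mkcond/=.
rewrite [RHS](reindex_omap (fun a : darc E => val a) insub)/=.
  by apply: eq_bigl => a; rewrite (valP a) valK eqxx.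
by move=> p pE; rewrite insubT.
Qed.

Lemma big_arc_edges (T : Type) (idx : T) (op : Monoid.com_law idx) (h : {set V} -> T) :
  \big[op/idx]_(a : darc E) h (arc_edge a) = \big[op/idx]_(e in E) op (h e) (h e).
Proof.
rewrite (partition_big (@arc_edge V E) (mem E))/=; last by move=> a _; exact: arc_edge_in.
apply: eq_bigr => e eE.
have /eqP/cards2P[x [y [xy exy]]] := E2 eE.
have pE : [set (x, y).1; (x, y).2]%SET \in E by rewrite /= -exy.
pose a : darc E := exist _ (x, y) pE.
have ea : arc_edge a = e by rewrite /arc_edge /src /tgt /= exy.
rewrite (bigD1 a)/= ?ea//; congr (op _ _).
rewrite (bigD1 (rev_arc a))/=; last by rewrite arc_edge_rev ea eqxx rev_arc_neq.
rewrite arc_edge_rev ea big1 ?Monoid.mulm1// => b /andP[/andP[/eqP eb ba] bra].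
by have [e1|e1] : b = a \/ b = rev_arc a; [apply: arc_edge_eq; rewrite eb ea|rewrite e1 eqxx in ba|rewrite e1 eqxx in bra].
Qed.

End arcs.

Section flow_coordinates.
Variables (R : realType) (V : finType) (E : {set {set V}}) (i0 : V) (T0 : dtree E).
Hypothesis E2 : forall e : {set V}, e \in E -> #|e| = 2%N.
Local Notation m := #|{: {i : V | i != i0}}|.
Local Notation mR := (measurableTypeR R).
Local Notation offtree := {a : darc E | a \notin val T0}.
Local Notation N := #|{: offtree}|.

(** [f] is the parent function of the tree under [T0], and [tau q] is the arc of [T0] between [nr q]
    and its parent, in either direction. *)
Variables (f : {ffun V -> V}) (tau : 'I_m -> darc E).
Hypothesis rf : rooted i0 f.
Hypothesis fT0 : [set arc_edge a | a in val T0]%SET = parent_edges i0 f.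
Hypothesis tau_in : forall q, tau q \in val T0.
Hypothesis tau_edge : forall q, arc_edge (tau q) = [set nr q; f (nr q)]%SET.

Lemma tau_inj : injective tau.
Proof.
move=> p q /(congr1 (@arc_edge _ _)); rewrite !tau_edge => e.
by apply: nr_inj; apply: (parent_edge_inj rf); rewrite ?inE ?nr_neq.
Qed.

Lemma tau_onto a : a \in val T0 -> exists q, a = tau q.
Proof.
move=> aT; have : arc_edge a \in parent_edges i0 f by rewrite -fT0; apply/imsetP; exists a.
case/imsetP => i ii0 e; have [q iq] := nr_onto ii0; exists q.
have /arc_edge_eq[//|e1] : arc_edge a = arc_edge (tau q) by rewrite tau_edge -iq.
have /andP[_ /forall_inP/(_ _ (tau_in q))] := valP T0.
by rewrite -e1 aT.
Qed.

Definition off (o : 'I_N) : darc E := val (enum_val o).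

Lemma off_notin o : off o \notin val T0. Proof. exact: (valP (enum_val o)). Qed.

Lemma big_arcs (T : Type) (idx : T) (op : Monoid.com_law idx) (F : darc E -> T) :
  \big[op/idx]_a F a = op (\big[op/idx]_q F (tau q)) (\big[op/idx]_o F (off o)).
Proof.
rewrite (bigID (mem (val T0)))/=; congr (op _ _).
  pose tinv a := [pick q | tau q == a].
  rewrite (reindex_omap tau tinv).
    apply: eq_bigl => q; rewrite tau_in/= /tinv; case: pickP => [p|/(_ q)]; last by rewrite eqxx.
    by move=> /eqP/tau_inj ->; rewrite eqxx.
  move=> a /tau_onto[q ->]; rewrite /tinv; case: pickP => [p /eqP/= ->//|/(_ q)].
  by rewrite eqxx.
rewrite (reindex_omap off (fun a => omap enum_rank (insub a : option offtree))).
  apply: eq_bigl => o; rewrite off_notin /= /off valK /= enum_valK; exact/eqP.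
by move=> a aT; rewrite insubT /= /off enum_rankK.
Qed.

Definition incidence (p : 'I_m) (a : darc E) : R :=
  (src a == nr p)%:R - (tgt a == nr p)%:R.

(** The divergences of any k sum to zero over all vertices, because each arc has one source and one
    target. Balance at the root thus follows from balance elsewhere. *)
Lemma is_flowP (k : {ffun darc E -> mR}) :
  is_flow k <-> forall p, \sum_a incidence p a * k a = 0.
Proof.
have divE i : \sum_(a : darc E | src a == i) (k a - k (rev_arc a)) =
    \sum_a ((src a == i)%:R - (tgt a == i)%:R) * k a.
  rewrite sumrB [X in _ - X](reindex_inj (inv_inj (@rev_arcK _ E)))/=.
  under [X in _ - X]eq_bigr do rewrite rev_arcK.
  rewrite big_mkcond [X in _ - X]big_mkcond -sumrB; apply: eq_bigr => a _.
  rewrite mulrBl; congr (_ - _); case: ifP => _; by rewrite ?mul1r ?mul0r.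
split=> [/forallP h p|h]; first by have /eqP := h (nr p); rewrite divE.
apply/forallP => i; rewrite divE.
have [->|/nr_onto[p ->]] := eqVneq i i0; last by rewrite -/(incidence p _) h.
have s0 : \sum_i \sum_a ((src a == i)%:R - (tgt a == i)%:R) * k a = 0.
  rewrite exchange_big big1//= => a _; rewrite -mulr_suml sumrB.
  rewrite (bigD1 (src a))//= eqxx big1 ?addr0; last by move=> j /negbTE; rewrite eq_sym => ->.
  rewrite (bigD1 (tgt a))//= eqxx big1 ?addr0; last by move=> j /negbTE; rewrite eq_sym => ->.
  by rewrite subrr mul0r.
move: s0; rewrite (bigD1 i0)//= [X in _ + X]big1 ?addr0; first by move=> ->.
by move=> j /nr_onto[p ->]; exact: h.
Qed.

Definition tree_mx : 'M[R]_m := \matrix_(p, q) incidence p (tau q).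
Definition off_mx : 'M[R]_(m, N) := \matrix_(p, o) incidence p (off o).

(** Up to a sign for each column, given by the direction of the arc, this is the transpose of
    [parent_mx]. Squaring removes the signs. *)
Lemma det_tree_mx : \det tree_mx ^+ 2 = 1.
Proof.
pose s q : R := if src (tau q) == nr q then 1 else -1.
have -> : tree_mx = (parent_mx i0 R f)^T *m diag_mx (\row_q s q).
  apply/matrixP => p q; rewrite mul_mx_diag !mxE /incidence /s.
  have fq : f (nr q) != nr q by exact: (rooted_neq rf (nr_neq q)).
  have := tau_edge q => /set2_eq[[-> ->]|[-> ->]].
    by rewrite eqxx mulr1 (inj_eq (@nr_inj _ _)).
  by rewrite (negbTE fq) mulrN1 opprB (inj_eq (@nr_inj _ _)).
rewrite det_mulmx det_tr det_parent_mx// mul1r det_diag -prodrXl big1// => q _.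
by rewrite mxE /s; case: ifP; rewrite ?sqrrN expr1n.
Qed.

Lemma tree_mx_unit : tree_mx \in unitmx.
Proof. by rewrite unitmxE unitfE -sqrf_eq0 det_tree_mx oner_eq0. Qed.

(** Conservation reads [tree_mx] x + [off_mx] y = 0 for tree values x and off-tree values y; hence x
    = [solve_mx] y. *)
Definition solve_mx : 'M[R]_(m, N) := - (invmx tree_mx *m off_mx).

Lemma tree_solve_mx : tree_mx *m solve_mx = - off_mx.
Proof. by rewrite mulmxN mulKVmx// tree_mx_unit. Qed.

Definition flow_fun (x : {ffun offtree -> mR}) : {ffun darc E -> mR} :=
  [ffun a => if insub a is Some k then x k else
     \sum_q (a == tau q)%:R * \sum_o solve_mx q o * x (enum_val o)].

Lemma flow_fun_off x o : flow_fun x (off o) = x (enum_val o).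
Proof. by rewrite ffunE /off valK. Qed.

Lemma flow_fun_tree x q : flow_fun x (tau q) = \sum_o solve_mx q o * x (enum_val o).
Proof.
rewrite ffunE insubF ?tau_in// (bigD1 q)//= eqxx mul1r [X in _ + X]big1 ?addr0// => p pq.
by rewrite (inj_eq tau_inj) eq_sym (negbTE pq) mul0r.
Qed.

Lemma flow_fun_flow x : is_flow (flow_fun x).
Proof.
apply/is_flowP => p; rewrite big_arcs/=.
under eq_bigr do rewrite flow_fun_tree mulr_sumr.
under [X in _ + X]eq_bigr do rewrite flow_fun_off.
rewrite exchange_big/= -big_split/= big1// => o _.
under eq_bigr do rewrite mulrA.
rewrite -mulr_suml -mulrDl.
have /matrixP/(_ p o) := tree_solve_mx; rewrite !mxE.
under eq_bigr do rewrite mxE.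
by move=> ->; rewrite addNr mul0r.
Qed.

Definition flow_ext (x : {ffun offtree -> mR}) : flow R E := exist _ (flow_fun x) (flow_fun_flow x).

Lemma flow_extK : cancel flow_ext (@flow_restr R V E T0).
Proof. by move=> x; apply/ffunP => k; rewrite !ffunE /= valK. Qed.

Lemma flow_restrK : cancel (@flow_restr R V E T0) flow_ext.
Proof.
move=> k; apply: val_inj; apply/ffunP => a; rewrite /=.
have [aT|aT] := boolP (a \in val T0); last by rewrite ffunE insubT ffunE.
have [q ->] := tau_onto aT; rewrite flow_fun_tree.
have /is_flowP h := valP k.
have e : tree_mx *m (\col_q val k (tau q)) = - (off_mx *m \col_o val k (off o)).
  apply/matrixP => p j; rewrite !mxE; apply/eqP; rewrite -addr_eq0; apply/eqP.
  rewrite -[RHS](h p) big_arcs/=; congr (_ + _); apply: eq_bigr => i _; by rewrite !mxE.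
have : \col_q val k (tau q) = solve_mx *m \col_o val k (off o).
  by rewrite /solve_mx mulNmx -mulmxA -mulmxN -e mulKmx// tree_mx_unit.
move=> /matrixP/(_ q 0); rewrite !mxE => ->; apply: eq_bigr => o _.
by rewrite !mxE ffunE.
Qed.

Lemma measurable_flow (a : darc E) : measurable_fun [set: flow R E] (fun k => val k a : R).
Proof.
apply: (measurableT_comp (measurable_ffun_coord a)).
by move=> _ A mA; exists A.
Qed.

Lemma measurable_flow_restr : measurable_fun [set: flow R E] (@flow_restr R V E T0).
Proof.
apply: measurable_to_ffun => k; rewrite (_ : (fun u => flow_restr T0 u k) = fun u => val u (val k)).
  exact: measurable_flow.
by apply/funext => u; rewrite ffunE.
Qed.

Lemma measurable_flow_ext : measurable_fun [set: {ffun offtree -> mR}] flow_ext.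
Proof.
move=> _ _ [B mB <-]; rewrite !setTI.
have : measurable_fun [set: {ffun offtree -> mR}] flow_fun.
  apply: measurable_to_ffun => a.
  have [aT|aT] := boolP (a \in val T0).
    have [q ->] := tau_onto aT.
    rewrite (_ : (fun x => flow_fun x (tau q)) = fun x : {ffun offtree -> mR} =>
        \sum_o solve_mx q o * x (enum_val o)); last by apply/funext => x; rewrite flow_fun_tree.
    apply: measurable_sum => o; apply: measurable_funM => //.
    exact: measurable_ffun_coord.
  rewrite (_ : (fun x => flow_fun x a) = fun x : {ffun offtree -> mR} => x (exist _ a aT)).
    exact: measurable_ffun_coord.
  by apply/funext => x; rewrite ffunE insubT.
by move=> /(_ measurableT _ mB); rewrite setTI.
Qed.

Section quadratic.
Variable w : {set V} -> R.
Hypothesis w0 : forall e, e \in E -> 0 < w e.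

Let r (a : darc E) : R := (w (arc_edge a))^-1.

Let r0 a : 0 < r a. Proof. by rewrite invr_gt0 w0// arc_edge_in. Qed.

Let D1 : 'M[R]_N := diag_mx (\row_o r (off o)).
Let D2 : 'M[R]_m := diag_mx (\row_q r (tau q)).

Definition flow_form : 'M[R]_N := D1 + solve_mx^T *m D2 *m solve_mx.

Lemma quad_flow_form (x : {ffun offtree -> mR}) :
  quad flow_form (fun o => x (enum_val o)) = \sum_a flow_fun x a ^+ 2 / w (arc_edge a).
Proof.
rewrite big_arcs/= addrC.
under [X in X + _]eq_bigr do rewrite flow_fun_off -/(r _).
under [X in _ + X]eq_bigr do rewrite flow_fun_tree -/(r _).
have qD (A B : 'M[R]_N) y : quad (A + B) y = quad A y + quad B y.
  rewrite /quad -big_split; apply: eq_bigr => i _; rewrite -big_split; apply: eq_bigr => j _ /=.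
  by rewrite mxE mulrDr mulrDl.
rewrite /flow_form qD; congr (_ + _).
  rewrite /quad; apply: eq_bigr => o _; rewrite (bigD1 o)//= big1 ?addr0.
    by rewrite !mxE eqxx mulr1n; ring.
  by move=> j jo; rewrite !mxE eq_sym (negbTE jo) mulr0n mulr0 mul0r.
transitivity (\sum_i \sum_j \sum_q solve_mx q i * x (enum_val i) *
    (solve_mx q j * x (enum_val j)) * r (tau q)).
  apply: eq_bigr => i _; apply: eq_bigr => j _; rewrite mxE mulr_sumr mulr_suml.
  by apply: eq_bigr => q _; rewrite mul_mx_diag !mxE; ring.
transitivity (\sum_q \sum_i \sum_j solve_mx q i * x (enum_val i) *
    (solve_mx q j * x (enum_val j)) * r (tau q)).
  rewrite [RHS]exchange_big; apply: eq_bigr => i _ /=.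
  by rewrite [RHS]exchange_big.
apply: eq_bigr => q _; rewrite expr2 mulr_suml mulr_suml; apply: eq_bigr => i _.
by rewrite mulr_sumr mulr_suml.
Qed.

Lemma posdef_flow_form : posdef flow_form.
Proof.
split.
  by rewrite /flow_form linearD/= !trmx_mul trmxK !tr_diag_mx mulmxA.
move=> x [k xk]; pose X : {ffun offtree -> mR} := [ffun j => x (enum_rank j)].
have -> : x = (fun o => X (enum_val o)) by apply/funext => i; rewrite ffunE enum_valK.
rewrite quad_flow_form big_arcs/=; apply: ltr_wpDl.
  by apply: sumr_ge0 => q _; rewrite mulr_ge0 ?sqr_ge0// ltW// r0.
rewrite (bigD1 k)//=; apply: ltr_pwDl; last first.
  by apply: sumr_ge0 => i _; rewrite mulr_ge0 ?sqr_ge0// ltW// r0.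
rewrite mulr_gt0 ?r0// flow_fun_off ffunE enum_valK lt_neqAle sqr_ge0 andbT eq_sym.
by rewrite sqrf_eq0.
Qed.

(** [det_add_congr] leaves an m by m determinant which becomes that of incidence times diag(w) times
    its transpose, over all arcs. Every edge has two arcs, so this matrix is twice the reduced
    Laplacian. *)
Lemma det_flow_form : \det flow_form = \prod_a r a * 2 ^+ m * tree_sum E w.
Proof.
have u1 : D1 \in unitmx.
  by rewrite unitmxE det_diag unitfE gt_eqF// prodr_gt0// => o _; rewrite mxE r0.
have u2 : D2 \in unitmx.
  by rewrite unitmxE det_diag unitfE gt_eqF// prodr_gt0// => o _; rewrite mxE r0.
have inv_diag n (d : 'I_n -> R) : (forall i, 0 < d i) ->
    invmx (diag_mx (\row_i d i)) = diag_mx (\row_i (d i)^-1).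
  move=> d0; have h : diag_mx (\row_i d i) *m diag_mx (\row_i (d i)^-1) = 1%:M.
    rewrite mulmx_diag -diag_const_mx; congr diag_mx; apply/rowP => i.
    by rewrite !mxE mulfV// gt_eqF.
  have [u _] := mulmx1_unit h; by rewrite -[RHS](mulKmx u) h mulmx1.
rewrite /flow_form det_add_congr// !det_diag big_arcs/=.
rewrite -[\prod_q r (tau q) * _]mulrC; under eq_bigr do rewrite mxE.
under [X in _ * X * _]eq_bigr do rewrite mxE.
rewrite -!mulrA; congr (_ * (_ * _)).
(* Congruence by [tree_mx] keeps the determinant and turns [solve_mx] into - [off_mx], so that tree
   arcs and off-tree arcs enter alike. *)
set S := invmx D2 + _.
have <- : \det (tree_mx *m S *m tree_mx^T) = \det S.
  by rewrite !det_mulmx det_tr mulrAC -expr2 det_tree_mx mul1r.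
rewrite (tree_sumE i0 E2) -detZ; congr determinant.
have -> : tree_mx *m S *m tree_mx^T =
    tree_mx *m invmx D2 *m tree_mx^T + off_mx *m invmx D1 *m off_mx^T.
  rewrite /S mulmxDr mulmxDl; congr (_ + _).
  have e : solve_mx^T *m tree_mx^T = - off_mx^T by rewrite -trmx_mul tree_solve_mx linearN.
  by rewrite !mulmxA tree_solve_mx -mulmxA e mulmxN !mulNmx opprK.
apply/matrixP => p q.
have congrE n (A : 'M[R]_(m, n)) (d : 'I_n -> R) : (forall i, 0 < d i) ->
    (A *m invmx (diag_mx (\row_i d i)) *m A^T) p q = \sum_i (d i)^-1 * (A p i * A q i).
  move=> d0; rewrite inv_diag// mul_mx_diag mxE; apply: eq_bigr => i _.
  by rewrite !mxE; ring.
rewrite mxE !congrE//.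
under eq_bigr do rewrite !mxE.
under [X in _ + X]eq_bigr do rewrite !mxE.
rewrite -(big_arcs _ (fun a => (r a)^-1 * (incidence p a * incidence q a)))/=.
under eq_bigr do rewrite /r invrK.
rewrite (big_arc_pairs E _ (fun i j => w [set i; j]%SET * (((i == nr p)%:R - (j == nr p)%:R) *
  ((i == nr q)%:R - (j == nr q)%:R))))/=.
pose c i j : R := if [set i; j]%SET \in E then w [set i; j]%SET else 0.
have cC i j : c i j = c j i by rewrite /c finset.setUC.
transitivity (\sum_i \sum_j (c i j * ((i == nr p)%:R * (i == nr q)%:R)
   + c i j * ((j == nr p)%:R * (j == nr q)%:R)
   - c i j * ((i == nr p)%:R * (j == nr q)%:R)
   - c i j * ((j == nr p)%:R * (i == nr q)%:R))).
  apply: eq_bigr => i _; apply: eq_bigr => j _; rewrite /c; case: ifP => _; ring.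
have e1 : \sum_i \sum_j c i j * ((i == nr p)%:R * (i == nr q)%:R) =
    (p == q)%:R * \sum_j c (nr p) j.
  rewrite (bigD1 (nr p))//= [X in _ + X]big1 ?addr0.
    rewrite eqxx (inj_eq (@nr_inj _ _)) mulr_sumr; apply: eq_bigr => j _ /=; ring.
  by move=> i /negbTE ->; rewrite big1// => j _; rewrite mul0r mulr0.
have e3 k l : \sum_i \sum_j c i j * ((i == k)%:R * (j == l)%:R) = c k l.
  rewrite (bigD1 k)//= [X in _ + X]big1 ?addr0; last first.
    by move=> i /negbTE ->; rewrite big1// => j _; rewrite mul0r mulr0.
  rewrite (bigD1 l)//= big1 ?addr0 ?eqxx ?mulr1// => j /negbTE ->.
  by rewrite !mulr0.
under eq_bigr do rewrite !(sumrB, big_split)/=.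
rewrite !(sumrB, big_split)/= e1 e3.
have -> : \sum_i \sum_j c i j * ((j == nr p)%:R * (j == nr q)%:R) = (p == q)%:R * \sum_j c (nr p) j.
  rewrite exchange_big -e1; apply: eq_bigr => i _; apply: eq_bigr => j _ /=; by rewrite cC.
have -> : \sum_i \sum_j c i j * ((j == nr p)%:R * (i == nr q)%:R) = c (nr p) (nr q).
  rewrite exchange_big -[RHS]e3; apply: eq_bigr => i _; apply: eq_bigr => j _ /=; by rewrite cC.
rewrite !mxE -/(c _ _); under [X in _ = 2 * (_ * X - _)]eq_bigr do rewrite -/(c _ _).
ring.
Qed.

End quadratic.

End flow_coordinates.

(** * Weighted graphs *)

Section tree_frame.
Variables (V : finType) (E : {set {set V}}) (i0 : V) (T0 : dtree E).
Hypothesis E2 : forall e : {set V}, e \in E -> #|e| = 2%N.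
Local Notation m := #|{: {i : V | i != i0}}|.

Lemma tree_frame : exists (f : {ffun V -> V}) (tau : 'I_m -> darc E),
  [/\ rooted i0 f, [set arc_edge a | a in val T0]%SET = parent_edges i0 f,
    forall q, tau q \in val T0 & forall q, arc_edge (tau q) = [set nr q; f (nr q)]%SET].
Proof.
have /andP[sT _] := valP T0.
have [f rf ef] := spanning_treeP i0 E2 sT.
have tauP (q : 'I_m) : exists a : darc E, (a \in val T0) && (arc_edge a == [set nr q; f (nr q)]%SET).
  have : [set nr q; f (nr q)]%SET \in [set arc_edge a | a in val T0]%SET.
    by rewrite ef; apply/imsetP; exists (nr q); rewrite ?inE ?nr_neq.
  by case/imsetP => a aT ->; exists a; rewrite aT eqxx.
exists f, (fun q => xchoose (tauP q)); split=> // q; have /andP[h1 /eqP h2] := xchooseP (tauP q).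
  exact: h1.
exact: h2.
Qed.

(** Counting arcs once by [big_arcs] and once by edges. *)
Lemma card_arcs : (#|{: {a : darc E | a \notin val T0}}| + #|V|.-1 = 2 * #|E|)%N.
Proof.
have [f [tau [rf fT tin te]]] := tree_frame.
have := big_arcs rf fT tin te addn (fun=> 1%N).
rewrite (big_arc_edges E2 _ (fun=> 1%N)) !sum_nat_const !card_ord -(card_nonroot i0).
by rewrite !muln1 mulnC addnC.
Qed.

End tree_frame.

Section weighted_graph.
Variables (R : realType) (V : finType) (E : {set {set V}}) (i0 : V).
Hypothesis E2 : forall e : {set V}, e \in E -> #|e| = 2%N.
Hypothesis E_connected : connected_edges E.
Local Notation m := #|{: {i : V | i != i0}}|.

(** [on_edge] reads the endpoints in enumeration order, which may put [j] first; symmetry of [g]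
    covers that case. *)
Lemma on_edge_pair (g : V -> V -> R) i j : [set i; j]%SET \in E -> g i j = g j i ->
  on_edge g [set i; j]%SET = g i j.
Proof.
move=> /(edge_neq E2) ij gC; rewrite /on_edge.
have : perm_eq (enum [set i; j]%SET) [:: i; j].
  apply: uniq_perm; rewrite ?enum_uniq//= ?inE ?ij// => x.
  by rewrite mem_enum !inE.
have := perm_size; move=> /[apply].
have mi : i \in enum [set i; j]%SET by rewrite mem_enum !inE eqxx.
have mj : j \in enum [set i; j]%SET by rewrite mem_enum !inE eqxx orbT.
have sub x : x \in enum [set i; j]%SET -> (x == i) || (x == j) by rewrite mem_enum !inE.
case: (enum _) mi mj sub (enum_uniq [set i; j]%SET) => [|x [|y [|//]]]//=.
move=> mi mj sub _ _.
have := sub x; rewrite inE eqxx => /(_ isT)/orP[]/eqP ex; have := sub y; rewrite !inE eqxx orbT => /(_ isT)/orP[]/eqP ey; subst x y => //.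
  by move: mj; rewrite !inE orbb eq_sym (negbTE ij).
by move: mi; rewrite !inE orbb (negbTE ij).
Qed.

Lemma tree_sum_gt0 (w : {set V} -> R) : (forall e, e \in E -> 0 < w e) -> 0 < tree_sum E w.
Proof.
move=> w0; have [f rf fE] := connected_parent i0 E_connected.
rewrite /tree_sum (bigD1 (parent_edges i0 f))/=; last exact: spanning_parent_edges.
rewrite ltr_pwDl//.
  by rewrite prodr_gt0// => e ef; apply: w0; exact: (fintype.subsetP fE).
apply: sumr_ge0 => T /andP[/and3P[TE _ _] _]; apply: prodr_ge0 => e eT.
by rewrite ltW// w0//; exact: (fintype.subsetP TE).
Qed.

Section laplacian_form.
Variable c : V -> V -> R.
Hypothesis cC : forall i j, c i j = c j i.
Hypothesis c0 : forall i j, 0 <= c i j.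
Hypothesis cE : forall i j, [set i; j]%SET \in E -> 0 < c i j.

Lemma quad_laplacian (s : V -> R) : s i0 = 0 ->
  quad (laplacian i0 c) (fun p => s (nr p)) = 2^-1 * \sum_i \sum_j c i j * (s i - s j) ^+ 2.
Proof.
move=> s0.
(* Since s vanishes at the root, sums over nonroot vertices extend to all vertices. *)
have ext (F : V -> R) : F i0 = 0 -> \sum_p F (@nr V i0 p) = \sum_i F i.
  by move=> F0; rewrite [RHS](bigD1 i0)//= F0 add0r big_nonroot.
have -> : quad (laplacian i0 c) (fun p => s (nr p)) =
    \sum_i \sum_j c i j * s i ^+ 2 - \sum_i \sum_j c i j * (s i * s j).
  rewrite -sumrB -ext/=; last by rewrite !big1 ?subrr// => j _; rewrite s0 ?expr0n ?mul0r mulr0.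
  apply: eq_bigr => p _.
  rewrite -(ext (fun j => c (nr p) j * (s (nr p) * s j))); last by rewrite s0 !mulr0.
  rewrite (bigD1 p)//= [X in _ = _ - X](bigD1 p)//= opprD addrA; congr (_ + _).
    by rewrite !mxE eqxx mul1r -mulr_suml; ring.
  rewrite -sumrN; apply: eq_bigr => q qp; rewrite !mxE eq_sym (negbTE qp) mul0r sub0r; ring.
have e : \sum_i \sum_j c i j * s j ^+ 2 = \sum_i \sum_j c i j * s i ^+ 2.
  rewrite exchange_big; apply: eq_bigr => i _; apply: eq_bigr => j _ /=; by rewrite cC.
have -> : \sum_i \sum_j c i j * (s i - s j) ^+ 2 = \sum_i \sum_j c i j * s i ^+ 2
    + \sum_i \sum_j c i j * s j ^+ 2 - 2 * \sum_i \sum_j c i j * (s i * s j).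
  rewrite mulr_sumr -big_split -sumrB; apply: eq_bigr => i _ /=.
  rewrite mulr_sumr -big_split -sumrB; apply: eq_bigr => j _ /=; ring.
by rewrite e; field.
Qed.

(** Zero energy makes s constant along every edge; a nonzero value would propagate along parents to
    the root, where s = 0. *)
Lemma posdef_laplacian : posdef (laplacian i0 c).
Proof.
split.
  apply/matrixP => p q; rewrite !mxE cC eq_sym; congr (_ - _).
  by case: eqVneq => [->//|_]; rewrite !mul0r.
move=> x [p xp].
pose s i := if insub i is Some k then x (enum_rank (k : {i | i != i0})) else 0.
have sx q : s (nr q) = x q by rewrite /s insubT ?nr_neq// => h; congr x; apply: nr_inj; rewrite nr_rank.
have -> : x = (fun q => s (nr q)) by apply/funext => q; rewrite sx.
have s0 : s i0 = 0 by rewrite /s insubF ?eqxx.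
rewrite quad_laplacian// mulr_gt0// lt_neqAle eq_sym; apply/andP; split; last first.
  by apply: sumr_ge0 => i _; apply: sumr_ge0 => j _; rewrite mulr_ge0 ?sqr_ge0.
apply/eqP => h.
have [f rf fE] := connected_parent i0 E_connected.
apply: (@rooted_ind _ i0 f (fun i => s i != 0) rf _ _ (nr p)); last by rewrite sx.
  move=> i ii0 si; have iE : [set i; f i]%SET \in E.
    by apply: (fintype.subsetP fE); apply/imsetP; exists i.
  have t0 : c i (f i) * (s i - s (f i)) ^+ 2 = 0.
    move/eqP: h; rewrite psumr_eq0 => [/allP/(_ i)|k _]; last first.
      by apply: sumr_ge0 => j _; rewrite mulr_ge0 ?sqr_ge0.
    rewrite mem_index_enum => /(_ isT)/=; rewrite psumr_eq0 => [/allP/(_ (f i))|j _]; last first.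
      by rewrite mulr_ge0 ?sqr_ge0.
    by rewrite mem_index_enum => /(_ isT)/= /eqP.
  split=> //; move/eqP: t0; rewrite mulf_eq0 gt_eqF ?cE//= sqrf_eq0 subr_eq0 => /eqP <-.
  exact: si.
by rewrite s0 eqxx.
Qed.

End laplacian_form.

End weighted_graph.

Section measurable_big.
Context d (T : measurableType d) (R : realType) (I : finType) (P : pred I) (h : I -> T -> R).
Hypothesis mh : forall i, P i -> measurable_fun [set: T] (h i).

Lemma measurable_sum_pred : measurable_fun [set: T] (fun x => \sum_(i | P i) h i x).
Proof.
rewrite (_ : (fun x => _) = fun x => \sum_i (if P i then h i else cst 0) x).
  by apply: measurable_sum => i; case: ifP => [/mh//|_]; exact: measurable_cst.
by apply/funext => x; rewrite big_mkcond; apply: eq_bigr => i _; case: ifP.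
Qed.

Lemma measurable_prod_pred : measurable_fun [set: T] (fun x => \prod_(i | P i) h i x).
Proof.
rewrite (_ : (fun x => _) = fun x => \prod_i (if P i then h i else cst 1) x).
  by apply: measurable_prod => i _; case: ifP => [/mh//|_]; exact: measurable_cst.
by apply/funext => x; rewrite big_mkcond; apply: eq_bigr => i _; case: ifP.
Qed.

End measurable_big.

(** * Gaussian integrals over spins and circulations on the graph *)

Section graph_integrals.
Variables (R : realType) (V : finType) (E : {set {set V}}).
Variables (W : V -> V -> R) (i0 : V) (T0 : dtree E).
Hypothesis E2 : forall e : {set V}, e \in E -> #|e| = 2%N.
Hypothesis E_connected : connected_edges E.
Hypothesis W_sym : forall i j : V, adj E i j -> W i j = W j i.
Hypothesis W_gt0 : forall i j : V, adj E i j -> 0 < W i j.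
Local Notation m := #|{: {i : V | i != i0}}|.
Local Notation N := #|{: {a : darc E | a \notin val T0}}|.
Local Notation mR := (measurableTypeR R).

Definition conductance (u : V -> R) i j : R := W i j * expR (u i + u j).
Definition wt (u : V -> R) (e : {set V}) : R := on_edge (conductance u) e.
Definition restr_edges (g : V -> V -> R) i j : R := if [set i; j]%SET \in E then g i j else 0.

Lemma cond_sym u i j : [set i; j]%SET \in E -> conductance u i j = conductance u j i.
Proof. by move=> h; rewrite /conductance (W_sym h) addrC. Qed.

Lemma wt_pair u i j : [set i; j]%SET \in E -> wt u [set i; j]%SET = conductance u i j.
Proof. by move=> h; apply: (on_edge_pair E2 h); exact: cond_sym. Qed.

Lemma wt_arc u (a : darc E) : wt u (arc_edge a) = conductance u (src a) (tgt a).
Proof. by apply: wt_pair; exact: arc_edge_in. Qed.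

Lemma wt_gt0 u e : e \in E -> 0 < wt u e.
Proof.
move=> eE; have /eqP/cards2P[x [y [_ exy]]] := E2 eE; rewrite exy in eE *.
by rewrite wt_pair// mulr_gt0 ?expR_gt0// W_gt0.
Qed.

Lemma restr_edges_sym g : (forall i j, [set i; j]%SET \in E -> g i j = g j i) ->
  forall i j, restr_edges g i j = restr_edges g j i.
Proof.
by move=> gC i j; rewrite /restr_edges [in RHS]finset.setUC; case: ifP => // /gC.
Qed.

Lemma sum_on_edge g : (forall i j, [set i; j]%SET \in E -> g i j = g j i) ->
  \sum_(e in E) on_edge g e = 2^-1 * \sum_i \sum_j restr_edges g i j.
Proof.
move=> gC; have := big_arc_edges E2 +%R (on_edge g).
rewrite (eq_bigr (fun a => g (src a) (tgt a))) => [|a _]; last first.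
  by apply: (on_edge_pair E2 (arc_edge_in a)); apply: gC; exact: arc_edge_in.
rewrite (big_arc_pairs _ _ g) big_split/= => ->.
by field.
Qed.

Definition tree_weight (u : V -> R) : R := tree_sum E (wt u).

Lemma tree_weight_gt0 u : 0 < tree_weight u.
Proof. by apply: (tree_sum_gt0 i0 E_connected) => e; exact: wt_gt0. Qed.

Lemma tree_weight_laplacian u : tree_weight u = \det (laplacian i0 (restr_edges (conductance u))).
Proof.
rewrite /tree_weight (tree_sumE i0 E2); congr (\det (laplacian _ _)).
apply/funext => i; apply/funext => j; rewrite /restr_edges; case: ifP => // h.
exact: wt_pair.
Qed.

Definition pinned_mu : set (pinned R i0) -> \bar R :=
  coord_measure (@pinned_extK R V i0) (@measurable_pinned_restr R V i0) (@measurable_pinned_ext R V i0).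

HB.instance Definition _ := SigmaFiniteMeasure.on pinned_mu.

Lemma pinned_measureE : pinned_measure R i0 = pinned_mu.
Proof. by apply: lebesgue_coordE; exact: pinned_restrK. Qed.

Lemma integral_pinned (g : pinned R i0 -> \bar R) : measurable_fun [set: pinned R i0] g ->
  (forall x, 0 <= g x)%E ->
  (\int[pinned_mu]_s g s = \int[@lebesgue_tuple R m]_x g (of_tuple (@pinned_ext R V i0) x))%E.
Proof. exact: integral_coord_measure. Qed.

Lemma of_tuple_pinned (x : m.-tuple mR) p :
  val (of_tuple (@pinned_ext R V i0) x) (nr p) = tnth x p.
Proof.
by rewrite /= ffunE insubT ?nr_neq// => h; rewrite ffunE; congr tnth; apply: nr_inj; rewrite nr_rank.
Qed.

Lemma val_pinned0 (u : pinned R i0) : val u i0 = 0.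
Proof. exact/eqP/(valP u). Qed.

Definition spin_weight (u s : V -> R) : R :=
  expR (- \sum_(e in E) on_edge (fun i j => W i j * (2^-1 * expR (u i + u j) * (s i - s j) ^+ 2)) e).

Lemma spin_weightE u (s : V -> R) : s i0 = 0 ->
  spin_weight u s = expR (- (2^-1 * quad (laplacian i0 (restr_edges (conductance u))) (fun p => s (nr p)))).
Proof.
move=> s0; rewrite quad_laplacian//; last exact/restr_edges_sym/cond_sym.
rewrite /spin_weight sum_on_edge; last first.
  by move=> i j h; rewrite (W_sym h) (addrC (u i)) -[in RHS]sqrrN opprB.
congr expR; congr (- _); congr (_ * _); rewrite mulr_sumr; apply: eq_bigr => i _.
rewrite mulr_sumr; apply: eq_bigr => j _; rewrite /restr_edges; case: ifP => _.
  by rewrite /conductance; ring.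
by rewrite mul0r mulr0.
Qed.

Lemma posdef_cond u : posdef (laplacian i0 (restr_edges (conductance u))).
Proof.
apply: (posdef_laplacian i0 E_connected).
- exact/restr_edges_sym/cond_sym.
- move=> i j; rewrite /restr_edges; case: ifP => // h.
  by rewrite mulr_ge0 ?expR_ge0// ltW// W_gt0.
- by move=> i j h; rewrite /restr_edges h mulr_gt0 ?expR_gt0// W_gt0.
Qed.

Lemma measurable_spin_weight u :
  measurable_fun [set: pinned R i0] (fun s => (spin_weight u (val s))%:E).
Proof.
apply/measurable_EFinP; apply: measurableT_comp => //; apply: measurableT_comp => //.
apply: measurable_sum_pred => e _; rewrite /on_edge; case: (enum e) => [|i [|j [|? ?]]]; try exact: measurable_cst.
apply: measurable_funM => //; apply: measurable_funM => //; apply: measurable_funX.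
by apply: measurable_funB; exact: measurable_pinned.
Qed.

Lemma integral_spin u :
  (\int[pinned_mu]_s (spin_weight u (val s))%:E = (Num.sqrt ((2 * pi) ^+ m / tree_weight u))%:E)%E.
Proof.
rewrite integral_pinned; last first.
- by move=> s; rewrite lee_fin expR_ge0.
- exact: measurable_spin_weight.
rewrite tree_weight_laplacian -gaussian_integral; last exact: posdef_cond.
apply: eq_integral => x _; rewrite spin_weightE ?val_pinned0//.
by congr (expR (- (_ * quad _ _)))%:E; apply/funext => p; rewrite of_tuple_pinned.
Qed.

Definition flow_weight (u : V -> R) (k : darc E -> R) : R :=
  expR (- \sum_a k a ^+ 2 / wt u (arc_edge a)).

Lemma measurable_flow_weight u :
  measurable_fun [set: flow R E] (fun k => (flow_weight u (val k))%:E).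
Proof.
apply/measurable_EFinP; apply: measurableT_comp => //; apply: measurableT_comp => //.
apply: measurable_sum => a; apply: measurable_funM => //; apply: measurable_funX.
exact: measurable_flow.
Qed.

(** The sigma-finite structure is built from a parent function and arcs known only to exist, so the
    measure and its Gaussian integral are delivered together. *)
Lemma flow_mu_ex : exists2 M : {sigma_finite_measure set (flow R E) -> \bar R},
  flow_measure (R := R) T0 = M & forall u,
  (\int[M]_k (flow_weight u (val k))%:E =
   (Num.sqrt (pi ^+ N / (2 ^+ m * tree_weight u)) * \prod_(e in E) wt u e)%:E)%E.
Proof.
have [f [tau [rf fT tin te]]] := tree_frame i0 T0 E2.
exists (coord_measure (flow_extK (R := R) rf fT tin te) (measurable_flow_restr (T0 := T0))
  (measurable_flow_ext (R := R) rf fT tin te)).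
  by apply: lebesgue_coordE; exact: flow_restrK.
move=> u.
have w0 e : e \in E -> 0 < wt u e by exact: wt_gt0.
rewrite integral_coord_measure; last first.
- by move=> k; rewrite lee_fin expR_ge0.
- exact: measurable_flow_weight.
set A := flow_form T0 tau (wt u).
have pA : posdef A := posdef_flow_form rf fT tin te w0.
(* [flow_weight] has no factor 1/2 in its exponent, unlike [gaussian_integral], so the matrix is
   twice the flow form. *)
have quad2 x : quad (2 *: A) x = 2 * quad A x.
  rewrite /quad mulr_sumr; apply: eq_bigr => i _; rewrite mulr_sumr; apply: eq_bigr => j _.
  by rewrite mxE; ring.
have p2A : posdef (2 *: A).
  by case: pA => sA pA; split => [|x /pA]; [rewrite linearZ/= sA|rewrite quad2 => ?; rewrite mulr_gt0].
transitivity (\int[@lebesgue_tuple R N]_x (expR (- (2^-1 * quad (2 *: A) (tnth x))))%:E)%E.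
  apply: eq_integral => x _; congr (expR (- _))%:E.
  rewrite quad2 mulKf//.
  rewrite -(quad_flow_form rf fT tin te)//=.
  by congr quad; apply/funext => i; rewrite ffunE enum_valK.
rewrite gaussian_integral// detZ /A (det_flow_form E2 rf fT tin te w0); congr EFin.
rewrite (big_arc_edges E2 _ (fun e => (wt u e)^-1))/=.
set P := \prod_(e in E) wt u e.
have P0 : 0 < P by apply: prodr_gt0 => e; exact: w0.
have -> : \prod_(e in E) ((wt u e)^-1 / wt u e) = P ^- 2.
  by rewrite big_split/= -expr2 prodfV -/P exprVn.
have -> : (2 * pi) ^+ N / (2 ^+ N * (P ^- 2 * 2 ^+ m * tree_sum E (wt u))) =
    pi ^+ N / (2 ^+ m * tree_weight u) * P ^+ 2 :> R.
  rewrite exprMn -/(tree_weight u).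
  have x0 : (2 : R) ^+ N != 0 by rewrite expf_neq0.
  have y0 : (2 : R) ^+ m != 0 by rewrite expf_neq0.
  move: x0 y0 (lt0r_neq0 (tree_weight_gt0 u)) (lt0r_neq0 P0).
  clearbody P; clear P0; move: ((2 : R) ^+ N) (2 ^+ m) (pi ^+ N) (tree_weight u) P.
  by move=> x y z d p x0 y0 d0 p0; field; rewrite x0 y0 d0 p0.
by rewrite sqrtrM ?sqrtr_sqr ?gtr0_norm// divr_ge0 ?exprn_ge0 ?pi_ge0// mulr_ge0 ?exprn_ge0// ltW ?tree_weight_gt0.
Qed.

End graph_integrals.

(** * The sigma model on a rooted graph *)

Section graph_sigma_model.
Variables (R : realType) (V : finType) (E : {set {set V}}).
Variables (W : V -> V -> R) (i0 : V).
Hypothesis E2 : forall e : {set V}, e \in E -> #|e| = 2%N.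
Hypothesis E_connected : connected_edges E.
Hypothesis W_sym : forall i j : V, adj E i j -> W i j = W j i.
Hypothesis W_gt0 : forall i j : V, adj E i j -> 0 < W i j.
Local Notation m := #|{: {i : V | i != i0}}|.
Local Notation mR := (measurableTypeR R).

Definition edge_weight (u : V -> R) : R :=
  expR (\sum_(e in E) on_edge (fun i j => W i j * (1 - cosh (u i - u j))) e).

(** The field is zero at [i0], so edges at the root turn into the weight [eta]. *)
Let W' (p q : 'I_m) : R := restr_edges E W (nr p) (nr q).
Let eta (p : 'I_m) : R := restr_edges E W (nr p) i0.

Let rW_sym i j : restr_edges E W i j = restr_edges E W j i.
Proof. by apply: restr_edges_sym => {}i {}j; exact: W_sym. Qed.

Let rW_ge0 i j : 0 <= restr_edges E W i j.
Proof. by rewrite /restr_edges; case: ifP => // h; rewrite ltW// W_gt0. Qed.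

Section field.
Variable u : V -> R.
Hypothesis u0 : u i0 = 0.
Let v (p : 'I_m) := u (nr p).

Let big_root (F : V -> R) : \sum_i F i = F i0 + \sum_p F (@nr V i0 p).
Proof. by rewrite (bigD1 i0)//= big_nonroot. Qed.

Lemma graph_energy : edge_weight u = expR (- energy W' eta v).
Proof.
rewrite /edge_weight (sum_on_edge E2) => [|i j h]; last first.
  by rewrite (W_sym h) -coshN opprB.
congr expR; rewrite /energy.
pose F i j := restr_edges E W i j * (cosh (u i - u j) - 1).
have FC i j : F i j = F j i by rewrite /F rW_sym -coshN opprB.
have F0 i : F i i = 0 by rewrite /F subrr cosh0 subrr mulr0.
have -> : \sum_i \sum_j restr_edges E (fun i j => W i j * (1 - cosh (u i - u j))) i j =
    - \sum_i \sum_j F i j.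
  rewrite -sumrN; apply: eq_bigr => i _; rewrite -sumrN; apply: eq_bigr => j _.
  by rewrite /F /restr_edges; case: ifP => _; ring.
have -> : \sum_i \sum_j W' i j * (cosh (v i - v j) - 1) = \sum_p \sum_q F (@nr V i0 p) (@nr V i0 q).
  by [].
have -> : \sum_i eta i * (cosh (v i) - 1) = \sum_p F (@nr V i0 p) i0.
  by apply: eq_bigr => p _; rewrite /F u0 subr0.
rewrite (big_root (fun i => \sum_j F i j)) (big_root (F i0)) F0.
under [X in _ + X]eq_bigr do rewrite big_root.
rewrite big_split/=.
rewrite (eq_bigr (fun p => F (nr p) i0)) => [|p _]; last exact: FC.
by field.
Qed.

(** The operator is the reduced Laplacian of the conductances multiplied on both sides by
    diag(e^(-u)). *)
Lemma graph_schroedinger :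
  \det (schroedinger W' eta v) = tree_weight E W u * (\prod_p expR (- v p)) ^+ 2.
Proof.
pose d : 'M[R]_m := diag_mx (\row_p expR (- v p)).
have -> : schroedinger W' eta v = d *m laplacian i0 (restr_edges E (conductance W u)) *m d.
  apply/matrixP => p q; rewrite /d mul_mx_diag mul_diag_mx !mxE.
  have e i j : restr_edges E (conductance W u) i j = restr_edges E W i j * expR (u i + u j).
    by rewrite /restr_edges; case: ifP => //; rewrite mul0r.
  rewrite e (eq_bigr _ (fun j _ => e (nr p) j)) expRD.
  have -> : \sum_j restr_edges E W (nr p) j * expR (u (nr p) + u j) =
      expR (v p) * (eta p + \sum_k W' p k * expR (v k)).
    rewrite big_root u0 addr0 mulrDr mulrC mulr_sumr; congr (_ + _).
    by apply: eq_bigr => q' _; rewrite expRD mulrCA.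
  rewrite -/(v p) -/(v q) -/(W' p q) !expRN.
  have := expR_gt0 (v p); have := expR_gt0 (v q).
  by case: eqVneq => [->|_] q0 p0 /=; field; rewrite ?gt_eqF.
rewrite !det_mulmx (tree_weight_laplacian i0 E2 W_sym) det_diag.
rewrite (eq_bigr (fun p => expR (- v p))) => [|p _]; last by rewrite mxE.
by rewrite expr2; ring.
Qed.

Lemma graph_density : sigma_density W' eta v =
  edge_weight u * Num.sqrt (tree_weight E W u) * \prod_(i | i != i0) expR (- u i).
Proof.
rewrite /sigma_density -graph_energy graph_schroedinger sqrtrM; last first.
  by rewrite ltW// (tree_weight_gt0 i0).
rewrite sqrtr_sqr ger0_norm; last by apply: prodr_ge0 => p _; exact: expR_ge0.
by rewrite mulrA big_nonroot.
Qed.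

End field.

Lemma graph_admissible : admissible W' eta.
Proof.
split; [by move=> p q; exact: rW_sym|by move=> p q; exact: rW_ge0|by move=> p; exact: rW_ge0|].
move=> v; pose u i := if insub i is Some k then v (enum_rank (k : {i | i != i0})) else 0.
have -> : v = fun p => u (nr p).
  by apply/funext => p; rewrite /u insubT ?nr_neq// => h; congr v; apply: nr_inj; rewrite nr_rank.
rewrite graph_schroedinger; last by rewrite /u insubF ?eqxx.
rewrite mulf_neq0 ?sqrf_eq0 ?(lt0r_neq0 (tree_weight_gt0 i0 E2 E_connected W_sym W_gt0 u))//.
by apply/prodf_neq0 => p _; rewrite gt_eqF ?expR_gt0.
Qed.

Definition graph_density_fun (u : V -> R) : R :=
  edge_weight u * Num.sqrt (tree_weight E W u) * \prod_(i | i != i0) expR (- u i).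

Lemma measurable_edge_weight :
  measurable_fun [set: pinned R i0] (fun u => edge_weight (val u) : R).
Proof.
apply: measurableT_comp => //.
apply: measurable_sum_pred => e _; rewrite /on_edge; case: (enum e) => [|i [|j [|? ?]]]; try exact: measurable_cst.
apply: measurable_funM => //; apply: measurable_funB => //; apply: measurable_cosh.
by apply: measurable_funB; exact: measurable_pinned.
Qed.

Lemma measurable_wt e : measurable_fun [set: pinned R i0] (fun u => wt W (val u) e : R).
Proof.
rewrite /wt /on_edge; case: (enum e) => [|i [|j [|? ?]]]; try exact: measurable_cst.
apply: measurable_funM => //; apply: measurableT_comp => //.
by apply: measurable_funD; exact: measurable_pinned.
Qed.

Lemma measurable_tree_weight : measurable_fun [set: pinned R i0] (fun u => tree_weight E W (val u) : R).
Proof.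
apply: measurable_sum_pred => T _; apply: measurable_prod_pred => e _.
exact: measurable_wt.
Qed.

Lemma measurable_prod_expRN :
  measurable_fun [set: pinned R i0] (fun u => \prod_(i | i != i0) expR (- val u i) : R).
Proof.
by apply: measurable_prod_pred => i _; apply: measurable_expRN; exact: measurable_pinned.
Qed.

Lemma integral_graph_density :
  (\int[@pinned_mu R V i0]_u (graph_density_fun (val u))%:E = (Num.sqrt (2 * pi) ^+ m)%:E)%E.
Proof.
rewrite integral_pinned; last first.
- move=> u; rewrite lee_fin !mulr_ge0 ?expR_ge0 ?sqrtr_ge0//.
  by apply: prodr_ge0 => p _; exact: expR_ge0.
- apply/measurable_EFinP; apply: measurable_funM; last exact: measurable_prod_expRN.
  apply: measurable_funM; first exact: measurable_edge_weight.
  by apply: measurable_sqrt; exact: measurable_tree_weight.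
rewrite -(sigma_model_normalized graph_admissible).
apply: eq_integral => x _; congr EFin.
rewrite /graph_density_fun -graph_density ?val_pinned0//.
by congr sigma_density; apply/funext => p; rewrite of_tuple_pinned.
Qed.

End graph_sigma_model.

(** * Tonelli for counting and product measures *)

Section finite_counting.
Context (R : realType) (T : finType) (x0 : T).
Local Notation X := (discrete_space x0).

Definition fin_counting : set X -> \bar R := counting.

HB.instance Definition _ := Measure.on fin_counting.

Let fin_counting_sigma_finite : sigma_finite [set: X] fin_counting.
Proof.
exists (fun=> setT); first by rewrite bigcup_const//; exists 0%N.
by move=> _; split => //; rewrite /fin_counting /counting asboolT ?ltry//; exact: finite_finset.
Qed.

HB.instance Definition _ := Measure_isSigmaFinite.Build _ _ _ fin_counting fin_counting_sigma_finite.

Lemma integral_fin_counting (f : X -> \bar R) : (forall x, 0 <= f x)%E ->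
  (\int[fin_counting]_x f x = \sum_(x : T) f x)%E.
Proof.
move=> f0.
have -> : [set: X] = \big[setU/set0]_(x <- index_enum T) ([set x] : set X).
  apply/seteqP; split => // x _; rewrite -bigcup_seq; exists x => //=.
  by rewrite mem_index_enum.
rewrite ge0_integral_bigsetU//=.
- apply: eq_bigr => x _.
  rewrite (eq_integral (cst (f x))); last by move=> y; rewrite inE => ->.
  rewrite integral_cst//= [X in (_ * X)%E](_ : _ = 1%E) ?mule1//.
  by rewrite /fin_counting /counting asboolT// fset_set1 finmap.cardfs1.
- exact: index_enum_uniq.
- by apply/trivIsetP => i j _ _ ij; apply/seteqP; split => // y [/= -> e]; rewrite e eqxx in ij.
Qed.

(** The function splits into finitely many terms, one for each level set of [g]. *)
Lemma measurable_select d (Y : measurableType d) (g : Y -> X) (h : T -> Y -> R) :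
  measurable_fun [set: Y] g -> (forall t, measurable_fun [set: Y] (h t)) ->
  measurable_fun [set: Y] (fun y => h (g y) y).
Proof.
move=> mg mh.
rewrite (_ : (fun y => _) = fun y => \sum_(t : T) h t y * \1_(g @^-1` [set t]) y).
  apply: measurable_sum => t; apply: measurable_funM => //.
  by apply: measurable_indic; rewrite -[X in measurable X]setTI; exact: mg.
apply/funext => y; rewrite (bigD1 (g y))//= indicE mem_set// mulr1 big1 ?addr0//.
move=> t tg; rewrite indicE memNset ?mulr0// => /= e; by rewrite e eqxx in tg.
Qed.

End finite_counting.

Section tonelli.
Local Open Scope ereal_scope.
Context d d' (T1 : measurableType d) (T2 : measurableType d') (R : realType).
Variable m1 : {sigma_finite_measure set T1 -> \bar R}.
Variable m2 : {sigma_finite_measure set T2 -> \bar R}.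
Variable f : T1 * T2 -> \bar R.
Hypotheses (mf : measurable_fun [set: T1 * T2] f) (f0 : forall x, 0 <= f x).

Lemma integral_sf_prod : \int[sf_prod m1 m2]_z f z = \int[m1]_x \int[m2]_y f (x, y).
Proof. exact: fubini_tonelli1. Qed.

Lemma exchange_integral : \int[m1]_x \int[m2]_y f (x, y) = \int[m2]_y \int[m1]_x f (x, y).
Proof. by rewrite fubini_tonelli. Qed.

Lemma measurable_integral : measurable_fun [set: T1] (fun x => \int[m2]_y f (x, y)).
Proof. exact: measurable_fun_fubini_tonelli_F. Qed.

End tonelli.

Section density.
Local Open Scope ereal_scope.
Context d (T : measurableType d) (R : realType).
Variables (mu : {measure set T -> \bar R}) (f : T -> \bar R).

Lemma density_probability : measurable_fun [set: T] f -> (forall x, 0 <= f x) ->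
  \int[mu]_x f x = 1 ->
  exists P : probability T R, forall A, measurable A -> P A = \int[mu]_(x in A) f x.
Proof.
move=> mf f0 f1.
pose nu A := \int[mu]_(x in A) f x.
have nu0 : nu set0 = 0 by rewrite /nu integral_set0.
have nu_ge0 A : 0 <= nu A by exact: integral_ge0.
have nu_add : semi_sigma_additive nu.
  move=> F mF tF mUF; rewrite /nu; apply: cvg_toP.
    apply: ereal_nondecreasing_is_cvgn => m n mn.
    by apply: lee_sum_nneg_natr => // k _ _; exact: nu_ge0.
  by rewrite ge0_integral_bigcup//; exact: measurable_funTS.
pose M := isMeasure.Build _ _ _ nu nu0 nu_ge0 nu_add.
pose Mu : {measure set T -> \bar R} := HB.pack nu M.
pose Pm := Measure_isProbability.Build _ _ _ Mu f1.
pose P : probability T R := HB.pack nu M Pm.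
by exists P.
Qed.

End density.

Ltac measurable_proj := repeat (first
  [ exact: measurable_id | exact: measurable_fst | exact: measurable_snd
  | apply: measurable_fun_pair
  | apply: (measurableT_comp measurable_fst) | apply: (measurableT_comp measurable_snd) ]).

Section iterated_integrals.
Local Open Scope ereal_scope.
Context d1 d2 d3 d4 (T1 : measurableType d1) (T2 : measurableType d2)
  (T3 : measurableType d3) (T4 : measurableType d4) (R : realType).
Variables (m1 : {sigma_finite_measure set T1 -> \bar R}) (m2 : {sigma_finite_measure set T2 -> \bar R})
  (m3 : {sigma_finite_measure set T3 -> \bar R}) (m4 : {sigma_finite_measure set T4 -> \bar R}).

Lemma integral_sf_prod3 (f : T1 * T2 * T3 -> \bar R) :
  measurable_fun setT f -> (forall x, 0 <= f x) ->
  \int[sf_prod (sf_prod m1 m2) m3]_x f x =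
  \int[m1]_x \int[m2]_y \int[m3]_z f (x, y, z).
Proof.
move=> mf f0; rewrite integral_sf_prod// integral_sf_prod//.
- exact: measurable_integral.
- by move=> x; exact: integral_ge0.
Qed.

Lemma integral_sf_prod4 (f : T1 * T2 * T3 * T4 -> \bar R) :
  measurable_fun setT f -> (forall x, 0 <= f x) ->
  \int[sf_prod (sf_prod (sf_prod m1 m2) m3) m4]_x f x =
  \int[m1]_x \int[m2]_y \int[m3]_z \int[m4]_t f (x, y, z, t).
Proof.
move=> mf f0; rewrite integral_sf_prod// integral_sf_prod3//.
- exact: measurable_integral.
- by move=> x; exact: integral_ge0.
Qed.

End iterated_integrals.

Section regroup.
Local Open Scope ereal_scope.
Context dk du di dj (K : measurableType dk) (U : measurableType du)
  (I : measurableType di) (J : measurableType dj) (R : realType).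
Variables (mk : {sigma_finite_measure set K -> \bar R}) (mu : {sigma_finite_measure set U -> \bar R})
  (mi : {sigma_finite_measure set I -> \bar R}) (mj : {sigma_finite_measure set J -> \bar R}).
Variable h : K * K * U * U * I * I * J * J -> \bar R.
Hypotheses (mh : measurable_fun setT h) (h0 : forall x, 0 <= h x).

(** The variables to integrate out are interleaved with those to keep. [h7], [h6], [h4] and [h3]
    remove T', i1', s and k' in this order; [h5] only regroups the arguments. *)
Let h7 x := \int[mj]_t' h (x, t').
Let mh7 : measurable_fun setT h7. Proof. exact: measurable_integral. Qed.
Let h70 x : 0 <= h7 x. Proof. exact: integral_ge0. Qed.

Let h6 (z : K * K * U * U * I * J) := \int[mi]_i' h7 (z.1, i', z.2).
Let mh6 : measurable_fun setT h6.
Proof.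
have mf : measurable_fun setT (fun z : K * K * U * U * I * J * I => h7 (z.1.1, z.2, z.1.2)).
  by apply: (measurableT_comp mh7); measurable_proj.
exact: (measurable_integral mi mf (fun z => h70 _)).
Qed.
Let h60 x : 0 <= h6 x. Proof. exact: integral_ge0. Qed.

Let h5 (z : K * K * (U * I * J)) s := h6 (z.1, s, z.2.1.1, z.2.1.2, z.2.2).
Let mh5 : measurable_fun setT (fun z => h5 z.1 z.2).
Proof. by apply: (measurableT_comp mh6); measurable_proj. Qed.

Let h4 z := \int[mu]_s h5 z s.
Let mh4 : measurable_fun setT h4.
Proof. by apply: (measurable_integral mu (f := fun z => h5 z.1 z.2)) => // z; exact: h60. Qed.
Let h40 x : 0 <= h4 x. Proof. by apply: integral_ge0 => s _; exact: h60. Qed.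

Let h3 (z : K * (U * I * J)) := \int[mk]_k' h4 (z.1, k', z.2).
Let mh3 : measurable_fun setT h3.
Proof.
have mf : measurable_fun setT (fun z : K * (U * I * J) * K => h4 (z.1.1, z.2, z.1.2)).
  by apply: (measurableT_comp mh4); measurable_proj.
exact: (measurable_integral mk mf (fun z => h40 _)).
Qed.
Let h30 x : 0 <= h3 x. Proof. exact: integral_ge0. Qed.

Lemma integral_regroup :
  \int[sf_prod (sf_prod (sf_prod (sf_prod (sf_prod (sf_prod (sf_prod mk mk) mu) mu) mi) mi) mj) mj]_x h x =
  \int[sf_prod (sf_prod (sf_prod mk mu) mi) mj]_z
    \int[mk]_k' \int[mu]_s \int[mi]_i' \int[mj]_t'
      h (z.1.1.1, k', s, z.1.1.2, z.1.2, i', z.2, t').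
Proof.
have m77 := measurable_integral mj mh7 h70.
have m770 x : 0 <= \int[mj]_t h7 (x, t) by apply: integral_ge0 => t _; exact: h70.
rewrite (integral_sf_prod _ _ mh h0) (integral_sf_prod _ _ mh7 h70) (integral_sf_prod _ _ m77 m770).
transitivity (\int[sf_prod (sf_prod (sf_prod (sf_prod mk mk) mu) mu) mi]_x \int[mj]_t h6 (x, t)).
  apply: eq_integral => x _.
  have mx : measurable_fun setT (fun z : I * J => h7 (x, z.1, z.2)).
    by apply: (measurableT_comp mh7); measurable_proj; exact: measurable_cst.
  exact: (exchange_integral mi mj mx (fun z => h70 _)).
have m65 := measurable_integral mj mh6 h60.
have h650 x : 0 <= \int[mj]_t h6 (x, t) by apply: integral_ge0 => t _; exact: h60.
rewrite (integral_sf_prod4 _ _ _ _ m65 h650).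
(* The kept variables u, i1 and T are bundled into one product space, so that a single exchange
   moves s past all of them. *)
transitivity (\int[sf_prod mk mk]_x \int[sf_prod (sf_prod mu mi) mj]_w h4 (x, w)).
  apply: eq_integral => x _.
  have mx : measurable_fun setT (fun z : U * (U * I * J) => h5 (x, z.2) z.1).
    by apply: (measurableT_comp mh6); measurable_proj; exact: measurable_cst.
  have := exchange_integral mu (sf_prod (sf_prod mu mi) mj) mx (fun z => h60 _).
  move=> /= <-; apply: eq_integral => s _.
  have mxs : measurable_fun setT (fun z : U * I * J => h6 (x, s, z.1.1, z.1.2, z.2)).
    by apply: (measurableT_comp mh6); measurable_proj; exact: measurable_cst.
  by rewrite -(integral_sf_prod3 _ _ _ mxs (fun z => h60 _)).
have m4 := measurable_integral (sf_prod (sf_prod mu mi) mj) mh4 h40.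
have m40 x : 0 <= \int[sf_prod (sf_prod mu mi) mj]_w h4 (x, w).
  by apply: integral_ge0 => t _; exact: h40.
rewrite (integral_sf_prod _ _ m4 m40).
transitivity (\int[mk]_k \int[sf_prod (sf_prod mu mi) mj]_w h3 (k, w)).
  apply: eq_integral => k _.
  have mk4 : measurable_fun setT (fun z : K * (U * I * J) => h4 (k, z.1, z.2)).
    by apply: (measurableT_comp mh4); measurable_proj; exact: measurable_cst.
  exact: (exchange_integral mk (sf_prod (sf_prod mu mi) mj) mk4 (fun z => h40 _)).
have mh34 : measurable_fun setT (fun z : K * U * I * J => h3 (z.1.1.1, (z.1.1.2, z.1.2, z.2))).
  by apply: (measurableT_comp mh3); measurable_proj.
rewrite [RHS](integral_sf_prod4 mk mu mi mj mh34 (fun z => h30 _)).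
apply: eq_integral => k _.
have mk3 : measurable_fun setT (fun z : U * I * J => h3 (k, z)).
  by apply: (measurableT_comp mh3); exact: pair1_measurable.
exact: (integral_sf_prod3 mu mi mj mk3 (fun z => h30 _)).
Qed.

End regroup.

(** * The two densities *)

Lemma sqrtr_exp (R : rcfType) (x : R) n : 0 <= x -> Num.sqrt (x ^+ n) = Num.sqrt x ^+ n.
Proof.
move=> x0; elim: n => [|n IH]; first by rewrite !expr0 sqrtr1.
by rewrite !exprS sqrtrM// IH.
Qed.

Section densities_algebra.
Variables (R : realType) (V : finType) (E : {set {set V}}).
Variables (W : V -> V -> R) (i0 : V) (T0 : dtree E).
Hypothesis E2 : forall e : {set V}, e \in E -> #|e| = 2%N.
Hypothesis E_connected : connected_edges E.
Hypothesis W_sym : forall i j : V, adj E i j -> W i j = W j i.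
Hypothesis W_gt0 : forall i j : V, adj E i j -> 0 < W i j.
Local Notation m := #|{: {i : V | i != i0}}|.
Local Notation N := #|{: {a : darc E | a \notin val T0}}|.

Let wt_pos u e (eE : e \in E) : 0 < wt W u e := wt_gt0 E2 W_sym W_gt0 u eE.

Lemma card_spanning_tree T : is_spanning_tree E T -> #|T| = m.
Proof.
by move=> /(spanning_treeP i0 E2)[f rf ->]; rewrite card_parent_edges// card_nonroot.
Qed.

Lemma prod_compl_tree u (T : {set {set V}}) : T \subset E ->
  \prod_(e in E :\: T) (wt W u e)^-1 = (\prod_(e in T) wt W u e) / \prod_(e in E) wt W u e.
Proof.
move=> TE; rewrite [X in _ / X](big_setID T)/= (finset.setIidPr TE).
have T0' : \prod_(e in T) wt W u e != 0.
  by rewrite gt_eqF// prodr_gt0// => e eT; apply: wt_pos; exact: (fintype.subsetP TE).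
rewrite invfM mulrA mulfV// mul1r -prodfV.
by [].
Qed.

Definition vertex_total (u : V -> R) : R := \sum_i expR (2 * u i).

Lemma vertex_total_gt0 u : 0 < vertex_total u.
Proof.
rewrite /vertex_total (bigD1 i0)//= ltr_pwDl ?expR_gt0// sumr_ge0// => i _; exact: expR_ge0.
Qed.

Lemma sum_vertex_prob u : \sum_i expR (2 * u i) / vertex_total u = 1.
Proof. by rewrite -mulr_suml mulfV// gt_eqF// vertex_total_gt0. Qed.

(** The factors shared by both densities. *)
Definition single_const (k : darc E -> R) (u : V -> R) (i1 : V) : R :=
  edge_weight E W u * flow_weight W u k * (expR (2 * u i1) / vertex_total u)
  * \prod_(i | i != i0) expR (- u i).

Lemma rho_singleE (k : darc E -> R) u i1 (T : {set {set V}}) : T \subset E ->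
  rho_single W i0 k u i1 T =
  (pi ^+ #|E|)^-1 * (\prod_(e in T) wt W u e) / (\prod_(e in E) wt W u e) * single_const k u i1.
Proof.
move=> TE; rewrite /rho_single /single_const -/(edge_weight E W u) -/(vertex_total u).
rewrite prod_compl_tree//.
have -> : expR (- \sum_(a : darc E) k a ^+ 2 / (W (src a) (tgt a) * expR (u (src a) + u (tgt a)))) =
    flow_weight W u k.
  by congr (expR (- _)); apply: eq_bigr => a _; rewrite (wt_arc E2 W_sym).
by ring.
Qed.

(** On the diagonal the density is a product of one factor for each of k', s, i1', T' and a
    prefactor free of them. The powers of 2 come from omega' being half the conductance. *)
Lemma rho_bigE (k k' : darc E -> R) s u i1 i1' (T T' : {set {set V}}) : is_spanning_tree E T -> is_spanning_tree E T' ->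
  rho_big W i0 k k' s u u i1 i1' T T' =
  (4 ^+ m / (2 * pi) ^+ (2 * #|E|)%N * ((\prod_(e in T) wt W u e) / 2 ^+ m) / 2 ^+ m
    * (4 ^+ #|E| / (\prod_(e in E) wt W u e) ^+ 2) * single_const k u i1)
  * flow_weight W u k' * spin_weight E W u s * (expR (2 * u i1') / vertex_total u)
  * \prod_(e in T') wt W u e.
Proof.
move=> sT sT'; rewrite /rho_big -/(vertex_total u) -(card_nonroot i0).
have on_wt e : on_edge (omega' W u) e = wt W u e / 2.
  rewrite /wt /on_edge; case: (enum e) => [|i [|j [|? ?]]]; rewrite ?mul0r//.
  by rewrite /omega' /conductance mulrAC.
have prodT S : is_spanning_tree E S ->
    \prod_(e in S) on_edge (omega' W u) e = (\prod_(e in S) wt W u e) / 2 ^+ m.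
  move=> sS; rewrite (eq_bigr (fun e => wt W u e * 2^-1)) => [|e _]; last exact: on_wt.
  by rewrite big_split/= prodr_const card_spanning_tree// exprVn.
rewrite !prodT//.
have -> : \prod_(e in E) (on_edge (omega' W u) e ^+ 2)^-1 =
    4 ^+ #|E| / (\prod_(e in E) wt W u e) ^+ 2.
  rewrite -prodrXl -prodfV -prodr_const -big_split/=; apply: eq_bigr => e eE.
  by rewrite on_wt; field; rewrite gt_eqF ?wt_pos.
have -> : expR (\sum_(e in E) on_edge (fun i j =>
      W i j * (1 - cosh (u i - u j) - 2^-1 * expR (u i + u j) * (s i - s j) ^+ 2)) e) =
    edge_weight E W u * spin_weight E W u s.
  rewrite /edge_weight /spin_weight -expRD -sumrB; congr expR; apply: eq_bigr => e _.
  by rewrite /on_edge; case: (enum e) => [|i [|j [|? ?]]]; rewrite ?subr0//; ring.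
have -> : expR (- \sum_(a : darc E) (k a ^+ 2 + k' a ^+ 2) / (2 * omega' W u (src a) (tgt a))) =
    flow_weight W u k * flow_weight W u k'.
  rewrite /flow_weight -expRD -opprD -big_split/=; congr (expR (- _)); apply: eq_bigr => a _.
  rewrite (wt_arc E2 W_sym) -mulrDl; congr (_ / _).
  by rewrite /omega' /conductance; field.
rewrite expRD /single_const -!/(vertex_total u).
rewrite (invfM (vertex_total u)); set a := 4 ^+ m / _; set b := (2 ^+ m)^-1; set c := _ / _ ^+ 2.
by move: a b c => a b c; ring.
Qed.

(** Since N + m = 2|E|, the two Gaussian square roots multiply to pi^|E| / D, and the last factor D
    comes from the sum over T'. *)
Lemma big_constant u (p c : R) :
  4 ^+ m / (2 * pi) ^+ (2 * #|E|)%N * (p / 2 ^+ m) / 2 ^+ m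
    * (4 ^+ #|E| / (\prod_(e in E) wt W u e) ^+ 2) * c
    * (Num.sqrt (pi ^+ N / (2 ^+ m * tree_weight E W u)) * \prod_(e in E) wt W u e)
    * Num.sqrt ((2 * pi) ^+ m / tree_weight E W u) * tree_weight E W u
  = (pi ^+ #|E|)^-1 * p / (\prod_(e in E) wt W u e) * c.
Proof.
have d0 : 0 < tree_weight E W u by exact: (tree_weight_gt0 i0).
have P0 : 0 < \prod_(e in E) wt W u e by apply: prodr_gt0 => e; exact: wt_pos.
have NE : (N + m = 2 * #|E|)%N by rewrite (card_nonroot i0) card_arcs.
have pi0 : 0 < pi ^+ #|E| :> R by rewrite exprn_gt0// pi_gt0.
have s : Num.sqrt (pi ^+ N / (2 ^+ m * tree_weight E W u)) * Num.sqrt ((2 * pi) ^+ m / tree_weight E W u) =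
    pi ^+ #|E| / tree_weight E W u.
  rewrite -sqrtrM ?divr_ge0 ?exprn_ge0 ?pi_ge0 ?mulr_ge0 ?exprn_ge0 ?(ltW d0)//.
  have -> : pi ^+ N / (2 ^+ m * tree_weight E W u) * ((2 * pi) ^+ m / tree_weight E W u) = (pi ^+ #|E| / tree_weight E W u) ^+ 2.
    rewrite expr_div_n -exprM (mulnC #|E|) -NE exprD exprMn.
    have y0 : (2 : R) ^+ m != 0 by rewrite expf_neq0.
    move: y0 (lt0r_neq0 d0); move: ((2 : R) ^+ m) (pi ^+ m) (pi ^+ N) (tree_weight E W u).
    by move=> x y z d x0 {}d0; field; rewrite x0 d0.
  by rewrite sqrtr_sqr ger0_norm// ltW// divr_gt0.
have e4 : (4 : R) ^+ m = 2 ^+ m * 2 ^+ m by rewrite -exprMn; congr (_ ^+ _); ring.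
have eP : (2 * pi) ^+ (2 * #|E|)%N = 4 ^+ #|E| * (pi ^+ #|E|) ^+ 2 :> R.
  rewrite mulnC exprM exprMn exprMn -!exprM !(mulnC #|E|) !exprM; congr (_ ^+ _ * _); ring.
transitivity (4 ^+ m / (2 * pi) ^+ (2 * #|E|)%N * (p / 2 ^+ m) / 2 ^+ m
    * (4 ^+ #|E| / (\prod_(e in E) wt W u e) ^+ 2) * c * \prod_(e in E) wt W u e * tree_weight E W u
    * (Num.sqrt (pi ^+ N / (2 ^+ m * tree_weight E W u)) * Num.sqrt ((2 * pi) ^+ m / tree_weight E W u))).
  move: (Num.sqrt _) (Num.sqrt _) => r1 r2.
  set a := 4 ^+ m / _; set b := (2 ^+ m)^-1; set q := 4 ^+ #|E| / _ ^+ 2.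
  by move: a b q => a b q; ring.
rewrite s e4 eP.
have x0 : (2 : R) ^+ m != 0 by rewrite expf_neq0.
have y0 : (4 : R) ^+ #|E| != 0 by rewrite expf_neq0.
move: x0 y0 (lt0r_neq0 d0) (lt0r_neq0 P0) (lt0r_neq0 pi0).
move: ((2 : R) ^+ m) ((4 : R) ^+ #|E|) (tree_weight E W u) (\prod_(e in E) wt W u e) (pi ^+ #|E|).
by move=> x y d P q x0 y0 {}d0 {}P0 {}pi0; field; rewrite x0 y0 d0 P0 pi0.
Qed.

(** A single Gaussian root meets the tree sum here, which leaves the sqrt(D) that the sigma model
    requires. *)
Lemma mass_constant u :
  (pi ^+ #|E|)^-1 * tree_weight E W u / (\prod_(e in E) wt W u e)
    * (Num.sqrt (pi ^+ N / (2 ^+ m * tree_weight E W u)) * \prod_(e in E) wt W u e)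
  = (Num.sqrt (2 * pi) ^+ m)^-1 * Num.sqrt (tree_weight E W u).
Proof.
have d0 : 0 < tree_weight E W u by exact: (tree_weight_gt0 i0).
have P0 : 0 < \prod_(e in E) wt W u e by apply: prodr_gt0 => e; exact: wt_pos.
have NE : (N + m = 2 * #|E|)%N by rewrite (card_nonroot i0) card_arcs.
have pi0 : 0 < pi ^+ #|E| :> R by rewrite exprn_gt0// pi_gt0.
have pi1 : 0 < pi ^+ m :> R by rewrite exprn_gt0// pi_gt0.
have x0 : 0 < (2 : R) ^+ m by rewrite exprn_gt0.
have -> : Num.sqrt (2 * pi) ^+ m = Num.sqrt ((2 * pi) ^+ m) :> R by rewrite sqrtr_exp// mulr_ge0// pi_ge0.
have -> : Num.sqrt (pi ^+ N / (2 ^+ m * tree_weight E W u)) =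
    pi ^+ #|E| / (tree_weight E W u) * (Num.sqrt (tree_weight E W u) / Num.sqrt ((2 * pi) ^+ m)).
  rewrite -sqrtrV ?exprn_ge0 ?mulr_ge0 ?pi_ge0// -sqrtrM ?(ltW d0)//.
  have e : pi ^+ #|E| / tree_weight E W u = Num.sqrt ((pi ^+ #|E| / tree_weight E W u) ^+ 2).
    by rewrite sqrtr_sqr ger0_norm// divr_ge0 ?(ltW pi0) ?(ltW d0).
  rewrite [X in _ = X * _]e -sqrtrM ?sqr_ge0//.
  congr Num.sqrt; rewrite expr_div_n -exprM (mulnC #|E|) -NE exprD exprMn.
  move: (lt0r_neq0 x0) (lt0r_neq0 d0) (lt0r_neq0 pi1); move: ((2 : R) ^+ m) (pi ^+ m) (pi ^+ N) (tree_weight E W u).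
  by move=> x y z d {}x0 {}d0 {}pi1; field; rewrite x0 d0 pi1.
have t0 : 0 < Num.sqrt ((2 * pi) ^+ m) :> R by rewrite sqrtr_gt0 exprn_gt0// mulr_gt0// pi_gt0.
move: (lt0r_neq0 t0) (lt0r_neq0 d0) (lt0r_neq0 P0) (lt0r_neq0 pi0).
move: (Num.sqrt ((2 * pi) ^+ m)) (Num.sqrt (tree_weight E W u)) (tree_weight E W u) (\prod_(e in E) wt W u e) (pi ^+ #|E|).
by move=> t r d P q {}t0 {}d0 {}P0 {}pi0; field; rewrite t0 d0 P0 pi0.
Qed.

End densities_algebra.

(** * Integration of the densities *)

Lemma integral_scale d (T : measurableType d) (R : realType) (mu : {measure set T -> \bar R})
    (c : R) (f : T -> R) :
  measurable_fun [set: T] (fun x => (f x)%:E) -> (forall x, 0 <= f x) -> 0 <= c ->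
  (\int[mu]_x (c%:E * (f x)%:E) = c%:E * \int[mu]_x (f x)%:E)%E.
Proof.
move=> mf f0 c0; rewrite (ge0_integralZl mu measurableT mf)//.
by move=> x _; rewrite lee_fin.
Qed.

Lemma measurable_proj4 d d1 d2 d3 d4 (X : measurableType d) (T1 : measurableType d1)
    (T2 : measurableType d2) (T3 : measurableType d3) (T4 : measurableType d4)
    (g : X -> T1 * T2 * T3 * T4) : measurable_fun [set: X] g ->
  [/\ measurable_fun [set: X] (fun x => (g x).1.1.1),
    measurable_fun [set: X] (fun x => (g x).1.1.2),
    measurable_fun [set: X] (fun x => (g x).1.2)
    & measurable_fun [set: X] (fun x => (g x).2)].
Proof.
move=> mg; have m1 := measurableT_comp measurable_fst mg.
have m2 := measurableT_comp measurable_fst m1.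
split.
- exact: (measurableT_comp measurable_fst m2).
- exact: (measurableT_comp measurable_snd m2).
- exact: (measurableT_comp measurable_snd m1).
- exact: (measurableT_comp measurable_snd mg).
Qed.

Section density_measurability.
Variables (R : realType) (V : finType) (E : {set {set V}}).
Variables (W : V -> V -> R) (i0 : V) (T0 : dtree E).
Hypothesis E2 : forall e : {set V}, e \in E -> #|e| = 2%N.
Hypothesis W_sym : forall i j : V, adj E i j -> W i j = W j i.
Hypothesis W_gt0 : forall i j : V, adj E i j -> 0 < W i j.
Context d (X : measurableType d).

Lemma measurable_invr_gt0 (f : X -> R) : measurable_fun [set: X] f -> (forall x, 0 < f x) ->
  measurable_fun [set: X] (fun x => (f x)^-1).
Proof.
move=> mf f0; rewrite (_ : (fun x => _) = fun x => expR (- ln (f x))).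
  by apply: measurable_expRN; exact: measurableT_comp.
by apply/funext => x; rewrite expRN lnK// posrE.
Qed.

Lemma measurable_on_edge (g : X -> V -> V -> R) e :
  (forall i j, measurable_fun [set: X] (fun x => g x i j)) ->
  measurable_fun [set: X] (fun x => on_edge (g x) e).
Proof.
move=> mg; rewrite /on_edge.
by case: (enum e) => [|i [|j [|? ?]]] => //; exact: measurable_cst.
Qed.

Variables (u s : X -> pinned R i0) (k : X -> flow R E).
Variables (i1 : X -> vertex_space i0) (T : X -> tree_space T0).
Hypotheses (mu : measurable_fun [set: X] u) (ms : measurable_fun [set: X] s)
  (mk : measurable_fun [set: X] k) (mi1 : measurable_fun [set: X] i1)
  (mT : measurable_fun [set: X] T).

Let mval (w : X -> pinned R i0) (mw : measurable_fun [set: X] w) i :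
  measurable_fun [set: X] (fun x => val (w x) i : R).
Proof. exact: (measurableT_comp (measurable_pinned i)). Qed.

Let mexp (g : X -> R) : measurable_fun [set: X] g -> measurable_fun [set: X] (fun x => expR (g x)).
Proof. by move=> mg; apply: measurableT_comp. Qed.

Let mwt e : measurable_fun [set: X] (fun x => wt W (val (u x)) e : R).
Proof. exact: (measurableT_comp (@measurable_wt R V W i0 e)). Qed.

Let wt_pos x e (eE : e \in E) : 0 < wt W (val (u x)) e := wt_gt0 E2 W_sym W_gt0 _ eE.

Lemma measurable_prod_wt_invX n :
  measurable_fun [set: X] (fun x => ((\prod_(e in E) wt W (val (u x)) e) ^+ n)^-1 : R).
Proof.
apply: measurable_invr_gt0; first by apply: measurable_funX; apply: measurable_prod_pred => e _.
by move=> x; rewrite exprn_gt0// prodr_gt0// => e; exact: wt_pos.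
Qed.

Lemma measurable_prod_wt_tree :
  measurable_fun [set: X] (fun x => \prod_(e in val (T x : stree E)) wt W (val (u x)) e : R).
Proof.
apply: (measurable_select (h := fun (t : stree E) x => \prod_(e in val t) wt W (val (u x)) e) mT) => t.
by apply: measurable_prod_pred => e _.
Qed.

Lemma measurable_vertex_prob :
  measurable_fun [set: X] (fun x => expR (2 * val (u x) (i1 x)) / vertex_total (val (u x)) : R).
Proof.
have m2 i : measurable_fun [set: X] (fun x => expR (2 * val (u x) i) : R).
  by apply: mexp; apply: measurable_funM => //; exact: mval.
apply: measurable_funM.
  exact: (measurable_select (h := fun i x => expR (2 * val (u x) i)) mi1).
apply: measurable_invr_gt0 => [|x]; first exact: measurable_sum.
exact: (vertex_total_gt0 i0).
Qed.

Lemma measurable_flow_weight_joint :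
  measurable_fun [set: X] (fun x => flow_weight W (val (u x)) (val (k x)) : R).
Proof.
apply: measurable_expRN; apply: measurable_sum => a; apply: measurable_funM.
  by apply: measurable_funX; exact: (measurableT_comp (measurable_flow a)).
by apply: measurable_invr_gt0 => // x; apply: wt_pos; exact: arc_edge_in.
Qed.

Lemma measurable_spin_weight_joint :
  measurable_fun [set: X] (fun x => spin_weight E W (val (u x)) (val (s x)) : R).
Proof.
apply: measurable_expRN; apply: measurable_sum_pred => e _; apply: measurable_on_edge => i j.
apply: measurable_funM => //; apply: measurable_funM.
  by apply: measurable_funM => //; apply: mexp; apply: measurable_funD; exact: mval.
by apply: measurable_funX; apply: measurable_funB; exact: mval.
Qed.

Lemma measurable_single_const :
  measurable_fun [set: X] (fun x => single_const W i0 (val (k x)) (val (u x)) (i1 x) : R).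
Proof.
apply: measurable_funM; last exact: (measurableT_comp (@measurable_prod_expRN R V i0)).
apply: measurable_funM; last exact: measurable_vertex_prob.
apply: measurable_funM; last exact: measurable_flow_weight_joint.
exact: (measurableT_comp (@measurable_edge_weight R V E W i0)).
Qed.

Lemma measurable_rho_single : measurable_fun [set: X]
  (fun x => rho_single W i0 (val (k x)) (val (u x)) (i1 x) (val (T x : stree E)) : R).
Proof.
rewrite (_ : (fun x => _) = fun x => (pi ^+ #|E|)^-1 * (\prod_(e in val (T x : stree E)) wt W (val (u x)) e)
    / (\prod_(e in E) wt W (val (u x)) e) * single_const W i0 (val (k x)) (val (u x)) (i1 x)).
  apply: measurable_funM; last exact: measurable_single_const.
  apply: measurable_funM; last exact: (measurable_prod_wt_invX 1).
  by apply: measurable_funM => //; exact: measurable_prod_wt_tree.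
apply/funext => x; rewrite rho_singleE//.
by case/and3P: (valP (T x : stree E)).
Qed.

End density_measurability.

Section final_measures.
Variables (R : realType) (V : finType) (E : {set {set V}}).
Variables (W : V -> V -> R) (i0 : V) (T0 : dtree E).
Hypothesis E2 : forall e : {set V}, e \in E -> #|e| = 2%N.
Hypothesis E_connected : connected_edges E.
Hypothesis W_sym : forall i j : V, adj E i j -> W i j = W j i.
Hypothesis W_gt0 : forall i j : V, adj E i j -> 0 < W i j.

Local Notation H := (flow R E).
Local Notation Omega := (pinned R i0).
Local Notation vert := (vertex_space i0).
Local Notation tree := (tree_space T0).
Local Notation m := #|{: {i : V | i != i0}}|.
Local Notation N := #|{: {a : darc E | a \notin val T0}}|.

Definition vert_mu : set vert -> \bar R := @fin_counting R V i0.
HB.instance Definition _ := SigmaFiniteMeasure.on vert_mu.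
Definition tree_mu : set tree -> \bar R := @fin_counting R (stree E) (undirected T0).
HB.instance Definition _ := SigmaFiniteMeasure.on tree_mu.

Lemma integral_vert (f : vert -> \bar R) : (forall x, 0 <= f x)%E ->
  (\int[vert_mu]_x f x = \sum_(x : V) f x)%E.
Proof. exact: integral_fin_counting. Qed.

Lemma integral_tree (f : tree -> \bar R) : (forall x, 0 <= f x)%E ->
  (\int[tree_mu]_x f x = \sum_(x : stree E) f x)%E.
Proof. exact: integral_fin_counting. Qed.

Lemma sum_stree (F : {set {set V}} -> R) :
  \sum_(T : stree E) F (val T) = \sum_(T | is_spanning_tree E T) F T.
Proof.
rewrite [RHS](reindex_omap (fun T : stree E => val T) insub)/=.
  by apply: eq_bigl => T; rewrite (valP T) valK eqxx.
by move=> T sT; rewrite insubT.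
Qed.

Definition big_fun (x : H * H * Omega * Omega * vert * vert * tree * tree) : \bar R :=
  let: (k, k', s, u, i1, i1', T, T') := x in
  (rho_big W i0 (val k) (val k') (val s) (val u) (val u) i1 i1'
    (val (T : stree E)) (val (T' : stree E)))%:E.

Definition single_fun (x : H * Omega * vert * tree) : \bar R :=
  let: (k, v, i1, T) := x in
  (rho_single W i0 (val k) (val v) i1 (val (T : stree E)))%:E.

Lemma single_const_ge0 (k : darc E -> R) u i1 : 0 <= single_const W i0 k u i1.
Proof.
rewrite !mulr_ge0 ?expR_ge0 ?invr_ge0//; first by rewrite ltW// (vertex_total_gt0 i0).
by apply: prodr_ge0 => i _; exact: expR_ge0.
Qed.

Lemma prod_wt_ge0 u (S : {set {set V}}) : S \subset E -> 0 <= \prod_(e in S) wt W u e.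
Proof.
by move=> SE; apply: prodr_ge0 => e eS; rewrite ltW// (wt_gt0 E2)//; exact: (fintype.subsetP SE).
Qed.

Lemma stree_sub (T : stree E) : val T \subset E.
Proof. by case/and3P: (valP T). Qed.

Lemma single_fun_ge0 x : (0 <= single_fun x)%E.
Proof.
case: x => [[[k v] i1] T] /=.
rewrite lee_fin (rho_singleE i0 E2 W_sym W_gt0) ?(stree_sub T)//.
apply: mulr_ge0; last exact: single_const_ge0.
by rewrite !mulr_ge0 ?invr_ge0 ?exprn_ge0 ?pi_ge0 ?prod_wt_ge0 ?(stree_sub T).
Qed.

Lemma measurable_single_fun : measurable_fun setT single_fun.
Proof.
rewrite (_ : single_fun = fun x => (rho_single W i0 (val x.1.1.1) (val x.1.1.2) x.1.2 (val (x.2 : stree E)))%:E); last first.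
  by apply/funext => -[[[k v] i1] T].
have [mk mv mi mT] := @measurable_proj4 _ _ _ _ _ (H * Omega * vert * tree)%type
  H Omega vert tree id (@measurable_id _ _ _).
by apply/measurable_EFinP; exact: (measurable_rho_single E2 W_sym W_gt0 mv mk mi mT).
Qed.

Lemma big_funE x : big_fun x = ((4 ^+ m / (2 * pi) ^+ (2 * #|E|)%N
    * ((\prod_(e in val (x.1.2 : stree E)) wt W (val x.1.1.1.1.2) e) / 2 ^+ m) / 2 ^+ m
    * (4 ^+ #|E| / (\prod_(e in E) wt W (val x.1.1.1.1.2) e) ^+ 2)
    * single_const W i0 (val x.1.1.1.1.1.1.1) (val x.1.1.1.1.2) x.1.1.1.2)
  * flow_weight W (val x.1.1.1.1.2) (val x.1.1.1.1.1.1.2)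
  * spin_weight E W (val x.1.1.1.1.2) (val x.1.1.1.1.1.2)
  * (expR (2 * val x.1.1.1.1.2 x.1.1.2) / vertex_total (val x.1.1.1.1.2))
  * \prod_(e in val (x.2 : stree E)) wt W (val x.1.1.1.1.2) e)%:E.
Proof.
case: x => [[[[[[[k k'] s] u] i1] i1'] T] T'] /=.
by rewrite (rho_bigE i0 E2 W_sym W_gt0) //; [exact: (valP (T : stree E))|exact: (valP (T' : stree E))].
Qed.

Lemma big_const_ge0 (k : darc E -> R) u i1 (T : stree E) :
  0 <= 4 ^+ m / (2 * pi) ^+ (2 * #|E|)%N
    * ((\prod_(e in val T) wt W u e) / 2 ^+ m) / 2 ^+ m
    * (4 ^+ #|E| / (\prod_(e in E) wt W u e) ^+ 2) * single_const W i0 k u i1.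
Proof.
apply: mulr_ge0; last exact: single_const_ge0.
by rewrite !mulr_ge0 ?invr_ge0 ?exprn_ge0 ?mulr_ge0 ?pi_ge0 ?prod_wt_ge0 ?stree_sub.
Qed.

Lemma big_fun_ge0 x : (0 <= big_fun x)%E.
Proof.
rewrite big_funE lee_fin; apply: mulr_ge0; last by rewrite prod_wt_ge0 ?stree_sub.
apply: mulr_ge0; last by rewrite mulr_ge0 ?invr_ge0 ?expR_ge0// ltW// (vertex_total_gt0 i0).
by do 2! (apply: mulr_ge0; last exact: expR_ge0); exact: big_const_ge0.
Qed.

Lemma measurable_big_fun : measurable_fun setT big_fun.
Proof.
rewrite (funext big_funE); apply/measurable_EFinP.
have [m5 mi' mT mT'] := @measurable_proj4 _ _ _ _ _ (H * H * Omega * Omega * vert * vert * tree * tree)%type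
  (H * H * Omega * Omega * vert)%type vert tree tree id (@measurable_id _ _ _).
have [mkk ms mu mi] := measurable_proj4 m5.
have mk := measurableT_comp measurable_fst mkk.
have mk' := measurableT_comp measurable_snd mkk.
apply: measurable_funM; last exact: (measurable_prod_wt_tree W mu mT').
apply: measurable_funM; last exact: (measurable_vertex_prob mu mi').
apply: measurable_funM; last exact: (measurable_spin_weight_joint E W mu ms).
apply: measurable_funM; last exact: (measurable_flow_weight_joint E2 W_sym W_gt0 mu mk').
apply: measurable_funM; last exact: (measurable_single_const E2 W_sym W_gt0 mu mk mi).
apply: measurable_funM.
  apply: measurable_funM; last exact: measurable_cst.
  apply: measurable_funM; first exact: measurable_cst.
  apply: measurable_funM; last exact: measurable_cst.
  exact: (measurable_prod_wt_tree W mu mT).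
apply: measurable_funM; first exact: measurable_cst.
exact: (measurable_prod_wt_invX E2 W_sym W_gt0 mu 2).
Qed.

Section with_flow_measure.
Variable MF : {sigma_finite_measure set H -> \bar R}.
Hypothesis MF_flow : forall u, (\int[MF]_k (flow_weight W u (val k))%:E =
   (Num.sqrt (pi ^+ N / (2 ^+ m * tree_weight E W u)) * \prod_(e in E) wt W u e)%:E)%E.

Lemma integral_big_fun (k : H) (u : Omega) (i1 : vert) (T : tree) :
  (\int[MF]_k' \int[@pinned_mu R V i0]_s \int[vert_mu]_i1' \int[tree_mu]_T'
     big_fun (k, k', s, u, i1, i1', T, T') = single_fun (k, u, i1, T))%E.
Proof.
(* The prefactor of the density that is free of k', s, i1' and T'. *)
pose a := 4 ^+ m / (2 * pi) ^+ (2 * #|E|)%N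
    * ((\prod_(e in val (T : stree E)) wt W (val u) e) / 2 ^+ m) / 2 ^+ m
    * (4 ^+ #|E| / (\prod_(e in E) wt W (val u) e) ^+ 2) * single_const W i0 (val k) (val u) i1.
have a0 : 0 <= a by exact: big_const_ge0.
have d0 : 0 < tree_weight E W (val u) by exact: (tree_weight_gt0 i0).
(* The sum over T' gives D, and the vertex probabilities sum to 1 over i1'. *)
have inner k' s : (\int[vert_mu]_i1' \int[tree_mu]_T' big_fun (k, k', s, u, i1, i1', T, T') =
    ((a * tree_weight E W (val u))%:E * (flow_weight W (val u) (val k'))%:E) *
      (spin_weight E W (val u) (val s))%:E)%E.
  rewrite integral_vert; last by move=> x; apply: integral_ge0 => y _; exact: big_fun_ge0.
  transitivity (\sum_(i : V) ((a * flow_weight W (val u) (val k') * spin_weight E W (val u) (val s)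
      * tree_weight E W (val u)) * (expR (2 * val u i) / vertex_total (val u)))%:E)%E.
    apply: eq_bigr => i _; rewrite integral_tree; last by move=> x; exact: big_fun_ge0.
    transitivity (\sum_(T' : stree E) (a * flow_weight W (val u) (val k') * spin_weight E W (val u) (val s)
      * (expR (2 * val u i) / vertex_total (val u)) * \prod_(e in val T') wt W (val u) e)%:E)%E.
      by apply: eq_bigr => T' _; rewrite big_funE.
    rewrite sumEFin -mulr_sumr (sum_stree (fun S => \prod_(e in S) wt W (val u) e)) -/(tree_sum E _).
    rewrite -/(tree_weight E W (val u)); congr EFin.
    by move: (a * _ * _) (_ / _) (tree_weight E W _) => x y z; ring.
  rewrite sumEFin -mulr_sumr (sum_vertex_prob i0) mulr1 -!EFinM; congr EFin.
  by move: (a) (flow_weight _ _ _) (spin_weight _ _ _ _) (tree_weight _ _ _) => x0 x y z; ring.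
pose b := a * tree_weight E W (val u) * Num.sqrt ((2 * pi) ^+ m / tree_weight E W (val u)).
transitivity (\int[MF]_k' (b%:E * (flow_weight W (val u) (val k'))%:E))%E.
  apply: eq_integral => k' _; under eq_integral do rewrite inner -EFinM.
  rewrite integral_scale; first last.
  - by apply: mulr_ge0; [apply: mulr_ge0 a0 (ltW d0)|exact: expR_ge0].
  - by move=> s; exact: expR_ge0.
  - exact: measurable_spin_weight.
  rewrite (integral_spin i0 E2 E_connected W_sym W_gt0) -!EFinM; congr EFin.
  by rewrite /b mulrAC.
rewrite integral_scale; first last.
- by apply: mulr_ge0 (sqrtr_ge0 _); exact: mulr_ge0 a0 (ltW d0).
- by move=> k'; exact: expR_ge0.
- exact: measurable_flow_weight.
rewrite MF_flow -!EFinM /single_fun (rho_singleE i0 E2 W_sym W_gt0); last first.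
  by case/and3P: (valP (T : stree E)).
rewrite -(big_constant i0 T0 E2 E_connected W_sym W_gt0 (val u)) -/a; congr EFin.
rewrite /b; set r1 := Num.sqrt _; set r2 := Num.sqrt _.
by move: (a) r1 r2 (tree_weight E W _) (\prod_(e in E) _) => x r1 r2 y z; ring.
Qed.

(** The sum over T gives D and the sum over i1 gives 1. After the Gaussian integral over k, what
    remains is the density of the sigma model divided by its known mass. *)
Lemma mass_single_fun :
  (\int[sf_prod (sf_prod (sf_prod MF (@pinned_mu R V i0)) vert_mu) tree_mu]_x single_fun x = 1)%E.
Proof.
have msf := measurable_single_fun; have sf0 := single_fun_ge0.
rewrite (integral_sf_prod4 _ _ _ _ msf sf0).
pose g (u : V -> R) := (pi ^+ #|E|)^-1 * tree_weight E W u / (\prod_(e in E) wt W u e) *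
   edge_weight E W u * \prod_(i | i != i0) expR (- u i).
have P0 (u : V -> R) : 0 < \prod_(e in E) wt W u e.
  by apply: prodr_gt0 => e; exact: (wt_gt0 E2).
have g0 u : 0 <= g u.
  rewrite !mulr_ge0 ?invr_ge0 ?exprn_ge0 ?pi_ge0 ?expR_ge0 ?(ltW (P0 u))//.
    by rewrite ltW// (tree_weight_gt0 i0).
  by apply: prodr_ge0 => i _; exact: expR_ge0.
pose G (z : H * Omega) : \bar R := (g (val z.2) * flow_weight W (val z.2) (val z.1))%:E.
have G0 z : (0 <= G z)%E by rewrite lee_fin mulr_ge0// expR_ge0.
have mg : measurable_fun [set: Omega] (fun u => g (val u) : R).
  apply: measurable_funM; last exact: measurable_prod_expRN.
  apply: measurable_funM; last exact: measurable_edge_weight.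
  apply: measurable_funM; first by apply: measurable_funM => //; exact: measurable_tree_weight.
  exact: (measurable_prod_wt_invX E2 W_sym W_gt0 (u := id) (@measurable_id _ _ _) 1).
have mG : measurable_fun setT G.
  apply/measurable_EFinP; apply: measurable_funM.
    by apply: (measurableT_comp mg); measurable_proj.
  by apply: (measurable_flow_weight_joint E2 W_sym W_gt0); measurable_proj.
transitivity (\int[MF]_k \int[@pinned_mu R V i0]_u G (k, u))%E.
  apply: eq_integral => k _; apply: eq_integral => u _.
  rewrite integral_vert; last by move=> i; apply: integral_ge0.
  transitivity (\sum_(i : V) (g (val u) * flow_weight W (val u) (val k) *
      (expR (2 * val u i) / vertex_total (val u)))%:E)%E.
    apply: eq_bigr => i _; rewrite integral_tree//.
    transitivity (\sum_(T : stree E) ((pi ^+ #|E|)^-1 / (\prod_(e in E) wt W (val u) e)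
        * single_const W i0 (val k) (val u) i * \prod_(e in val T) wt W (val u) e)%:E)%E.
      apply: eq_bigr => T _; rewrite /single_fun (rho_singleE i0 E2 W_sym W_gt0); last first.
        by case/and3P: (valP T).
      congr EFin; move: (\prod_(e in val T) _) ((pi ^+ _)^-1) (\prod_(e in E) _) (single_const _ _ _ _ _).
      by move=> x y z t; ring.
    rewrite sumEFin -mulr_sumr (sum_stree (fun S => \prod_(e in S) wt W (val u) e)) -/(tree_sum E _).
    rewrite -/(tree_weight E W (val u)) /g /single_const; congr EFin.
    move: (tree_weight _ _ _) ((pi ^+ _)^-1) (\prod_(e in E) _) (edge_weight _ _ _) (flow_weight _ _ _) (\prod_(i | i != i0) _) (_ / vertex_total _).
    by move=> x1 x2 x3 x4 x5 x6 x7; ring.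
  by rewrite sumEFin -mulr_sumr (sum_vertex_prob i0) mulr1.
(* The k-integral has to be the inner one, because its value is known at fixed u. *)
rewrite exchange_integral//.
transitivity (\int[@pinned_mu R V i0]_u (((Num.sqrt (2 * pi) ^+ m)^-1)%:E *
    (graph_density_fun E W i0 (val u))%:E))%E.
  apply: eq_integral => u _; rewrite /G /=.
  under eq_integral do rewrite EFinM.
  rewrite integral_scale; first last.
  - exact: g0.
  - by move=> k; exact: expR_ge0.
  - exact: measurable_flow_weight.
  rewrite MF_flow -!EFinM; congr EFin.
  transitivity ((pi ^+ #|E|)^-1 * tree_weight E W (val u) / (\prod_(e in E) wt W (val u) e)
    * (Num.sqrt (pi ^+ N / (2 ^+ m * tree_weight E W (val u))) * \prod_(e in E) wt W (val u) e)
    * (edge_weight E W (val u) * \prod_(i | i != i0) expR (- val u i))).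
    rewrite /g; move: (_ / (\prod_(e in E) _)) (edge_weight _ _ _) (\prod_(i | i != i0) _) (Num.sqrt _ * _).
    by move=> x y z t; ring.
  rewrite (mass_constant i0 T0 E2 E_connected W_sym W_gt0) /graph_density_fun.
  move: ((Num.sqrt _ ^+ _)^-1) (edge_weight _ _ _) (\prod_(i | i != i0) _) (Num.sqrt (tree_weight _ _ _)).
  by move=> x y z t; ring.
have s0 : 0 < Num.sqrt (2 * pi) ^+ m :> R by rewrite exprn_gt0// sqrtr_gt0 mulr_gt0// pi_gt0.
rewrite integral_scale; first last.
- by rewrite invr_ge0 ltW.
- move=> u; rewrite !mulr_ge0 ?expR_ge0 ?sqrtr_ge0//.
  by apply: prodr_ge0 => i _; exact: expR_ge0.
- apply/measurable_EFinP; apply: measurable_funM; last exact: measurable_prod_expRN.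
  apply: measurable_funM; first exact: measurable_edge_weight.
  by apply: measurable_sqrt; exact: measurable_tree_weight.
by rewrite (integral_graph_density i0 E2)// -EFinM mulVf// gt_eqF.
Qed.

End with_flow_measure.

End final_measures.

(** * Reduction of the marginal to iterated integrals *)

Section regroup_marginal.
Local Open Scope ereal_scope.
Context dk du di dj (K : measurableType dk) (U : measurableType du)
  (I : measurableType di) (J : measurableType dj) (R : realType).
Variables (mk : {sigma_finite_measure set K -> \bar R}) (mu : {sigma_finite_measure set U -> \bar R})
  (mi : {sigma_finite_measure set I -> \bar R}) (mj : {sigma_finite_measure set J -> \bar R}).
Variable h : K * K * U * U * I * I * J * J -> \bar R.
Hypotheses (mh : measurable_fun setT h) (h0 : forall x, 0 <= h x).

Let p (x : K * K * U * U * I * I * J * J) : K * U * I * J :=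
  (x.1.1.1.1.1.1.1, x.1.1.1.1.2, x.1.1.1.2, x.1.2).

(** Extending [h] by zero outside the preimage of [A] reduces to the whole space; the restriction
    depends on kept variables only and passes through the inner integrals. *)
Lemma integral_regroup_marginal (A : set (K * U * I * J)) : measurable A ->
  \int[sf_prod (sf_prod (sf_prod (sf_prod (sf_prod (sf_prod (sf_prod mk mk) mu) mu) mi) mi) mj) mj]_(x in p @^-1` A) h x =
  \int[sf_prod (sf_prod (sf_prod mk mu) mi) mj]_(z in A)
    \int[mk]_k' \int[mu]_s \int[mi]_i' \int[mj]_t'
      h (z.1.1.1, k', s, z.1.1.2, z.1.2, i', z.2, t').
Proof.
move=> mA; have mp : measurable_fun setT p by measurable_proj.
have mpA : measurable (p @^-1` A) by rewrite -[X in measurable X]setTI; exact: mp.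
have mhA : measurable_fun setT (h \_ (p @^-1` A)).
  by apply/(measurable_restrictT _ mpA); exact: measurable_funTS.
have hA0 x : 0 <= (h \_ (p @^-1` A)) x by rewrite patchE; case: ifP.
rewrite integral_mkcond (integral_regroup _ _ _ _ mhA hA0) [RHS]integral_mkcond.
apply: eq_integral => z _; rewrite [RHS]patchE; case: ifPn => zA.
  apply: eq_integral => k' _; apply: eq_integral => s _; apply: eq_integral => i' _.
  apply: eq_integral => t' _; rewrite patchE ifT// inE/=.
  by move: zA; rewrite inE; case: z => [[[? ?] ?] ?].
rewrite integral0_eq// => k' _; rewrite integral0_eq// => s _; rewrite integral0_eq// => i' _.
rewrite integral0_eq// => t' _; rewrite patchE ifN//; apply: contra zA.
by rewrite !inE/=; case: z => [[[? ?] ?] ?].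
Qed.

End regroup_marginal.

Section diagonal_marginal.
Local Open Scope ereal_scope.
Context dk du di dj (K : measurableType dk) (U : measurableType du)
  (I : measurableType di) (J : measurableType dj) (R : realType).
Variables (mk : {sigma_finite_measure set K -> \bar R}) (mu : {sigma_finite_measure set U -> \bar R})
  (mi : {sigma_finite_measure set I -> \bar R}) (mj : {sigma_finite_measure set J -> \bar R}).
Variable h : K * K * U * U * U * I * I * J * J -> \bar R.
Hypotheses (mh : measurable_fun setT h) (h0 : forall x, 0 <= h x).

Let diag (x : K * K * U * U * I * I * J * J) : K * K * U * U * U * I * I * J * J :=
  let: (k, k', s, u, i1, i1', T, T') := x in (k, k', s, u, u, i1, i1', T, T').
Let margin (x : K * K * U * U * U * I * I * J * J) : K * U * I * J :=
  let: (k, _, _, v, _, i1, _, T, _) := x in (k, v, i1, T).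

Let diagE x : diag x = (x.1.1.1.1.1, x.1.1.1.1.2, x.1.1.1.1.2, x.1.1.1.2, x.1.1.2, x.1.2, x.2).
Proof. by case: x => [[[[[[[? ?] ?] ?] ?] ?] ?] ?]. Qed.

Let marginE x : margin x = (x.1.1.1.1.1.1.1.1, x.1.1.1.1.1.2, x.1.1.1.2, x.1.2).
Proof. by case: x => [[[[[[[[? ?] ?] ?] ?] ?] ?] ?] ?]. Qed.

Lemma integral_diagonal_marginal (A : set (K * U * I * J)) : measurable A ->
  \int[pushforward (sf_prod (sf_prod (sf_prod (sf_prod (sf_prod (sf_prod (sf_prod mk mk) mu) mu) mi) mi) mj) mj)
     diag]_(x in margin @^-1` A) h x =
  \int[sf_prod (sf_prod (sf_prod mk mu) mi) mj]_(z in A)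
    \int[mk]_k' \int[mu]_s \int[mi]_i' \int[mj]_t'
      h (z.1.1.1, k', s, z.1.1.2, z.1.1.2, z.1.2, i', z.2, t').
Proof.
move=> mA.
have mdiag : measurable_fun setT diag by rewrite (funext diagE); measurable_proj.
have mmargin : measurable_fun setT margin by rewrite (funext marginE); measurable_proj.
rewrite ge0_integral_pushforward//; last first.
- exact: measurable_funTS.
- by rewrite -[X in measurable X]setTI; exact: mmargin.
have mhd : measurable_fun setT (h \o diag) by exact: measurableT_comp.
rewrite (_ : diag @^-1` _ = (fun x : K * K * U * U * I * I * J * J =>
    (x.1.1.1.1.1.1.1, x.1.1.1.1.2, x.1.1.1.2, x.1.2)) @^-1` A); last first.
  by apply/funext => x; rewrite /preimage/= diagE marginE.
exact: (integral_regroup_marginal mk mu mi mj mhd (fun x => h0 _) mA).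
Qed.

End diagonal_marginal.

(* The density has to be measurable jointly in (v, u), not only on the diagonal
   v = u that carries the measure. *)
Section diagonal.
Context dk du di dj (K : measurableType dk) (U : measurableType du)
  (I : measurableType di) (J : measurableType dj).

Definition drop_copy (x : K * U * U * I * I * J * J) : K * U * I * I * J * J :=
  (x.1.1.1.1.1.1, x.1.1.1.1.2, x.1.1.1.2, x.1.1.2, x.1.2, x.2).

Lemma measurable_drop_copy : measurable_fun setT drop_copy.
Proof. by measurable_proj. Qed.

Lemma measurable_copied : measurable_fun setT
  (fun x : K * U * U * I * I * J * J => x.1.1.1.1.1.2).
Proof. by measurable_proj. Qed.

End diagonal.

Section joint_density.
Variables (R : realType) (V : finType) (E : {set {set V}}).
Variables (W : V -> V -> R) (i0 : V) (T0 : dtree E).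
Hypothesis E2 : forall e : {set V}, e \in E -> #|e| = 2%N.
Hypothesis E_connected : connected_edges E.
Hypothesis W_sym : forall i j : V, adj E i j -> W i j = W j i.
Hypothesis W_gt0 : forall i j : V, adj E i j -> 0 < W i j.

Definition vertex_prob (u : V -> R) i : R := expR (2 * u i) / vertex_total u.

Lemma vertex_prob_gt0 u i : 0 < vertex_prob u i.
Proof. by rewrite divr_gt0 ?expR_gt0// (vertex_total_gt0 i0). Qed.

(** The only place of [v] is the probability of [i1]. A ratio of probabilities therefore carries
    measurability from the diagonal density to the joint one. *)
Lemma rho_big_copy (k k' : darc E -> R) s v u i1 i1' T T' :
  rho_big W i0 k k' s v u i1 i1' T T' =
  rho_big W i0 k k' s u u i1 i1' T T' * (vertex_prob v i1 / vertex_prob u i1).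
Proof.
rewrite /rho_big -!/(vertex_total _) /vertex_prob !expRD.
have := vertex_total_gt0 i0 v; have := vertex_total_gt0 i0 u.
move: (vertex_total u) (vertex_total v) (expR_gt0 (2 * u i1)) (expR (2 * u i1')) => x y.
move: (expR (2 * u i1)) (expR (2 * v i1)) (\prod_(i | i != i0) _) => a b p a0 c x0 y0.
set q := (X in X * _ * _ = _); rewrite -/q; move: q => q.
by field; rewrite !gt_eqF.
Qed.

Definition joint_fun (x : big_space R i0 T0) : \bar R :=
  let: (k, k', s, v, u, i1, i1', T, T') := x in
  (rho_big W i0 (val k) (val k') (val s) (val v) (val u) i1 i1'
    (val (T : stree E)) (val (T' : stree E)))%:E.

Lemma joint_funE x : joint_fun x = (big_fun W (drop_copy x) *
  (vertex_prob (val x.1.1.1.1.1.2) x.1.1.1.2 / vertex_prob (val x.1.1.1.1.2) x.1.1.1.2)%:E)%E.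
Proof.
by case: x => [[[[[[[[k k'] s] v] u] i1] i1'] T] T']; rewrite /joint_fun rho_big_copy.
Qed.

Lemma joint_fun_ge0 x : (0 <= joint_fun x)%E.
Proof.
rewrite joint_funE mule_ge0 ?(big_fun_ge0 E2 W_sym W_gt0)// lee_fin.
by rewrite ltW// divr_gt0 ?vertex_prob_gt0.
Qed.

Lemma measurable_joint_fun : measurable_fun setT joint_fun.
Proof.
rewrite (funext joint_funE).
have mq : measurable_fun [set: big_space R i0 T0] (fun x => drop_copy x).
  exact: measurable_drop_copy.
have mv : measurable_fun [set: big_space R i0 T0] (fun x => x.1.1.1.1.1.2).
  exact: measurable_copied.
have [m1 _ _ _] := measurable_proj4 mq.
have [_ _ mu mi] := measurable_proj4 m1.
apply: emeasurable_funM.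
  by apply: measurableT_comp mq; exact: measurable_big_fun.
apply/measurable_EFinP; apply: measurable_funM.
  exact: (measurable_vertex_prob mv mi).
apply: measurable_invr_gt0 => [|x]; last exact: vertex_prob_gt0.
exact: (measurable_vertex_prob mu mi).
Qed.

End joint_density.

Section reference_measures.
Variables (R : realType) (V : finType) (E : {set {set V}}) (i0 : V) (T0 : dtree E).
Variable MF : {sigma_finite_measure set (flow R E) -> \bar R}.
Hypothesis MF_eq : flow_measure (R := R) T0 = MF.
Local Notation vmu := (@vert_mu R V i0).
Local Notation tmu := (@tree_mu R V E T0).
Local Notation pmu := (@pinned_mu R V i0).

Lemma ref_singleE : @ref_single R V E i0 T0 = sf_prod (sf_prod (sf_prod MF pmu) vmu) tmu.
Proof. by rewrite /ref_single MF_eq pinned_measureE. Qed.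

Lemma ref_bigE : @ref_big R V E i0 T0 = pushforward
  (sf_prod (sf_prod (sf_prod (sf_prod (sf_prod (sf_prod (sf_prod MF MF) pmu) pmu) vmu) vmu) tmu) tmu)
  (@diag_vu R V E i0 T0).
Proof. by rewrite /ref_big MF_eq pinned_measureE. Qed.

End reference_measures.

Theorem theorem1p4 (R : realType) (V : finType) (E : {set {set V}})
    (W : V -> V -> R) (i0 : V) (T0 : dtree E)
    (edge_card : forall e : {set V}, e \in E -> #|e| = 2%N)
    (E_connected : connected_edges E)
    (W_sym : forall i j : V, adj E i j -> W i j = W j i)
    (W_gt0 : forall i j : V, adj E i j -> 0 < W i j) :
  (exists P : probability (single_space R i0 T0) R,
     forall A : set (single_space R i0 T0), measurable A ->
       P A = mu_single W i0 T0 A) /\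
  (forall A : set (single_space R i0 T0), measurable A ->
     pushforward (mu_big W i0 T0) (marginal i0 T0) A = mu_single W i0 T0 A).
Proof.
have [MF MF_eq MF_flow] := flow_mu_ex i0 T0 edge_card E_connected W_sym W_gt0.
have msf := measurable_single_fun (i0 := i0) (T0 := T0) edge_card W_sym W_gt0.
have sf0 := single_fun_ge0 (i0 := i0) (T0 := T0) edge_card W_sym W_gt0.
have mu_singleE A : mu_single W i0 T0 A = (\int[sf_prod (sf_prod (sf_prod MF
    (@pinned_mu R V i0)) (@vert_mu R V i0)) (@tree_mu R V E T0)]_(x in A) single_fun W x)%E.
  by rewrite /mu_single (ref_singleE i0 MF_eq).
split.
  have [P PE] := density_probability msf sf0
    (mass_single_fun edge_card E_connected W_sym W_gt0 MF_flow).
  by exists P => A mA; rewrite mu_singleE; exact: PE.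
move=> A mA; rewrite mu_singleE /pushforward /mu_big (ref_bigE i0 MF_eq).
have mjf := measurable_joint_fun (i0 := i0) (T0 := T0) edge_card W_sym W_gt0.
have jf0 := joint_fun_ge0 (i0 := i0) (T0 := T0) edge_card W_sym W_gt0.
etransitivity.
  exact: (integral_diagonal_marginal MF (@pinned_mu R V i0) (@vert_mu R V i0) (@tree_mu R V E T0) mjf jf0 mA).
apply: eq_integral => -[[[k u] i1] T] _.
(* At v = u the joint density computes to [big_fun], so the four inner integrals are already
   evaluated. *)
exact: (integral_big_fun edge_card E_connected W_sym W_gt0 MF_flow).
Qed.
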